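(* Let $K$ be a fixed constant and let $d_1(n),d_2(n),D_1(n),D_2(n)$ be integer-valued functions which for all large $n$ satisfy (a) $d_1(n)\le\min\{5,d_2(n),D_2(n)\}$ and $D_1(n)\le D_2(n)$; (b) $(d_1(n),D_2(n))\notin\{(3,3),(5,5)\}$ for odd $n$; (c) $D_2(n)\ge3$; and (d) $d_2(n)>0$ and $D_1(n)\le K$. Then $$\mathbf{P}\big[P_{n,d_1,5,0,D_2}\in\mathcal{P}(n,d_1,d_2,D_1,D_2)\big]\to1\quad\text{as } n\to\infty.$$
   Context: $\mathcal{P}(n,d_1,d_2,D_1,D_2)$ denotes the set of simple labelled planar graphs on $\{1,\ldots,n\}$ with minimum degree in $[d_1(n),d_2(n)]$ and maximum degree in $[D_1(n),D_2(n)]$; $P_{n,d_1,d_2,D_1,D_2}$ is chosen uniformly at random from it. Thus $P_{n,d_1,5,0,D_2}$ is uniform over planar graphs on $\{1,\ldots,n\}$ with all degrees between $d_1(n)$ and $D_2(n)$. *)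

(* Defs.v *)
From HB Require Import structures.
From mathcomp Require Import all_boot all_order all_algebra.
From mathcomp Require Import all_classical all_reals all_analysis.

Set Implicit Arguments.
Unset Strict Implicit.
Unset Printing Implicit Defensive.

Import Order.TTheory GRing.Theory Num.Theory.
Import numFieldNormedType.Exports.

Local Open Scope classical_set_scope.
Local Open Scope ring_scope.

(* A graph with vertex set V is given by its set of edges, a set of 2-subsets
   of V.  The labels 1, ..., n are represented by 'I_n. *)
Definition simple_graph (V : finType) (G : {set {set V}}) : bool :=
  [forall e in G, #|e| == 2%N].

Definition degree (V : finType) (G : {set {set V}}) (v : V) : nat :=
  #|[set e in G | v \in e]%SET|.

(* The default value n of the minimum is only reached when n = 0, since degrees
   in a simple graph are at most n - 1. *)
Definition min_degree (n : nat) (G : {set {set 'I_n}}) : nat :=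
  \big[minn/n]_(v < n) degree G v.

Definition max_degree (n : nat) (G : {set {set 'I_n}}) : nat :=
  \max_(v < n) degree G v.

(* A drawing without crossings: vertices are distinct points, every edge e is a
   simple arc (arc e, parametrized by [0, 1]) joining its two ends, and the
   interior of an arc meets neither a vertex nor the interior of another arc. *)
Definition plane_drawing (R : realType) (V : finType) (G : {set {set V}})
    (pos : V -> R * R) (arc : {set V} -> R -> R * R) : Prop :=
  [/\ injective pos,
      forall e, e \in G ->
        [/\ {within `[0, 1], continuous (arc e)},
            {in `[0, 1] &, injective (arc e)} &
            [set arc e 0; arc e 1] = pos @` [set` e]],
      forall e (t : R) v, e \in G -> 0 < t < 1 -> arc e t <> pos v &
      forall e f (s t : R), e \in G -> f \in G -> e != f ->
        0 < s < 1 -> 0 < t < 1 -> arc e s <> arc f t].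

Definition planar (R : realType) (V : finType) (G : {set {set V}}) : Prop :=
  exists (pos : V -> R * R) (arc : {set V} -> R -> R * R),
    plane_drawing G pos arc.

Definition planar_graphs (R : realType) (n : nat) (d1 d2 D1 D2 : int) :
    {set {set {set 'I_n}}} :=
  [set G : {set {set 'I_n}} |
    [&& simple_graph G, `[< planar R G >],
        d1 <= (min_degree G)%:Z <= d2 & D1 <= (max_degree G)%:Z <= D2]]%SET.

(* Equal to 0 when A is empty. *)
Definition uniform_probability (R : realType) (T : finType) (A E : {set T}) : R :=
  #|A :&: E|%:R / #|A|%:R.

(* Main.v *)
(* Let c_n be the number of connected planar graphs on n labelled vertices with
   all degrees in an interval. Deleting an edge in each of two such graphs and
   reconnecting them through a fixed regular graph (K_4, the octahedron or the
   icosahedron, according to the minimum degree allowed) stays in the class, and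
   the pair can be recovered up to boundedly many choices; hence c_m c_n / (m! n!)
   is at most a constant times c_(m+n+s) / (m+n+s)!, where moreover only graphs
   having a vertex of degree at most 5 are counted. As planar graphs have no K_5
   minor there are at most C^n n! of them, so U = sup (c_n / n!)^(1/n) is finite,
   and these graphs number at least (t U)^n n! for large n and any t < 1.

   A graph outside the event has minimum degree above d2 or maximum degree below
   D1. In either case one degree d allowed in a larger class does not occur;
   inserting about n/q gadgets that contain a vertex of degree d, for a large
   constant q, shows that such connected graphs number at most (rho U)^n n! with
   rho < 1, up to a constant, and then so do all such graphs. They are therefore
   negligible. For the minimum degree the comparison must be uniform in the
   maximum degree D2, which may depend on n: it is first made without any upper
   bound, and U is then approached by graphs with degrees below a constant.

   Planarity of the joined graphs is proved by moving a drawing into a half plane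
   with the chosen edge crossing its boundary; the absence of K_5 minors comes
   from counting crossings modulo 2 along finite chains of points. *)

(* Exchanging edges u1v1 and u2v2 for u1u2 and v1v2 keeps every degree, so one construction serves
   all degree intervals. It keeps connectedness if one of the two edges is not a bridge, and an edge
   of an arbitrary connected graph may be one. Hence the fixed regular graph in between: two
   disjoint edges can be deleted from it without disconnecting it. It also supplies the vertex of
   degree at most 5 asked for by the bound on the minimum degree, so Euler's formula never enters;
   linear bounds on the number of edges come from excluded minors.

   A connected graph of order n can be cut at n or more places. When an inserted gadget carries a
   degree that occurred nowhere before, it is found again among the few vertices of that degree. So
   j insertions gain n^j / j! up to a factor C^j, which is exponential when j is a small fraction of
   n.

   Cutting needs connected graphs. The passage to all graphs splits off the component of a fixed
   vertex and raises the growth rate by an arbitrarily small factor, which the gap between rho and 1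
   absorbs. *)
Require Import Defs.
From Stdlib Require ZArith Btauto.
From mathcomp Require Import all_boot all_order all_algebra.
From mathcomp Require all_classical all_reals all_analysis zify ssrZ ring lra.

Set Implicit Arguments.
Unset Strict Implicit.
Unset Printing Implicit Defensive.

(** * Graphs, clique minors and the number of sparse graphs *)

Module Graphs.
Import boolp zify.

Section Pairs.
Variable V : finType.

Lemma set2_eqP (a b c d : V) :
  [set a; b] = [set c; d] -> (a = c /\ b = d) \/ (a = d /\ b = c).
Proof.
move=> E.
have := set21 a b; rewrite E !inE => /orP [] /eqP Ea;
have := set22 a b; rewrite E !inE => /orP [] /eqP Eb;
have := set21 c d; rewrite -E !inE => /orP [] /eqP Ec;
have := set22 c d; rewrite -E !inE => /orP [] /eqP Ed;
subst; auto.
Qed.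

End Pairs.

Section Graphs.
Variable V : finType.
Implicit Types (G : {set {set V}}) (S : {set V}) (x y z u v : V).

Definition adj G : rel V := fun x y => [set x; y] \in G.

Definition nbr G x : {set V} := [set y | adj G x y].

(** A graph on a vertex set [S] is a set of edges over an ambient type lying inside [S]; pieces can
    then be glued without changing types. *)
Definition supp G S : bool := [forall e in G, e \subset S].

Definition conn G S : bool :=
  [forall x in S, forall y in S, connect (adj G) x y].

Lemma adjC G x y : adj G x y = adj G y x.
Proof. by rewrite /adj setUC. Qed.

Lemma adj_connect_sym G : connect_sym (adj G).
Proof. by apply: sym_connect_sym => x y; rewrite adjC. Qed.

Lemma simple_neq G x y : simple_graph G -> adj G x y -> x != y.
Proof.
move=> /forall_inP sG /sG; apply: contraL => /eqP ->.
by rewrite setUid cards1.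
Qed.

Lemma simple_edgeP G e : simple_graph G -> e \in G ->
  exists x y, [/\ x != y, e = [set x; y] & adj G x y].
Proof.
move=> /forall_inP sG eG; have /cards2P [x [y [xy E]]] := sG _ eG.
by exists x, y; split=> //; rewrite /adj -E.
Qed.

Lemma graph_ext G G' : simple_graph G -> simple_graph G' ->
  adj G =2 adj G' -> G = G'.
Proof.
move=> sG sG' E; apply/setP => e; apply/idP/idP => H.
  by have [x [y [_ -> a]]] := simple_edgeP sG H; rewrite E in a.
by have [x [y [_ -> a]]] := simple_edgeP sG' H; rewrite -E in a.
Qed.

Lemma degree_nbr G x : simple_graph G -> degree G x = #|nbr G x|.
Proof.
move=> sG; rewrite /degree.
suff -> : [set e in G | x \in e] = [set [set x; y] | y in nbr G x].
  apply: card_in_imset => y z; rewrite !inE => ay az.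
  by case/set2_eqP => [[]|[E1 E2]] //; rewrite E2 -E1.
apply/setP => e; rewrite inE; apply/andP/imsetP => [[eG xe]|[y]].
  have [a [b [ab E aab]]] := simple_edgeP sG eG.
  move: xe; rewrite E !inE => /orP [] /eqP ->; first by exists b; rewrite ?inE.
  by exists a; rewrite ?inE 1?adjC // setUC.
by rewrite inE => a ->; rewrite set21.
Qed.

Lemma suppP G S x y : supp G S -> adj G x y -> (x \in S) /\ (y \in S).
Proof.
move=> /forall_inP sG /sG /subsetP H.
by split; apply: H; rewrite ?set21 ?set22.
Qed.

Lemma supp_nbr G S x : supp G S -> nbr G x \subset S.
Proof. by move=> sG; apply/subsetP => y; rewrite inE => /(suppP sG) []. Qed.

Lemma simple_sub G G' : G' \subset G -> simple_graph G -> simple_graph G'.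
Proof.
by move=> /subsetP sG /forall_inP H; apply/forall_inP => e /sG /H.
Qed.

Lemma connP G S x y : conn G S -> x \in S -> y \in S -> connect (adj G) x y.
Proof. by move=> /forall_inP H /H /forall_inP; apply. Qed.

Lemma conn_root G S r : (forall x, x \in S -> connect (adj G) r x) -> conn G S.
Proof.
move=> H; apply/forall_inP => x xS; apply/forall_inP => y yS.
by apply: connect_trans (H y yS); rewrite adj_connect_sym H.
Qed.

Lemma connect_adj_sub G G' x y :
  (forall a b, adj G a b -> connect (adj G') a b) ->
  connect (adj G) x y -> connect (adj G') x y.
Proof. by move=> H; apply: connect_sub H _ _. Qed.

Lemma adj_setD1 G x y a b :
  adj (G :\ [set a; b]) x y = ([set x; y] != [set a; b]) && adj G x y.
Proof. by rewrite /adj in_setD1. Qed.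

(** Follow a path from [u]: whenever it uses the deleted edge, restart at the end just reached. Even
    when the edge is a bridge, only the sides of [u] and [v] remain. *)
Lemma connect_cut G u v z : connect (adj G) u z ->
  connect (adj (G :\ [set u; v])) u z || connect (adj (G :\ [set u; v])) v z.
Proof.
case/connectP=> p; elim/last_ind: p z => [|p z' IH] z /=.
  by move=> _ ->; rewrite connect0.
rewrite rcons_path last_rcons => /andP [pp az] ->.
have := IH _ pp erefl; set w := last u p in az * => Hw.
have [E|Ne] := eqVneq [set w; z'] [set u; v].
  by case/set2_eqP: E => [[_ ->]|[_ ->]]; rewrite connect0 ?orbT.
have st : connect (adj (G :\ [set u; v])) w z'.
  by apply: connect1; rewrite adj_setD1 Ne.
by case/orP: Hw => H; rewrite (connect_trans H st) ?orbT.
Qed.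

End Graphs.

Section GraphMap.
Variables (V W : finType) (f : V -> W).
Hypothesis finj : injective f.
Implicit Types (G : {set {set V}}) (S : {set V}).

Definition gmap G : {set {set W}} := [set f @: (e : {set V}) | e in G].

Lemma imset_set2 (x y : V) : f @: [set x; y] = [set f x; f y].
Proof. by rewrite imsetU1 imset_set1. Qed.

Lemma mem_gmap G (e : {set V}) : (f @: e \in gmap G) = (e \in G).
Proof. by rewrite /gmap mem_imset //; apply: imset_inj. Qed.

Lemma gmap_inj : injective gmap.
Proof. by apply: imset_inj; apply: imset_inj. Qed.

Lemma adj_gmap G x y : adj (gmap G) (f x) (f y) = adj G x y.
Proof. by rewrite /adj -imset_set2 mem_gmap. Qed.

Lemma adj_gmapP G a b : simple_graph G -> adj (gmap G) a b ->
  exists x y, [/\ a = f x, b = f y & adj G x y].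
Proof.
move=> sG /imsetP [e eG]; have [x [y [xy -> axy]]] := simple_edgeP sG eG.
rewrite imset_set2 => /set2_eqP [[-> ->]|[-> ->]]; first by exists x, y.
by exists y, x; rewrite adjC.
Qed.

Lemma simple_gmap G : simple_graph (gmap G) = simple_graph G.
Proof.
apply/forall_inP/forall_inP => H e.
  by rewrite -mem_gmap => /H; rewrite card_imset.
by case/imsetP=> e' /H ? ->; rewrite card_imset.
Qed.

Lemma supp_gmap G S : supp (gmap G) (f @: S) = supp G S.
Proof.
apply/forall_inP/forall_inP => H e.
  rewrite -mem_gmap => /H /subsetP sub; apply/subsetP => x xe.
  by have := sub _ (imset_f f xe); rewrite mem_imset.
by case/imsetP=> e' /H ? ->; apply: imsetS.
Qed.

Lemma degree_gmap G x : degree (gmap G) (f x) = degree G x.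
Proof.
rewrite /degree.
suff -> : [set e in gmap G | f x \in e] =
          [set f @: (e : {set V}) | e in [set e in G | x \in e]].
  by rewrite card_imset //; apply: imset_inj.
apply/setP => e; rewrite inE; apply/andP/imsetP => [[]|[e']].
  by case/imsetP => e' eG ->; rewrite mem_imset // => xe; exists e'; rewrite ?inE ?eG.
by rewrite inE => /andP [eG xe] ->; rewrite mem_imset // mem_gmap.
Qed.

Lemma connect_gmap G x y :
  connect (adj G) x y -> connect (adj (gmap G)) (f x) (f y).
Proof.
case/connectP=> p; elim: p x => [|z p IH] x /= => [_ ->|].
  exact: connect0.
case/andP=> a pp E; apply: connect_trans (connect1 _) (IH _ pp E).
by rewrite adj_gmap.
Qed.

Lemma gmap_connect G x b : simple_graph G ->
  connect (adj (gmap G)) (f x) b -> exists2 y, b = f y & connect (adj G) x y.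
Proof.
move=> sG /connectP [p]; elim: p x => [|z p IH] x /= => [_ ->|].
  by exists x.
case/andP => /(adj_gmapP sG) [x' [y [/finj <- -> a]]] pp E.
have [y' -> c] := IH _ pp E; exists y' => //.
exact: connect_trans (connect1 a) c.
Qed.

Lemma conn_gmap G S : simple_graph G ->
  conn (gmap G) (f @: S) = conn G S.
Proof.
move=> sG; apply/idP/idP => H; apply/forall_inP => x xS; apply/forall_inP => y yS.
  have := connP H (imset_f f xS) (imset_f f yS).
  by case/(gmap_connect sG) => y' /finj ->.
case/imsetP: xS => x' x'S ->; case/imsetP: yS => y' y'S ->.
by apply: connect_gmap; apply: connP H _ _.
Qed.

Lemma gmap_setD1 G x y :
  gmap (G :\ [set x; y]) = gmap G :\ [set f x; f y].
Proof.
rewrite -imset_set2; apply/setP => e; rewrite in_setD1.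
apply/imsetP/andP => [[e']|[ne /imsetP [e' eG E]]].
  rewrite in_setD1 => /andP [ne eG] ->; rewrite mem_gmap; split=> //.
  by apply: contraNneq ne => /imset_inj -> .
exists e' => //; rewrite in_setD1 eG andbT.
by apply: contraNneq ne => <-; rewrite E.
Qed.

End GraphMap.

(** Each of the four ends loses one neighbour and gains one, so all degrees are kept
    ([degree_swap]). *)
Definition swap (V : finType) (G1 G2 : {set {set V}}) (u1 v1 u2 v2 : V) :=
  (G1 :\ [set u1; v1]) :|: (G2 :\ [set u2; v2])
    :|: [set [set u1; u2]; [set v1; v2]].

Lemma swapC (V : finType) (G1 G2 : {set {set V}}) (u1 v1 u2 v2 : V) :
  swap G1 G2 u1 v1 u2 v2 = swap G2 G1 u2 v2 u1 v1.
Proof. by rewrite /swap (setUC (G1 :\ _)) (setUC [set u1] [set u2]) (setUC [set v1] [set v2]). Qed.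

Lemma swapV (V : finType) (G1 G2 : {set {set V}}) (u1 v1 u2 v2 : V) :
  swap G1 G2 u1 v1 u2 v2 = swap G1 G2 v1 u1 v2 u2.
Proof.
rewrite /swap (setUC [set u1] [set v1]) (setUC [set u2] [set v2]).
by rewrite (setUC [set [set u1; u2]]).
Qed.

Section Swap.
Variables (V : finType) (S1 S2 : {set V}) (G1 G2 : {set {set V}}).
Variables (u1 v1 u2 v2 : V).
Hypotheses (dis : [disjoint S1 & S2]).
Hypotheses (s1 : supp G1 S1) (s2 : supp G2 S2).
Hypotheses (g1 : simple_graph G1) (g2 : simple_graph G2).
Hypotheses (a1 : adj G1 u1 v1) (a2 : adj G2 u2 v2).
Let G := swap G1 G2 u1 v1 u2 v2.

Let in1 x : x \in S1 -> x \in S2 = false.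
Proof. exact: disjointFr. Qed.

Let ne12 x y : x \in S1 -> y \in S2 -> x != y.
Proof. by move=> /in1 xS yS; apply: contraTneq yS => <-; rewrite xS. Qed.

Lemma adj_swap x y : adj G x y =
  [|| ([set x; y] != [set u1; v1]) && adj G1 x y,
      ([set x; y] != [set u2; v2]) && adj G2 x y,
      [set x; y] == [set u1; u2] | [set x; y] == [set v1; v2]].
Proof. by rewrite /G /swap /adj !inE !orbA. Qed.

Lemma swap_ends :
  [/\ u1 \in S1, v1 \in S1, u2 \in S2 & v2 \in S2] /\ u1 != v1 /\ u2 != v2.
Proof.
have [? ?] := suppP s1 a1; have [? ?] := suppP s2 a2.
by rewrite (simple_neq g1 a1) (simple_neq g2 a2).
Qed.

Lemma simple_swap : simple_graph G.
Proof.
have [[h1 h2 h3 h4] [h5 h6]] := swap_ends.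
apply/forall_inP => e; rewrite !inE -!orbA.
case/or4P => [/andP [_ ]|/andP [_]|/eqP ->|/eqP ->].
- by move/(forall_inP g1).
- by move/(forall_inP g2).
- by rewrite cards2 ne12.
- by rewrite cards2 ne12.
Qed.

Lemma supp_swap : supp G (S1 :|: S2).
Proof.
have [[h1 h2 h3 h4] [h5 h6]] := swap_ends.
apply/forall_inP => e; rewrite !inE -!orbA.
case/or4P => [/andP [_ ]|/andP [_]|/eqP ->|/eqP ->].
- by move/(forall_inP s1) => H; apply: subset_trans H (subsetUl _ _).
- by move/(forall_inP s2) => H; apply: subset_trans H (subsetUr _ _).
- by rewrite subUset !sub1set !inE h1 h3 orbT.
- by rewrite subUset !sub1set !inE h2 h4 orbT.
Qed.

(** Only the edge deleted from [G2] has to be a non-bridge: the edge from [u1] to [v1] is then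
    replaced by a detour through [S2]. *)
Lemma conn_swap : conn G1 S1 -> conn (G2 :\ [set u2; v2]) S2 ->
  conn G (S1 :|: S2).
Proof.
have [[h1 h2 h3 h4] [h5 h6]] := swap_ends.
move=> c1 c2.
have sub2 x y : connect (adj (G2 :\ [set u2; v2])) x y -> connect (adj G) x y.
  apply: connect_adj_sub => a b; rewrite adj_setD1 => H.
  by apply: connect1; rewrite adj_swap H !orbT.
have e1 : connect (adj G) u1 u2.
  by apply: connect1; rewrite adj_swap eqxx !orbT.
have e2 : connect (adj G) v2 v1.
  by apply: connect1; rewrite adjC adj_swap eqxx !orbT.
have e3 : connect (adj G) u1 v1.
  apply: connect_trans e1 (connect_trans _ e2).
  by apply: sub2; apply: connP c2 _ _.
have sub1 x y : connect (adj G1) x y -> connect (adj G) x y.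
  apply: connect_adj_sub => a b; have [E _|ne H] := eqVneq [set a; b] [set u1; v1].
    by case/set2_eqP: E => [[-> ->]|[-> ->]] //; rewrite adj_connect_sym.
  by apply: connect1; rewrite adj_swap ne H.
apply: (@conn_root _ _ _ u1) => x; rewrite inE => /orP [] xS.
  by apply: sub1; apply: connP c1 _ _.
by apply: connect_trans e1 _; apply: sub2; apply: connP c2 _ _.
Qed.

(** Together with [swap_cross] this undoes a swap: each side is an induced subgraph, and the
    crossing edges show where it was cut. *)
Lemma swap_side1 :
  [set e in G | e \subset S1] = G1 :\ [set u1; v1].
Proof.
have [[h1 h2 h3 h4] [h5 h6]] := swap_ends.
apply/setP => e; rewrite !inE; apply/andP/idP => [[]|/andP [ne eG]]; last first.
  by rewrite ne eG; split => //; apply: (forall_inP s1).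
rewrite -!orbA => /or4P [//|/andP [_ eG]|/eqP ->|/eqP ->] /subsetP sub.
- have [x [y [_ E a]]] := simple_edgeP g2 eG.
  have [xS _] := suppP s2 a.
  by have := sub x; rewrite E set21 => /(_ isT) /in1; rewrite xS.
- by have := sub _ (set22 _ _) => /in1; rewrite h3.
- by have := sub _ (set22 _ _) => /in1; rewrite h4.
Qed.

Lemma swap_cross x y : x \in S1 -> y \in S2 -> adj G x y ->
  (x = u1 /\ y = u2) \/ (x = v1 /\ y = v2).
Proof.
have [[h1 h2 h3 h4] [h5 h6]] := swap_ends.
move=> xS yS; rewrite adj_swap => /or4P [/andP [_ a]|/andP [_ a]|/eqP E|/eqP E].
- by have [_ /in1] := suppP s1 a; rewrite yS.
- by have [] := suppP s2 a; rewrite in1.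
- case/set2_eqP: E => [[-> ->]|[E _]]; first by left.
  by move: (ne12 xS h3); rewrite E eqxx.
- case/set2_eqP: E => [[-> ->]|[E _]]; first by right.
  by move: (ne12 xS h4); rewrite E eqxx.
Qed.

Lemma adj_swap_u : adj G u1 u2.
Proof. by rewrite adj_swap eqxx !orbT. Qed.

Lemma adj_swap_v : adj G v1 v2.
Proof. by rewrite adj_swap eqxx !orbT. Qed.

Lemma adj_swap1 x y : x \in S1 -> y \in S1 ->
  adj G x y = ([set x; y] != [set u1; v1]) && adj G1 x y.
Proof.
move=> xS yS; have := swap_side1 => /setP /(_ [set x; y]).
by rewrite in_set in_setD1 subUset !sub1set xS yS !andbT => E; rewrite /adj E.
Qed.

End Swap.

(** * Clique minors, contraction and the number of edges *)

Section Minor.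
Variable V : finType.
Implicit Types (e : rel V) (B S : {set V}).

Definition rin e B : rel V := [rel x y | [&& x \in B, y \in B & e x y]].

Lemma rinE e B x y : rin e B x y = [&& x \in B, y \in B & e x y].
Proof. by []. Qed.

Lemma rin_sub e B B' x y : B \subset B' ->
  connect (rin e B) x y -> connect (rin e B') x y.
Proof.
move=> /subsetP sB; apply: connect_sub => a b /and3P [aB bB eab].
by apply: connect1; rewrite rinE !sB.
Qed.

Lemma rin_connect_sym e B : symmetric e -> connect_sym (rin e B).
Proof.
move=> se; apply: sym_connect_sym => x y.
by rewrite !rinE andbCA se.
Qed.

(* The B i are the branch sets of a minor isomorphic to the complete graph. *)
Definition kmodel t e S (B : 'I_t -> {set V}) : Prop :=
  [/\ forall i, B i \subset S,
      forall i, exists x, x \in B i,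
      forall i j, i != j -> [disjoint B i & B j],
      forall i x y, x \in B i -> y \in B i -> connect (rin e (B i)) x y &
      forall i j, i != j -> exists x y, [/\ x \in B i, y \in B j & e x y]].

Definition kminor t e S : Prop := exists B : 'I_t -> {set V}, kmodel e S B.

Lemma kminorS t e S S' : S \subset S' -> kminor t e S -> kminor t e S'.
Proof.
move=> sS [B [H1 H2 H3 H4 H5]]; exists B; split=> // i.
exact: subset_trans (H1 i) sS.
Qed.

Lemma kminor_sub t e e' S : subrel e e' -> kminor t e S -> kminor t e' S.
Proof.
move=> sub [B [H1 H2 H3 H4 H5]]; exists B; split=> //.
  move=> i x y xB yB; apply: connect_sub (H4 i x y xB yB) => a b /and3P [aB bB eab].
  by apply: connect1; rewrite rinE aB bB sub.
by move=> i j /H5 [x [y [xB yB /sub exy]]]; exists x, y.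
Qed.

(* If e is obtained from e' by contracting the connected fibres of f, a model
   for e pulls back to a model for e'. *)
Lemma kminor_lift t (f : V -> V) e e' S S' : 1 < t ->
  (forall x y, f x = f y -> connect (rin e' [set z | f z == f x]) x y) ->
  (forall x y, e x y -> exists a b, [/\ f a = x, f b = y & e' a b]) ->
  (forall x, f x \in S -> x \in S') ->
  kminor t e S -> kminor t e' S'.
Proof.
move=> t1 fib edge sS [B [H1 H2 H3 H4 H5]].
pose B' i := [set z | f z \in B i].
have adjB i j : i != j -> exists x y, [/\ x \in B' i, y \in B' j & e' x y].
  move=> /H5 [x [y [xB yB /edge [a [b [fa fb eab]]]]]].
  by exists a, b; rewrite !inE fa fb.
exists B'; split => //.
- move=> i; apply/subsetP => x; rewrite inE => h; apply: sS.
  exact: subsetP (H1 i) _ h.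
- move=> i; pose j : 'I_t := if i == Ordinal t1 then Ordinal (ltnW t1) else Ordinal t1.
  have ij : i != j.
    by rewrite /j; case: (altP (i =P Ordinal t1)) => [->|//]; rewrite -val_eqE.
  by have [x [y [xB _ _]]] := adjB _ _ ij; exists x.
- move=> i j ij; apply/pred0P => x /=; rewrite !inE.
  by have /pred0P /(_ (f x)) := H3 i j ij.
- move=> i x y; rewrite !inE => xB yB.
  have fibB a b : f a = f b -> f a \in B i -> connect (rin e' (B' i)) a b.
    move=> fab aB; apply: rin_sub (fib _ _ fab); apply/subsetP => z.
    by rewrite !inE => /eqP ->.
  have /connectP [p] := H4 i _ _ xB yB.
  elim: p x xB => [|z p IH] x xB /= => [_ /esym E|]; first exact: fibB.
  case/andP => /and3P [_ zB exz] pp E.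
  have [a [b [fa fb eab]]] := edge _ _ exz.
  rewrite -fb in zB pp E *; apply: connect_trans (IH b zB pp E).
  apply: connect_trans (fibB x a (esym fa) xB) _.
  by apply: connect1; rewrite rinE !inE fa fb xB -fb zB.
Qed.

(* Each edge is counted twice. *)
Definition esize e : nat := \sum_x #|[set y | e x y]|.

(** Merges [v] into [w] and leaves [v] isolated, so the vertex type stays the same. Adjacent
    vertices and twins are merged in the same way. *)
Definition contract e (v w : V) : rel V := [rel x y |
  [&& x != v, y != v, x != y &
      [|| e x y, (x == w) && e v y | (y == w) && e v x]]].

Definition graph_on e S : Prop :=
  [/\ symmetric e, irreflexive e & forall x y, e x y -> x \in S].

Lemma contractE e v w x y : contract e v w x y = [&& x != v, y != v, x != y &
  [|| e x y, (x == w) && e v y | (y == w) && e v x]].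
Proof. by []. Qed.

Lemma graph_on_contract e S v w : graph_on e S -> w \in S ->
  graph_on (contract e v w) (S :\ v).
Proof.
case=> se ie sup wS; split.
- move=> x y; rewrite !contractE (eq_sym x y) se.
  by case: (x != v); case: (y != v) => //=; rewrite [(x == w) && _ || _]orbC.
- by move=> x; rewrite contractE eqxx !andbF.
- move=> x y; rewrite contractE => /and4P [xv yv xy h]; rewrite !inE xv /=.
  case/or3P: h => [/sup //|/andP [/eqP -> _] //|/andP [_]].
  by rewrite se => /sup.
Qed.

Lemma contract_minor t e S v w : 1 < t -> graph_on e S -> e v w ->
  kminor t (contract e v w) (S :\ v) -> kminor t e S.
Proof.
move=> t1 [se ie sup] evw.
have wv : w != v by apply: contraTneq evw => ->; rewrite ie.
apply: (@kminor_lift _ (fun x => if x == v then w else x)) => //.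
- have vw : connect (rin e [set z | (if z == v then w else z) == w]) v w.
    by apply: connect1; rewrite rinE !inE eqxx (negbTE wv) /= eqxx evw.
  move=> x y; case: (eqVneq x v) => [->|xv]; case: (eqVneq y v) => [->|yv] E.
  + exact: connect0.
  + by rewrite -E; exact: vw.
  + by rewrite E rin_connect_sym.
  + by rewrite E; exact: connect0.
- move=> x y; rewrite contractE => /and4P [xv yv xy /or3P [h|/andP [/eqP -> h]|/andP [/eqP -> h]]].
  + by exists x, y; rewrite (negbTE xv) (negbTE yv).
  + by exists v, y; rewrite eqxx (negbTE yv).
  + by exists x, v; rewrite eqxx (negbTE xv) se.
- move=> x; case: eqVneq => [->|xv]; rewrite !inE; last by case/andP.
  by move=> _; apply: sup evw.
Qed.

(** What is lost is the edge from [v] to [w], and one edge for each common neighbour [x], where the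
    edges to [v] and [w] become one; each is counted twice. [H1] accounts for the row of [w], [H2]
    for the rows of the other vertices. *)
Lemma esize_contract e S v w : graph_on e S -> e v w ->
  esize e <= esize (contract e v w) + 2 + 2 * #|[set x | e v x && e w x]|.
Proof.
case=> se ie sup evw; have wv : w != v by apply: contraTneq evw => ->; rewrite ie.
set C := [set x | e v x && e w x]; set e' := contract e v w.
have vN x : e v x -> x != v by move=> h; apply: contraTneq h => ->; rewrite ie.
rewrite /esize (bigD1 v) //= (bigD1 w) //=.
rewrite [X in _ <= X + _ + _](bigD1 v) //= [X in _ <= _ + X + _ + _](bigD1 w) //=.
set N := [set y | e v y].
have H1 : #|N| + #|[set y | e w y]| <= #|[set y | e' w y]| + 2 + #|C|.
  have E : [set y | e' w y] = (N :|: [set y | e w y]) :\ v :\ w.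
    apply/setP => y; rewrite !inE /e' contractE eqxx wv /= (eq_sym w y).
    case: (eqVneq y w) => [->|yw] /=; first by rewrite !andbF.
    by case: (eqVneq y v) => //= yv; rewrite orbF orbC.
  have := cardsUI N [set y | e w y].
  have -> : N :&: [set y | e w y] = C by apply/setP => y; rewrite !inE.
  rewrite E; have := cardsD1 v (N :|: [set y | e w y]).
  have := cardsD1 w ((N :|: [set y | e w y]) :\ v).
  by case: (v \in _); case: (w \in _); lia.
have H2 : \sum_(x | (x != v) && (x != w)) #|[set y | e x y]| <=
    \sum_(x | (x != v) && (x != w)) #|[set y | e' x y]| + #|C|.
  have -> : #|C| = \sum_x (x \in C) by rewrite -sum1_card big_mkcond.
  rewrite [\sum_x _](bigID (fun x => (x != v) && (x != w))) /=.
  apply: leq_trans (leq_add (leqnn _) (leq_addr _ _)); rewrite -big_split /=.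
  apply: leq_sum => x /andP [xv xw].
  have subN : [set y | e x y] :\ v \subset [set y | e' x y].
    apply/subsetP => y; rewrite !inE => /andP [yv exy].
    by rewrite /e' contractE xv yv exy andbT /=; apply: contraTneq exy => ->; rewrite ie.
  have cN := cardsD1 v [set y | e x y]; rewrite inE se in cN.
  have [evx|nvx] := boolP (e v x); last first.
    by rewrite cN (negbTE nvx) add0n; apply: leq_trans (subset_leq_card subN) (leq_addr _ _).
  have [ewx|nwx] := boolP (e w x).
    have -> : x \in C by rewrite inE evx ewx.
    by rewrite cN evx addnC leq_add2r; apply: subset_leq_card.
  have -> : x \in C = false by rewrite inE evx (negbTE nwx).
  rewrite cN evx addn0.
  have wN : w \in [set y | e' x y].
    by rewrite inE /e' contractE xv wv xw eqxx evx !orbT.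
  rewrite (cardsD1 w [set y | e' x y]) wN leq_add2l; apply: subset_leq_card.
  apply/subsetP => y yN; rewrite in_setD1 (subsetP subN _ yN) andbT.
  by apply: contraTneq yN => ->; rewrite !inE negb_and se nwx orbT.
by lia.
Qed.

(** If some edge has fewer than 2 ^ t.+1 common neighbours, contracting it loses at most 2 * 2 ^
    t.+1 in [esize] and one vertex, so the density hypothesis survives. Otherwise the neighbourhood
    of any non-isolated vertex [v] satisfies the hypothesis for [t], and [v] itself is one more
    branch set. *)
Lemma mader t e S : graph_on e S -> S != set0 -> 2 * 2 ^ t * #|S| <= esize e ->
  kminor t.+2 e S.
Proof.
elim: t e S => [|t IHt] e S.
  case=> se ie sup S0 big.
  have [[x y] /= exy|noe] := pickP (fun p : V * V => e p.1 p.2).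
    have xy : x != y by apply: contraTneq exy => ->; rewrite ie.
    have yS : y \in S by apply: (sup y x); rewrite se.
    have xS := sup _ _ exy.
    exists (fun i => if i == ord0 then [set x] else [set y]); split.
    - by move=> i; case: ifP; rewrite sub1set.
    - by move=> i; case: ifP; [exists x|exists y]; rewrite inE.
    - move=> i j ij; have [E | i0] := eqVneq i ord0.
        by move: ij; rewrite E eq_sym => /negbTE ->; rewrite disjoints1 inE.
      have -> : j = ord0 by apply/val_inj; case: i j ij i0 => [[|[]]] // ? [[|[]]].
      by rewrite eqxx disjoints1 inE eq_sym.
    - by move=> i a b; case: ifP => _; rewrite !inE => /eqP -> /eqP ->; apply: connect0.
    - move=> i j ij; have [E | i0] := eqVneq i ord0.
        move: ij; rewrite E eq_sym => /negbTE ->.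
        by exists x, y; rewrite !inE !eqxx.
      have -> : j = ord0 by apply/val_inj; case: i j ij i0 => [[|[]]] // ? [[|[]]].
      by rewrite eqxx; exists y, x; rewrite !inE !eqxx se.
  move: big; have -> : esize e = 0.
    by rewrite /esize big1 // => x _; apply/eqP; rewrite cards_eq0; apply/eqP/setP => y; rewrite !inE (noe (x, y)).
  by rewrite leqn0 muln_eq0 cards_eq0 (negbTE S0).
have [k] := ubnP #|S|; elim: k e S => // k IHk e S Sk gr S0 big.
have [se ie sup] := gr.
have c0 : 0 < 2 ^ t by rewrite expn_gt0.
have [[v w] /= /andP [evw few]|many] := pickP (fun p : V * V =>
    e p.1 p.2 && (#|[set x | e p.1 x && e p.2 x]| < 2 ^ t.+1)).
  have vS := sup _ _ evw; have wS : w \in S by apply: (sup w v); rewrite se.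
  have wv : w != v by apply: contraTneq evw => ->; rewrite ie.
  have cS := cardsD1 v S; rewrite vS in cS.
  apply: (contract_minor _ gr evw) => //; apply: IHk.
  - by rewrite -ltnS; apply: leq_trans Sk; rewrite cS.
  - exact: graph_on_contract.
  - by apply/set0Pn; exists w; rewrite !inE wv.
  - have := esize_contract gr evw; move: big few; rewrite cS !expnS; lia.
have [x0 x0S] := set0Pn _ S0.
have [[v w] /= evw|noe] := pickP (fun p : V * V => e p.1 p.2); last first.
  move: big; have -> : esize e = 0.
    by rewrite /esize big1 // => x _; apply/eqP; rewrite cards_eq0; apply/eqP/setP => y; rewrite !inE (noe (x, y)).
  by rewrite leqn0 !muln_eq0 cards_eq0 (negbTE S0) expn_eq0.
pose N := [set x | e v x].
have NS : N \subset S by apply/subsetP => x; rewrite inE se => /sup.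
have vN : v \notin N by rewrite inE ie.
have grN : graph_on (rin e N) N.
  split; first by move=> x y; rewrite !rinE andbCA se.
    by move=> x; rewrite rinE ie !andbF.
  by move=> x y /and3P [].
have N0 : N != set0 by apply/set0Pn; exists w; rewrite inE.
have bigN : 2 * 2 ^ t * #|N| <= esize (rin e N).
  rewrite /esize (bigID (mem N)) /=; apply: leq_trans (leq_addr _ _).
  rewrite mulnC -sum_nat_const; apply: leq_sum => x xN.
  have evx : e v x by move: xN; rewrite inE.
  have := many (v, x) => /=; rewrite evx /= => /negbT; rewrite -leqNgt expnS => h; apply: leq_trans h _.
  apply: subset_leq_card; apply/subsetP => y; rewrite !inE => /andP [h1 h2].
  by rewrite rinE !inE evx h1 h2.
have [B [H1 H2 H3 H4 H5]] := IHt _ _ grN N0 bigN.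
exists (fun i => if unlift ord0 i is Some j then B j else [set v]); split.
- move=> i; case: unliftP => [j _|_]; first exact: subset_trans (H1 j) NS.
  by rewrite sub1set; apply: sup evw.
- by move=> i; case: unliftP => [j _|_]; [apply: H2|exists v; rewrite inE].
- have dv j : [disjoint [set v] & B j].
    by rewrite disjoints1; apply: contra vN; apply: (subsetP (H1 j)).
  move=> i j; case: unliftP => [i' ->|->]; case: unliftP => [j' ->|->].
  + by rewrite (inj_eq lift_inj); apply: H3.
  + by move=> _; rewrite disjoint_sym.
  + by move=> _.
  + by rewrite eqxx.
- move=> i x y; case: unliftP => [j _|_]; last first.
    by rewrite !inE => /eqP -> /eqP ->; apply: connect0.
  move=> xB yB; apply: connect_sub (H4 j x y xB yB) => a b /and3P [aB bB /and3P [_ _ eab]].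
  by apply: connect1; rewrite rinE aB bB.
- move=> i j; case: unliftP => [i' ->|->]; case: unliftP => [j' ->|->].
  + rewrite (inj_eq lift_inj) => /H5 [x [y [xB yB /and3P [_ _ exy]]]].
    by exists x, y.
  + move=> _; have [x xB] := H2 i'; exists x, v; rewrite inE eqxx se; split=> //.
    by have := subsetP (H1 i') _ xB; rewrite inE.
  + move=> _; have [x xB] := H2 j'; exists v, x; rewrite inE eqxx; split=> //.
    by have := subsetP (H1 j') _ xB; rewrite inE.
  + by rewrite eqxx.
Qed.

End Minor.

Lemma card_dep_le (A B : finType) (P : {set A}) (Q : A -> {set B}) m :
  (forall a, a \in P -> #|Q a| <= m) ->
  #|[set x : A * B | (x.1 \in P) && (x.2 \in Q x.1)]| <= #|P| * m.
Proof.
move=> H; rewrite -sum1_card.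
have -> : \sum_(x in [set x : A * B | (x.1 \in P) && (x.2 \in Q x.1)]) 1 =
    \sum_(a in P) \sum_(b in Q a) 1.
  by rewrite pair_big_dep /=; apply: eq_bigl => x; rewrite inE.
by rewrite -sum_nat_const; apply: leq_sum => a aP; rewrite sum1_card H.
Qed.

Lemma card_dep_ge (A B : finType) (P : {set A}) (Q : A -> {set B}) m :
  (forall a, a \in P -> m <= #|Q a|) ->
  #|P| * m <= #|[set x : A * B | (x.1 \in P) && (x.2 \in Q x.1)]|.
Proof.
move=> H; rewrite -[X in _ <= X]sum1_card.
have -> : \sum_(x in [set x : A * B | (x.1 \in P) && (x.2 \in Q x.1)]) 1 =
    \sum_(a in P) \sum_(b in Q a) 1.
  by rewrite pair_big_dep /=; apply: eq_bigl => x; rewrite inE.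
by rewrite -sum_nat_const; apply: leq_sum => a aP; rewrite sum1_card H.
Qed.

(** * Cliques and twins in graphs without a K_5 minor *)

Section Cliques.
Variables (V : finType) (e : rel V).
Hypotheses (se : symmetric e) (ie : irreflexive e).

Definition cliques (X : {set V}) : {set {set V}} :=
  [set K : {set V} | (K \subset X) &&
    [forall a in K, forall b in K, (a != b) ==> e a b]].

(** By averaging, some [x] in [X] has at most [d] neighbours in [X]. A clique through [x] is [x]
    with a subset of these; the other cliques live on the rest. *)
Lemma card_cliques (d : nat) (X : {set V}) :
  (forall Y : {set V}, Y \subset X -> Y != set0 -> esize (rin e Y) < d.+1 * #|Y|) ->
  #|cliques X| <= 2 ^ d * #|X| + 1.
Proof.
have [k] := ubnP #|X|; elim: k X => // k IH X Xk sparse.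
have [->|X0] := eqVneq X set0.
  rewrite cards0 muln0 add0n -(cards1 (set0 : {set V})); apply: subset_leq_card.
  by apply/subsetP => K; rewrite !inE subset0 => /andP [].
have [x xX degx] : exists2 x, x \in X & #|[set y | rin e X x y]| <= d.
  apply: contrapT => no; have := sparse X (subxx _) X0; rewrite ltnNge => /negP; apply.
  rewrite /esize (bigID (mem X)) /=; apply: leq_trans (leq_addr _ _).
  rewrite mulnC -sum_nat_const; apply: leq_sum => x xX.
  by rewrite ltnNge; apply/negP => h; apply: no; exists x.
have cX := cardsD1 x X; rewrite xX in cX.
have IHx : #|cliques (X :\ x)| <= 2 ^ d * #|X :\ x| + 1.
  apply: IH; first by rewrite -ltnS; apply: leq_trans Xk; rewrite cX.
  move=> Y YX; apply: sparse; apply: subset_trans YX _; exact: subsetDl.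
set N := [set y | rin e X x y] in degx.
have sub : cliques X \subset cliques (X :\ x) :|: [set x |: K | K in powerset N].
  apply/subsetP => K; rewrite inE => /andP [KX /forall_inP cl].
  rewrite inE; have [xK|nxK] := boolP (x \in K); last first.
    apply/orP; left; rewrite inE; apply/andP; split; last exact/forall_inP.
    by rewrite subsetD1 KX.
  apply/orP; right; apply/imsetP; exists (K :\ x); last by rewrite setD1K.
  rewrite powersetE; apply/subsetP => y; rewrite in_setD1 => /andP [yx yK].
  rewrite inE rinE xX (subsetP KX _ yK) /=.
  by have /forall_inP /(_ _ yK) := cl _ xK; rewrite eq_sym yx.
apply: leq_trans (subset_leq_card sub) _.
apply: leq_trans (leq_card_setU _ _) _.
have h : #|[set x |: K | K in powerset N]| <= 2 ^ d.
  apply: leq_trans (leq_imset_card _ _) _; rewrite card_powerset.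
  by rewrite leq_exp2l.
by rewrite cX add1n mulnS addnC -addnA; apply: leq_add.
Qed.

End Cliques.

Section Twins.
Variables (V : finType) (e : rel V) (S : {set V}).
Hypothesis gr : graph_on e S.
Hypothesis nk : ~ kminor 5 e [set: V].

Let se : symmetric e. Proof. by case: gr. Qed.
Let ie : irreflexive e. Proof. by case: gr. Qed.

(** [mader] with t = 3: the bound 16 is 2 * 2 ^ 3, each edge being counted twice. *)
Lemma no_k5_sparse (e' : rel V) (X : {set V}) : graph_on e' X -> X != set0 ->
  ~ kminor 5 e' [set: V] -> esize e' < 16 * #|X|.
Proof.
move=> g' X0 nk'; rewrite ltnNge; apply/negP => big; apply: nk'.
by apply: kminorS (subsetT X) _; apply: (@mader _ 3).
Qed.

Variables (H U : {set V}).
Hypothesis disHU : [disjoint H & U].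
Hypothesis NU : forall v x, v \in U -> e v x -> x \in H.
Hypothesis injU : {in U &, injective (fun v => [set x | e v x])}.

(* Distinct vertices of U are contracted into distinct new edges on H as long
   as possible; the neighbourhoods of the others are then cliques. *)
Let valid (M : {set V * (V * V)}) : bool :=
  [forall t in M, [&& t.1 \in U, e t.1 t.2.1, e t.1 t.2.2 & t.2.1 != t.2.2]] &&
  [forall t in M, forall t' in M,
    ((t.1 == t'.1) || ([set t.2.1; t.2.2] == [set t'.2.1; t'.2.2])) ==> (t == t')].

(** The contracted graph [e1] on [H] has no K_5 minor, hence fewer than 8 * #|H| edges, which bounds
    the matched vertices. By maximality the neighbourhood of an unmatched vertex is a clique of
    [e1], and distinct vertices have distinct neighbourhoods; the exponent 15 comes from 16 = 15 + 1
    in [card_cliques]. *)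
Lemma few_twin_free : #|U| <= (2 ^ 15 + 8) * #|H| + 1.
Proof.
have [M /maxsetP [vM maxM] _] : {M | maxset valid M & set0 \subset M}.
  by apply: maxset_exists; apply/andP; split; apply/forall_inP => t; rewrite inE.
have [/forall_inP M1 /forall_inP M2] := andP vM.
have M2' t t' : t \in M -> t' \in M -> t.1 = t'.1 -> t = t'.
  move=> tM tM' E; have /forall_inP /(_ _ tM') /implyP := M2 _ tM.
  by rewrite E eqxx => /(_ isT) /eqP.
have M2'' t t' : t \in M -> t' \in M -> [set t.2.1; t.2.2] = [set t'.2.1; t'.2.2] -> t = t'.
  move=> tM tM' E; have /forall_inP /(_ _ tM') /implyP := M2 _ tM.
  by rewrite E eqxx orbT => /(_ isT) /eqP.
have HU x : x \in H -> x \notin U by move=> xH; rewrite (disjointFr disHU xH).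
pose e1 : rel V := [rel a b | [exists v, ((v, (a, b)) \in M) || ((v, (b, a)) \in M)]].
have e1E a b : e1 a b = [exists v, ((v, (a, b)) \in M) || ((v, (b, a)) \in M)] by [].
(* [f] contracts each matched vertex onto the first end of its pair, which realises every edge of
   [e1]. *)
pose f v := if [pick t in M | t.1 == v] is Some t then t.2.1 else v.
have fM t : t \in M -> f t.1 = t.2.1.
  move=> tM; rewrite /f; case: pickP => [t' /andP [tM' /eqP E]|/(_ t)].
    by rewrite (M2' _ _ tM' tM E).
  by rewrite tM eqxx.
have fH x : x \in H -> f x = x.
  move=> xH; rewrite /f; case: pickP => // t /andP [tM /eqP E].
  by have /and4P [] := M1 _ tM; rewrite E (negbTE (HU _ xH)).
have MH t : t \in M -> [/\ t.1 \in U, e t.1 t.2.1, e t.1 t.2.2 & t.2.1 != t.2.2] /\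
    t.2.1 \in H /\ t.2.2 \in H.
  by move=> tM; have /and4P [h1 h2 h3 h4] := M1 _ tM; rewrite !(NU h1).
have e1H a b : e1 a b -> a \in H /\ b \in H.
  by rewrite e1E => /existsP [v /orP [] /MH [_ []]].
have se1 : symmetric e1.
  by move=> a b; rewrite !e1E; apply: eq_existsb => v; rewrite orbC.
have ie1 : irreflexive e1.
  move=> a; rewrite e1E; apply/existsP => -[v]; rewrite orbb => /MH [[_ _ _]].
  by rewrite eqxx.
have nk1 : ~ kminor 5 e1 [set: V].
  move=> K; apply: nk; apply: (@kminor_lift _ 5 f) K => //.
  - have step x : connect (rin e [set z | f z == f x]) x (f x).
      have [->|[t tM <-]] : f x = x \/ exists2 t, t \in M & t.1 = x.
        rewrite /f; case: pickP => [t /andP [tM /eqP E]|_]; last by left.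
        by right; exists t.
      - exact: connect0.
      have [[h1 h2 h3 h4] [h5 h6]] := MH _ tM.
      apply: connect1; rewrite rinE !inE (fM _ tM) (fH _ h5) eqxx h2.
      by [].
    move=> x y E; apply: connect_trans (step x) _.
    by rewrite rin_connect_sym // E; apply: step.
  - move=> x y; rewrite e1E => /existsP [v /orP [] /[dup] tM /MH [[/= h1 h2 h3 h4] [h5 h6]]].
      by exists v, y; rewrite (fM _ tM) (fH _ h6).
    by exists x, v; rewrite (fM _ tM) (fH _ h6) se.
have sparse (Y : {set V}) : Y != set0 -> esize (rin e1 Y) < 16 * #|Y|.
  move=> Y0; apply: no_k5_sparse => //; last first.
    by move=> K; apply: nk1; apply: kminor_sub K => a b /and3P [].
  split; first by move=> a b; rewrite !rinE andbCA se1.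
    by move=> a; rewrite rinE ie1 !andbF.
  by move=> a b /and3P [].
have cM : #|M| <= 8 * #|H|.
  have [H0|H0] := eqVneq H set0.
    have -> : M = set0.
      by apply/setP => t; rewrite inE; apply/negP => /MH [_ []]; rewrite H0 inE.
    by rewrite cards0.
  have := sparse H H0; rewrite /esize.
  have -> : \sum_x #|[set y | rin e1 H x y]| = #|[set p : V * V | e1 p.1 p.2]|.
    rewrite -sum1_card (eq_bigr (fun x => \sum_(y in [set y | rin e1 H x y]) 1)).
      rewrite pair_big_dep /=; apply: eq_bigl => -[a b]; rewrite !inE /= rinE.
      by apply/and3P/idP => [[]//|h]; have [] := e1H _ _ h.
    by move=> x _; rewrite sum1_card.
  (* Each matched pair contributes both of its orders to [e1], and distinct triples give distinct
     edges. *)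
  move=> lt; suff : #|M| + #|M| <= #|[set p : V * V | e1 p.1 p.2]| by lia.
  have i1 : {in M &, injective (fun t : V * (V * V) => t.2)}.
    by move=> t t' tM tM' E; apply: M2'' => //; rewrite E.
  have i2 : {in M &, injective (fun t : V * (V * V) => (t.2.2, t.2.1))}.
    by move=> t t' tM tM' [E1 E2]; apply: M2'' => //; rewrite E1 E2.
  rewrite -{1}(card_in_imset i1) -(card_in_imset i2) -cardsUI.
  have -> : [set t.2 | t in M] :&: [set (t.2.2, t.2.1) | t in M] = set0.
    apply/setP => p; rewrite !inE; apply/negP => /andP [/imsetP [t tM ->] /imsetP [t' tM' E]].
    have tt : t = t' by apply: M2'' => //; rewrite E /= setUC.
    move: E; rewrite -tt => -[] /= E; have [[_ _ _]] := MH _ tM.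
    by case: t tM E {tt} => [v [a b]] /= _ [-> _]; rewrite eqxx.
  rewrite cards0 addn0; apply: subset_leq_card; apply/subsetP => p; rewrite !inE.
  case/orP => /imsetP [[v [a b]] tM ->]; rewrite /= ?e1E; apply/existsP; exists v.
    by rewrite /= tM.
  by rewrite /= tM orbT.
pose U1 := [set t.1 | t in M].
have cU1 : #|U1| <= #|M| by apply: leq_imset_card.
have cU2 : #|U :\: U1| <= #|cliques e1 H|.
  rewrite -(@card_in_imset _ _ (fun v => [set x | e v x])); last first.
    by move=> v v' /setDP [vU _] /setDP [vU' _]; apply: injU.
  apply: subset_leq_card; apply/subsetP => _ /imsetP [v /setDP [vU nv] ->].
  rewrite inE; apply/andP; split.
    by apply/subsetP => x; rewrite inE => /(NU vU).
  apply/forall_inP => a; rewrite inE => eva; apply/forall_inP => b; rewrite inE => evb.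
  apply/implyP => ab; have [//|nab] := boolP (e1 a b); exfalso.
  pose t := (v, (a, b)).
  have tM : t \notin M by apply: contra nv => tM; apply/imsetP; exists t.
  suff vt : valid (t |: M).
    by move: tM; rewrite -(maxM _ vt (subsetUr _ _)) setU11.
  have n1 t' : t' \in M -> (v == t'.1) = false.
    by move=> tM'; apply: contraNF nv => /eqP ->; apply/imsetP; exists t'.
  have n2 t' : t' \in M -> ([set a; b] == [set t'.2.1; t'.2.2]) = false.
    case: t' => [v' [a' b']] tM' /=; apply: contraNF nab => /eqP /set2_eqP E.
    rewrite e1E; apply/existsP; exists v'.
    by case: E => [[-> ->]|[-> ->]]; rewrite tM' ?orbT.
  apply/andP; split; apply/forall_inP => t'; rewrite in_setU1 => /predU1P [->|tM'].
  + by rewrite /= vU eva evb ab.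
  + exact: M1.
  + apply/forall_inP => t''; rewrite in_setU1 => /predU1P [->|tM''].
      by apply/implyP.
    by rewrite /= (n1 _ tM'') (n2 _ tM'').
  + apply/forall_inP => t''; rewrite in_setU1 => /predU1P [->|tM''].
      by rewrite /= eq_sym (n1 _ tM') eq_sym (n2 _ tM').
    by have /forall_inP := M2 _ tM'; apply.
have cC : #|cliques e1 H| <= 2 ^ 15 * #|H| + 1.
  by apply: card_cliques => // Y _; apply: sparse.
have sub : U \subset U1 :|: (U :\: U1).
  by apply/subsetP => x xU; rewrite !inE xU andbT orbN.
have h1 : #|U| <= #|U1| + #|U :\: U1|.
  exact: leq_trans (subset_leq_card sub) (leq_card_setU _ _).
move: h1 cU1 cU2 cC cM; rewrite mulnDl; move: (2 ^ 15 * _) => c; lia.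
Qed.

End Twins.

(** * The number of graphs without a K_5 minor *)

Section Reducible.
Variable V : finType.
Implicit Types (e : rel V) (S : {set V}) (G : {set {set V}}).

(* Locked: these numbers must never be computed. *)
Definition low_degree : nat := locked (32 * (2 ^ 15 + 9)).

Definition rnbr e x : {set V} := [set y | e x y].

(* The pairs that can be contracted losing boundedly much information. *)
Definition reducible e S (p : V * V) : bool :=
  [&& p.1 \in S, p.2 \in S, p.1 != p.2, #|rnbr e p.1| <= low_degree,
      #|rnbr e p.2| <= low_degree & e p.1 p.2 || (rnbr e p.1 == rnbr e p.2)].

(** The vertices of degree above [low_degree] form a small set [H], by the bound on the edges. A
    vertex of low degree in no reducible pair has all its neighbours in [H] and shares its
    neighbourhood with no other such vertex, so [few_twin_free] applies. The value of [low_degree]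
    makes these two sets together at most #|S| / 2 + 1, and at least a quarter of [S] is left since
    #|S| > 3. *)
Lemma many_reducible e S : graph_on e S -> ~ kminor 5 e [set: V] -> 3 < #|S| ->
  #|S| <= 4 * #|[set p | reducible e S p]|.
Proof.
move=> gr nk S4; have [se ie sup] := gr.
pose H := [set v in S | low_degree < #|rnbr e v|].
pose U := [set v in S | (#|rnbr e v| <= low_degree) && [forall w, ~~ reducible e S (v, w)]].
have supr x y : e x y -> y \in S by rewrite se => /sup.
have dHU : [disjoint H & U].
  apply/pred0P => x; apply/negbTE/negP => /=; rewrite !inE.
  by case/andP=> /andP [_ h] /and3P [_ h' _]; rewrite leqNgt h in h'.
have NU v x : v \in U -> e v x -> x \in H.
  rewrite !inE => /and3P [vS lv /forallP nr] evx; rewrite (supr _ _ evx) /= ltnNge.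
  apply/negP => lx; have := nr x; rewrite /reducible /= vS (supr _ _ evx) lv lx evx.
  by rewrite !andbT negbK => /eqP E; move: evx; rewrite E ie.
have injU : {in U &, injective (fun v => [set x | e v x])}.
  move=> v w; rewrite !inE => /and3P [vS lv /forallP nr] /and3P [wS lw _] E.
  apply/eqP; apply/negPn/negP => vw; have := nr w.
  by rewrite /reducible /= vS wS vw lv lw /rnbr E eqxx orbT.
have hU := few_twin_free gr nk dHU NU injU.
have cH : #|H| * low_degree <= 16 * #|S|.
  have S0 : S != set0 by rewrite -cards_eq0; case: (#|S|) S4.
  apply: leq_trans (ltnW (no_k5_sparse gr S0 nk)).
  rewrite /esize (bigID (mem H)) /=; apply: leq_trans (leq_addr _ _).
  by rewrite -sum_nat_const; apply: leq_sum => x; rewrite inE => /andP [_ /ltnW].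
have cR : #|S :\: H :\: U| <= #|[set p | reducible e S p]|.
  apply: leq_trans (leq_imset_card fst _); apply: subset_leq_card.
  apply/subsetP => v; rewrite !inE => /and3P [nU nH vS].
  move: nH nU; rewrite vS /= -leqNgt => lv; rewrite lv /= negb_forall.
  case/existsP=> w; rewrite negbK => r; apply/imsetP; exists (v, w) => //.
  by rewrite inE.
have cS : #|S| <= #|H| + #|U| + #|S :\: H :\: U|.
  apply: leq_trans (_ : #|(H :|: U) :|: (S :\: H :\: U)| <= _).
    apply: subset_leq_card; apply/subsetP => v vS; rewrite !in_setU !in_setD vS !andbT.
    by case: (v \in H); case: (v \in U); rewrite ?orbT.
  apply: leq_trans (leq_card_setU _ _) _; rewrite leq_add2r.
  exact: leq_trans (leq_card_setU _ _) _.
move: cS cR hU cH S4; rewrite /low_degree -lock.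
have -> : 2 ^ 15 + 9 = (2 ^ 15 + 8) + 1 by rewrite addn1 addnS.
move: (#|S :\: _ :\: _|) (#|[set p | _]|) (2 ^ 15 + 8) (#|H|) (#|U|) (#|S|).
move=> a r c x u n; nia.
Qed.

Definition rgraph e : {set {set V}} := [set [set p.1; p.2] | p : V * V & e p.1 p.2].

Lemma adj_rgraph e x y : symmetric e -> adj (rgraph e) x y = e x y.
Proof.
move=> se; apply/imsetP/idP => [[[a b]]|h]; last by exists (x, y); rewrite ?inE.
rewrite inE /= => h E; case: (set2_eqP E) => -[-> ->] //.
by rewrite se.
Qed.

Lemma rgraph_on e S : graph_on e S -> simple_graph (rgraph e) /\ supp (rgraph e) S.
Proof.
case=> se ie sup; split; apply/forall_inP => f /imsetP [[a b]]; rewrite inE /= => h ->.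
  by rewrite cards2; have [E|//] := eqVneq a b; rewrite E ie in h.
by rewrite subUset !sub1set (sup _ _ h); apply: (sup b a); rewrite se.
Qed.

Lemma graph_on_adj G S : simple_graph G -> supp G S -> graph_on (adj G) S.
Proof.
move=> sG suG; split; first exact: adjC.
  by move=> x; apply/negP => /(simple_neq sG); rewrite eqxx.
by move=> x y /(suppP suG) [].
Qed.

Definition k5_free G : bool := `[< ~ kminor 5 (adj G) [set: V] >].

Definition k5_free_graphs S : {set {set {set V}}} :=
  [set G | [&& simple_graph G, supp G S & k5_free G]].

(** Bounds the pairs of subsets of a set with at most 2 * low_degree + 2 elements, that is, the
    choices for the two neighbourhoods forgotten by a contraction. *)
Definition code_bound : nat := locked ((2 ^ (2 * low_degree + 2)) ^ 2).

(** The graph is recovered from its contraction and the neighbourhoods of [v] and [w], and both of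
    these lie in the new neighbourhood of [w] together with [v] and [w]. Contracting an edge creates
    no K_5 minor; contracting twins gives a subgraph. *)
Lemma reducible_fiber S p :
  #|[set G in k5_free_graphs S | reducible (adj G) S p]| <=
  #|k5_free_graphs (S :\ p.1)| * code_bound.
Proof.
case: p => v w /=.
pose ctr G := rgraph (contract (adj G) v w).
pose code G := (ctr G, (nbr G v, nbr G w)).
have cE G S' : simple_graph G -> supp G S' -> w \in S' -> forall x y,
    adj (ctr G) x y = contract (adj G) v w x y.
  move=> sG suG wS x y; apply: adj_rgraph.
  by have [] := graph_on_contract v (graph_on_adj sG suG) wS.
have inj : {in [set G in k5_free_graphs S | reducible (adj G) S (v, w)] &, injective code}.
  move=> G G'; rewrite !inE => /andP [/and3P [sG suG _] /and5P [vS wS vw _ _]].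
  move=> /andP [/and3P [sG' suG' _] _] [Ec Ev Ew].
  apply: graph_ext => // x y.
  have nv z : adj G v z = adj G' v z by have /setP /(_ z) := Ev; rewrite !inE.
  have nw z : adj G w z = adj G' w z by have /setP /(_ z) := Ew; rewrite !inE.
  have [->|xv] := eqVneq x v; first exact: nv.
  have [->|yv] := eqVneq y v; first by rewrite adjC nv adjC.
  have [->|xw] := eqVneq x w; first exact: nw.
  have [->|yw] := eqVneq y w; first by rewrite adjC nw adjC.
  have [->|xy] := eqVneq x y.
    by rewrite !(negbTE (contraTN (simple_neq _) _)) ?eqxx.
  have := cE G S sG suG wS x y; rewrite Ec (cE G' S sG' suG' wS x y) !contractE.
  by rewrite xv yv xy (negbTE xw) (negbTE yw) /= !orbF.
rewrite -(card_in_imset inj).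
pose Q (G : {set {set V}}) : {set {set V} * {set V}} :=
  [set x : {set V} * {set V} | [&& #|nbr G w| <= 2 * low_degree, x.1 \subset nbr G w :|: [set v; w]
     & x.2 \subset nbr G w :|: [set v; w]]].
apply: leq_trans (@card_dep_le _ _ (k5_free_graphs (S :\ v)) Q code_bound _); last first.
  move=> G _; rewrite /Q; have [le|gt] := leqP (#|nbr G w|) (2 * low_degree); last first.
    by rewrite (eq_card0 (A := [set x | _])) // => x; rewrite !inE.
  apply: leq_trans (_ : #|setX (powerset (nbr G w :|: [set v; w]))
     (powerset (nbr G w :|: [set v; w]))| <= _).
    by apply: subset_leq_card; apply/subsetP => -[A B]; rewrite !inE.
  rewrite /code_bound -lock cardsX !card_powerset -expnD addnn -muln2 expnM leq_exp2r // leq_exp2l //.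
  apply: leq_trans (leq_card_setU _ _) _; apply: leq_add => //.
  by rewrite cards2; case: (_ != _).
apply: subset_leq_card; apply/subsetP => c /imsetP [G].
rewrite !inE => /andP [/and3P [sG suG /asboolP kG] /and5P [/= vS wS vw lv /andP [lw red]]] ->.
have gG := graph_on_adj sG suG; have gC := graph_on_contract v gG wS.
have [se ie sup] := gG.
have [h1 h2] := rgraph_on gC; rewrite /= h1 h2 /=.
have NE : nbr (ctr G) w = (nbr G v :|: nbr G w) :\ v :\ w.
  apply/setP => y; rewrite !inE (cE G S) // contractE eqxx (eq_sym w v) vw /= (eq_sym w y).
  case: (eqVneq y w) => [->|yw] /=; first by rewrite !andbF.
  by case: (eqVneq y v) => //= yv; rewrite orbF orbC.
apply/and4P; split.
- apply/asboolP => K5; apply: kG.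
  have sub : subrel (adj (ctr G)) (contract (adj G) v w).
    by move=> x y; rewrite (cE G S).
  have {}K5 := kminor_sub sub K5.
  case/orP: red => [a|/eqP E].
    (* After the contraction [v] is isolated, while a branch set must be joined to the other ones;
       so no branch set contains [v]. *)
    have : kminor 5 (contract (adj G) v w) ([set: V] :\ v).
      have [B [H1 H2 H3 H4 H5]] := K5; exists B; split=> // i.
      have [j ij] : exists j : 'I_5, i != j.
        exists (if i == ord0 then ord_max else ord0).
        by case: (altP (i =P ord0)) => [->|].
      apply/subsetP => x xB; rewrite !inE andbT; apply: contraTneq xB => ->.
      apply/negP => vB; have [a' [b' [aB bB]]] := H5 i j ij.
      rewrite contractE => /and4P [av _ _ _].
      have := H4 i v a' vB aB => /connectP [[|z p] /=]; first by move=> _ av'; rewrite av' eqxx in av.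
      by case/andP=> /and3P [_ _]; rewrite contractE eqxx.
    by apply: contract_minor; rewrite // ?inE //; split=> // x y _; rewrite inE.
  have NvNw z : adj G v z = adj G w z by have /setP /(_ z) := E; rewrite !inE.
  apply: kminor_sub K5 => x y; rewrite contractE.
  case/and4P=> _ _ _ /or3P [//|/andP [/eqP -> ]|/andP [/eqP ->]]; rewrite NvNw //.
  by rewrite se.
- rewrite NE; apply: leq_trans (subset_leq_card (subsetDl _ _)) _.
  apply: leq_trans (subset_leq_card (subsetDl _ _)) _.
  by apply: leq_trans (leq_card_setU _ _) _; rewrite mul2n -addnn leq_add.
- rewrite NE; apply/subsetP => z zN; rewrite !inE in zN *.
  by rewrite zN; case: (z == v); case: (z == w).
- rewrite NE; apply/subsetP => z zN; rewrite !inE in zN *.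
  by rewrite zN orbT; case: (z == v); case: (z == w).
Qed.

(** Count pairs of a graph and a reducible pair: each graph has at least #|S| / 4, there are #|S| ^
    2 ordered pairs, and the fibre over each is at most [code_bound] times the count for one vertex
    less. The factor 2 ^ 8 bounds the sets of subsets of a set of at most 3 vertices. *)
Lemma card_k5_free_graphs S :
  #|k5_free_graphs S| <= 2 ^ 8 * (4 * code_bound) ^ #|S| * #|S|`!.
Proof.
have [k] := ubnP #|S|; elim: k S => // k IH S Sk.
have cb0 : 0 < code_bound by rewrite /code_bound -lock !expn_gt0.
have [small|S4] := leqP #|S| 3.
  apply: leq_trans (_ : 2 ^ 8 <= _); last first.
    by rewrite -mulnA leq_pmulr // muln_gt0 fact_gt0 expn_gt0 muln_gt0 cb0.
  apply: leq_trans (_ : #|powerset (powerset S)| <= _).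
    apply: subset_leq_card; apply/subsetP => G; rewrite !inE => /and3P [_ suG _].
    by apply/subsetP => e eG; rewrite inE; apply: (forall_inP suG).
  by rewrite !card_powerset leq_exp2l // (@leq_exp2l 2 _ 3).
set F := k5_free_graphs S; set b := 2 ^ 8 * (4 * code_bound) ^ #|S|.-1 * (#|S|.-1)`!.
have h1 : #|F| * #|S| <= 4 * \sum_(G in F) #|[set p | reducible (adj G) S p]|.
  rewrite big_distrr /= -sum_nat_const; apply: leq_sum => G; rewrite inE.
  case/and3P=> sG suG /asboolP kG; apply: many_reducible => //.
  exact: graph_on_adj.
have h2 : \sum_(G in F) #|[set p | reducible (adj G) S p]| <= #|S| ^ 2 * (b * code_bound).
  have -> : \sum_(G in F) #|[set p | reducible (adj G) S p]| =
      \sum_(p : V * V) #|[set G in F | reducible (adj G) S p]|.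
    rewrite (eq_bigr (fun G => \sum_(p : V * V | reducible (adj G) S p) 1)); last first.
      by move=> G _; rewrite sum1_card; apply: eq_card => p; rewrite !inE.
    rewrite (exchange_big_dep xpredT) //=; apply: eq_bigr => p _.
    by rewrite sum1_card; apply: eq_card => G; rewrite inE.
  rewrite (bigID (mem (setX S S))) /= [X in _ + X]big1 => [|p np]; last first.
    apply/eqP; rewrite cards_eq0; apply/eqP/setP => G; rewrite !inE; apply/negP.
    move=> /andP [_ /and5P [h1' h2' _ _ _]]; move: np; rewrite inE h1' h2' //.
  rewrite addn0 -mulnn -cardsX -sum_nat_const; apply: leq_sum => -[v w] /setXP [vS wS].
  apply: leq_trans (reducible_fiber S (v, w)) _; rewrite leq_mul2r; apply/orP; right => /=.
  have cS : #|S :\ v| = #|S|.-1 by rewrite (cardsD1 v S) vS.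
  by rewrite /b -cS; apply: IH; rewrite -ltnS; apply: leq_trans Sk; rewrite (cardsD1 v S) vS.
have [m Sm] : exists m, #|S| = m.+1 by exists (#|S|.-1); rewrite prednK // (ltn_trans _ S4).
have S0 : 0 < #|S| by rewrite Sm.
rewrite -(leq_pmul2r S0); apply: leq_trans h1 _.
apply: leq_trans (_ : 4 * (#|S| ^ 2 * (b * code_bound)) <= _).
  by rewrite leq_mul2l h2 orbT.
rewrite /b Sm /= factS [(4 * code_bound) ^ m.+1]expnS -mulnn.
move: ((4 * code_bound) ^ m) (m`!) (2 ^ 8) => a c d.
move: code_bound => f; nia.
Qed.

End Reducible.

End Graphs.
Import Graphs.

(** * Parity of crossings *)

Module Crossings.
Import Btauto lra.
Import Order.TTheory GRing.Theory Num.Theory.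
Local Open Scope ring_scope.

Section Crossing.
Variables (R : realFieldType) (h d : R).
Hypotheses (h0 : 0 <= h) (hd : 4 * h < d).
Implicit Types (p q r c x y : R * R) (s : seq (R * R)).

(* Arguments in [0, pi[. *)
Definition upper p : bool := (0 < p.2) || ((p.2 == 0) && (0 < p.1)).

(* Whether a short step from p to q crosses the positive half axis. *)
Definition cross p q : bool := (upper p != upper q) && (0 < p.1).

(** Distances are in the maximum norm. Chains will have steps at most [h] and be at distance at
    least [d] from each other, with 4 * h < d. *)
Definition far p q : bool := (d <= `|p.1 - q.1|) || (d <= `|p.2 - q.2|).
Definition nearby (e : R) p q : bool :=
  (`|p.1 - q.1| <= e) && (`|p.2 - q.2| <= e).

Let far0 p := far p 0.

Let d0 : 0 < d.
Proof. by have := h0; have := hd; lra. Qed.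

Lemma upperN p : p != 0 -> upper (- p) = ~~ upper p.
Proof.
case: p => a b; rewrite /upper -pair_eqE /= => ne.
rewrite !oppr_gt0 oppr_eq0; case: (ltgtP b 0) => //= b0.
rewrite b0 eqxx andbT in ne; case: (ltgtP a 0) => //= a0.
by rewrite a0 eqxx in ne.
Qed.

Lemma far0_neq0 p : far0 p -> p != 0.
Proof.
rewrite /far0 /far /= !subr0 => H; apply/eqP => E; move: H.
by rewrite E /= normr0 orbb leNgt d0.
Qed.

Lemma nearby_sym e p q : nearby e p q = nearby e q p.
Proof. by rewrite /nearby distrC (distrC p.2). Qed.

Lemma side_eq p q r : far0 r -> nearby (2 * h) p q -> nearby (2 * h) r p ->
  upper p != upper q -> 0 < r.1 -> 0 < p.1 \/ far0 p = false.
Proof.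
rewrite /far0 /far /nearby /= !subr0 => fr /andP [n1 n2] /andP [m1 m2] uu r1.
have [p0|p0] := ltP 0 p.1; first by left.
right; apply/negP => fp.
have yp : `|p.2| <= 2 * h.
  move: uu n2; rewrite /upper ler_norml ler_norml => uu /andP [k1 k2].
  case: (ltgtP p.2 0) uu k1 k2 => hp; case: (ltgtP q.2 0) => hq //= _ k1 k2; lra.
have yr : `|r.2| <= 4 * h.
  by have := ler_distD p.2 r.2 0; rewrite !subr0 => k; lra.
have xr : d <= `|r.1| by case/orP: fr => // k; have := hd; lra.
have xp : d <= `|p.1| by case/orP: fp => // k; have := hd; have := h0; lra.
move: m1 xr xp; rewrite (gtr0_norm r1) (ler0_norm p0) ler_norml => /andP [_ k].
by have := hd; have := h0; lra.
Qed.

(** If [upper] changes between [p] and [q], the second coordinate of [p] is at most 2 * h in size.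
    Being far from the origin, [p] then has a first coordinate of size at least [d], whose sign is
    shared by the points near it. *)
Lemma side_eq2 p q r : far0 p -> far0 q -> far0 r -> nearby (2 * h) p q ->
  nearby (2 * h) r p -> upper p != upper q -> (0 < r.1) = (0 < p.1).
Proof.
move=> fp fq fr npq nrp uu; apply/idP/idP => H.
  by case: (side_eq fr npq nrp uu H) => //; rewrite fp.
move: npq nrp uu fp fq fr; rewrite /far0 /far /nearby /= !subr0.
move=> /andP [n1 n2] /andP [m1 m2] uu fp fq fr.
have yp : `|p.2| <= 2 * h.
  move: uu n2; rewrite /upper ler_norml ler_norml => uu /andP [k1 k2].
  case: (ltgtP p.2 0) uu k1 k2 => hp; case: (ltgtP q.2 0) => hq //= _ k1 k2; lra.
have xp : d <= `|p.1| by case/orP: fp => // k; have := hd; have := h0; lra.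
rewrite (gtr0_norm H) in xp; move: m1; rewrite ler_norml => /andP [k _].
by have := hd; have := h0; lra.
Qed.

Lemma cross_sym p q : far0 p -> far0 q -> nearby (2 * h) p q ->
  cross p q = cross q p.
Proof.
move=> fp fq n; rewrite /cross eq_sym; case: (eqVneq (upper q) (upper p)) => //= ne.
by rewrite (@side_eq2 q p p) // nearby_sym.
Qed.

(** A small closed quadrilateral far from the origin does not wind around it. Round the
    quadrilateral [upper] changes an even number of times, and if it changes at all the four first
    coordinates have one sign. *)
Lemma cross_square p1 p2 p3 p4 : all far0 [:: p1; p2; p3; p4] ->
  (forall a b, a \in [:: p1; p2; p3; p4] -> b \in [:: p1; p2; p3; p4] ->
    nearby (2 * h) a b) ->
  cross p1 p2 (+) cross p2 p3 (+) cross p3 p4 (+) cross p4 p1 = false.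
Proof.
move=> /allP F N.
have key a b r : a \in [:: p1; p2; p3; p4] -> b \in [:: p1; p2; p3; p4] ->
    r \in [:: p1; p2; p3; p4] -> upper a != upper b -> (0 < r.1) = (0 < a.1).
  by move=> ia ib ir; apply: side_eq2; auto.
have i1 : p1 \in [:: p1; p2; p3; p4] by rewrite !inE eqxx.
have i2 : p2 \in [:: p1; p2; p3; p4] by rewrite !inE eqxx orbT.
have i3 : p3 \in [:: p1; p2; p3; p4] by rewrite !inE eqxx !orbT.
have i4 : p4 \in [:: p1; p2; p3; p4] by rewrite !inE eqxx !orbT.
rewrite /cross.
have [e12|n12] := eqVneq (upper p1) (upper p2); last first.
  rewrite (key _ _ _ i1 i2 i2 n12) (key _ _ _ i1 i2 i3 n12) (key _ _ _ i1 i2 i4 n12).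
  by move: (upper p1) (upper p2) (upper p3) (upper p4) (0 < p1.1) n12 => [] [] [] [] [].
have [e13|n13] := eqVneq (upper p1) (upper p3); last first.
  rewrite (key _ _ _ i1 i3 i2 n13) (key _ _ _ i1 i3 i3 n13) (key _ _ _ i1 i3 i4 n13).
  by move: (upper p1) (upper p2) (upper p3) (upper p4) (0 < p1.1) n13 e12 => [] [] [] [] [].
have [e14|n14] := eqVneq (upper p1) (upper p4); last first.
  rewrite (key _ _ _ i1 i4 i2 n14) (key _ _ _ i1 i4 i3 n14) (key _ _ _ i1 i4 i4 n14).
  by move: (upper p1) (upper p2) (upper p3) (upper p4) (0 < p1.1) n14 e12 e13 => [] [] [] [] [].
by rewrite -e12 -e13 -e14 eqxx.
Qed.

(** A short step at which [upper] changes crosses either the positive or the negative half axis, and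
    negation exchanges the two. *)
Lemma cross_opp p q : far0 p -> far0 q -> nearby (2 * h) p q ->
  cross (- p) (- q) = cross p q (+) (upper p (+) upper q).
Proof.
move=> fp fq n; rewrite /cross !upperN ?far0_neq0 //.
have -> : (~~ upper p != ~~ upper q) = (upper p != upper q).
  by case: (upper p); case: (upper q).
have [e|ne] := eqVneq (upper p) (upper q); first by rewrite e /= addbb.
have -> : upper p (+) upper q by move: ne; case: (upper p); case: (upper q).
rewrite /= oppr_gt0; case: (ltgtP p.1 0) => //= p0; exfalso.
have := ne; have := fp; have := fq; have := n; rewrite /nearby /far0 /far /upper /= !subr0 p0 normr0.
move=> /andP [n1 n2] fq'; case/orP => [k|k]; first by have := hd; have := h0; lra.
move: n2 k; rewrite ltxx /=; rewrite ler_norml => /andP [k1 k2] k uu.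
case: (ltgtP p.2 0) uu k k1 k2 => hp; case: (ltgtP q.2 0) => hq //= uu k k1 k2.
all: move: k; rewrite ?(gtr0_norm hp) ?(ltr0_norm hp) ?hp ?normr0 => k; have := hd; have := h0; lra.
Qed.

(** Parity of the crossings of the chain [x :: s] with the horizontal ray from [c] to the right: a
    discrete form of the change of argument seen from [c]. *)
Fixpoint winding c x s : bool :=
  if s is y :: s' then cross (x - c) (y - c) (+) winding c y s' else false.

(** The same for the opposite vectors, the chain now carrying the moving base point and [c] being
    the point looked at. *)
Fixpoint co_winding c x s : bool :=
  if s is y :: s' then cross (c - x) (c - y) (+) co_winding c y s' else false.

Lemma farE p q : far0 (p - q) = far p q.
Proof. by rewrite /far0 /far /= !subr0. Qed.

Lemma far_sym p q : far p q = far q p.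
Proof. by rewrite /far distrC (distrC p.2). Qed.

Lemma nearby_sub p q c c' : nearby h p q -> nearby h c c' -> nearby (2 * h) (p - c) (q - c').
Proof.
rewrite /nearby /= => /andP [a1 a2] /andP [b1 b2].
have H (a b a' b' : R) : `|a - b| <= h -> `|a' - b'| <= h ->
    `|a - a' - (b - b')| <= 2 * h.
  by rewrite !ler_norml => /andP [? ?] /andP [? ?]; apply/andP; split; lra.
by rewrite !H.
Qed.

Lemma nearby_refl p : nearby h p p.
Proof. by rewrite /nearby !subrr normr0 h0. Qed.

Lemma co_windingE c x s : path (nearby h) x s -> all (far c) (x :: s) ->
  co_winding c x s = winding c x s (+) (upper (x - c) (+) upper (last x s - c)).
Proof.
elim: s x => [|y s IH] x; first by rewrite /= addbb.
move=> /= /andP [n pp] /and3P [fx fy fs]; rewrite IH //=; last by rewrite fy.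
rewrite -(opprB x c) -(opprB y c) cross_opp ?farE 1?far_sym //; last exact: nearby_sub (nearby_refl c).
by move: (cross _ _) (upper _) (upper _) (upper _) (winding _ _ _) => [] [] [] [] [].
Qed.

(** Sum of [cross_square] over the quadrilaterals between consecutive points of the chain and the
    two base points; the inner sides cancel. *)
Lemma winding_step c c' x s : nearby h c c' -> path (nearby h) x s ->
  all (far c) (x :: s) -> all (far c') (x :: s) ->
  winding c x s (+) winding c' x s
    (+) (cross (x - c) (x - c') (+) cross (last x s - c) (last x s - c')) = false.
Proof.
move=> nc; elim: s x => [|y s IH] x; first by rewrite /= addbb.
move=> /= /andP [n pp] /and3P [fx fy fs] /and3P [fx' fy' fs'].
have := IH y pp; rewrite /= fy fs fy' fs' => /(_ isT isT).
have := @cross_square (x - c) (y - c) (y - c') (x - c').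
have F : all far0 [:: x - c; y - c; y - c'; x - c'].
  by rewrite /= !farE 2!(far_sym x) 2!(far_sym y) fx fx' fy fy'.
move=> /(_ F).
have nn := nearby_refl; have n' : nearby h y x by rewrite nearby_sym.
have nc' : nearby h c' c by rewrite nearby_sym.
have N a b : a \in [:: x - c; y - c; y - c'; x - c'] ->
    b \in [:: x - c; y - c; y - c'; x - c'] -> nearby (2 * h) a b.
  rewrite !inE => /or4P [] /eqP -> /or4P [] /eqP ->; exact: nearby_sub.
move=> /(_ N).
move: F; rewrite /= => /and5P [f1 f2 f3 f4 _].
have -> : cross (y - c') (x - c') = cross (x - c') (y - c').
  by apply: cross_sym => //; apply: nearby_sub.
have -> : cross (x - c') (x - c) = cross (x - c) (x - c').
  by apply: cross_sym => //; apply: nearby_sub.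
move: (cross _ _) (cross _ _) (cross _ _) (cross _ _) (cross _ _) => a1 a2 a3 a4 a5.
move: (winding _ _ _) (winding _ _ _) => w1 w2.
by move: a1 a2 a3 a4 a5 w1 w2 => [] [] [] [] [] [] [].
Qed.

(** A discrete homotopy: the differences of the points of two far chains form a grid avoiding the
    origin, so the number of crossings round its boundary is even. *)
Lemma winding_grid c t x s : path (nearby h) c t -> path (nearby h) x s ->
  (forall c', c' \in c :: t -> all (far c') (x :: s)) ->
  winding c x s (+) winding (last c t) x s
    (+) (co_winding x c t (+) co_winding (last x s) c t) = false.
Proof.
elim: t c => [|c' t IH] c; first by rewrite /= addbb.
move=> /= /andP [nc pc] px F.
have F' c'' : c'' \in c' :: t -> all (far c'') (x :: s).
  by move=> i; apply: F; rewrite inE i orbT.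
have h1 : all (far c) (x :: s) by apply: F; rewrite inE eqxx.
have h2 : all (far c') (x :: s) by apply: F; rewrite !inE eqxx orbT.
have := winding_step nc px h1 h2; have := IH c' pc px F'.
move: (winding _ _ _) (winding _ _ _) (winding _ _ _) (co_winding _ _ _) (co_winding _ _ _).
move: (cross _ _) (cross _ _) => [] [] [] [] [] [] [] //.
Qed.

End Crossing.

(** [w i j k] stands for the winding of the curve from i to j around vertex k. Add the 15 equations,
    one for each pair of disjoint edges of K_5: each [w i j k] occurs twice, and each pair of
    vertices occurs six times in [s]. Ordering the arguments of [s] costs nine negations for each
    four vertices, 45 in all, which is odd. *)
Lemma k5_parity (w : nat -> nat -> nat -> bool) (s : nat -> nat -> bool) :
  (forall i j k l, uniq [:: i; j; k; l] -> i < j -> k < l ->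
    i < 5 -> j < 5 -> k < 5 -> l < 5 ->
    xorb (xorb (w i j k) (w i j l))
      (xorb (xorb (w k l i) (xorb (s k i) (s l i)))
            (xorb (w k l j) (xorb (s k j) (s l j)))) = false)%N ->
  (forall i j, i < j -> j < 5 -> s j i = negb (s i j))%N -> False.
Proof.
move=> E A.
have := E 0 1 2 3 isT isT isT isT isT isT isT; have := E 0 2 1 3 isT isT isT isT isT isT isT.
have := E 0 3 1 2 isT isT isT isT isT isT isT.
have := E 0 1 2 4 isT isT isT isT isT isT isT; have := E 0 2 1 4 isT isT isT isT isT isT isT.
have := E 0 4 1 2 isT isT isT isT isT isT isT.
have := E 0 1 3 4 isT isT isT isT isT isT isT; have := E 0 3 1 4 isT isT isT isT isT isT isT.
have := E 0 4 1 3 isT isT isT isT isT isT isT.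
have := E 0 2 3 4 isT isT isT isT isT isT isT; have := E 0 3 2 4 isT isT isT isT isT isT isT.
have := E 0 4 2 3 isT isT isT isT isT isT isT.
have := E 1 2 3 4 isT isT isT isT isT isT isT; have := E 1 3 2 4 isT isT isT isT isT isT isT.
have := E 1 4 2 3 isT isT isT isT isT isT isT.
rewrite (A 0 1) // (A 0 2) // (A 0 3) // (A 0 4) // (A 1 2) // (A 1 3) // (A 1 4) //.
rewrite (A 2 3) // (A 2 4) // (A 3 4) //.
have key (a b : bool) : a = false -> b = false -> xorb a b = false by move=> -> ->.
do 14 (move/key => K /K {K}).
match goal with |- ?x = false -> _ => have -> : x = true by btauto end.
by [].
Qed.

End Crossings.
Import Crossings.

(** * Drawings *)

Module Drawings.
Import all_classical all_reals all_analysis zify ring lra.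
Import Order.TTheory GRing.Theory Num.Theory.
Import numFieldNormedType.Exports.
Local Open Scope classical_set_scope.
Local Open Scope ring_scope.

Section Clamp.
Variable R : realType.
Implicit Types (t : R).

(** The retraction of the line onto [0, 1], written with absolute values so that its continuity is
    immediate. *)
Definition clamp t : R := (1 + `|t| - `|t - 1|) / 2.

Lemma clampK t : 0 <= t <= 1 -> clamp t = t.
Proof.
by move=> /andP [h0 h1]; rewrite /clamp ger0_norm // ler0_norm; lra.
Qed.

Lemma clamp01 t : 0 <= clamp t <= 1.
Proof.
rewrite /clamp; have [h|h] := leP 0 t; have [k|k] := leP 0 (t - 1).
- by rewrite ger0_norm // ger0_norm //; lra.
- by rewrite ger0_norm // ltr0_norm //; lra.
- lra.
- by rewrite ltr0_norm // ltr0_norm //; lra.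
Qed.

Lemma continuous_clamp : continuous clamp.
Proof.
move=> t; rewrite /clamp.
apply: cvgM; last exact: cvg_cst.
apply: cvgB; first (apply: cvgD; first exact: cvg_cst).
  by apply: cvg_norm; apply: cvg_id.
by apply: cvg_norm; apply: cvgB; [exact: cvg_id|exact: cvg_cst].
Qed.

Lemma within_clamp (T : topologicalType) (g : R -> T) :
  {within `[0, 1], continuous g} -> continuous (g \o clamp).
Proof.
move=> /subspace_continuousP H t.
have cl : `[0, 1]%classic (clamp t) by rewrite /= in_itv /= clamp01.
move=> B /(H _ cl) HB.
have HB' : nbhs (clamp t) [set x | `[0, 1]%classic x -> B (g x)] by exact: HB.
have HB2 : nbhs t (clamp @^-1` [set x | `[0, 1]%classic x -> B (g x)]).
  exact: continuous_clamp HB'.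
change (nbhs t ((g \o clamp) @^-1` B)).
by apply: filterS HB2 => s /=; apply; rewrite /= in_itv /= clamp01.
Qed.

Lemma continuous_pair (T U W : topologicalType) (f : T -> U) (g : T -> W) x :
  {for x, continuous f} -> {for x, continuous g} ->
  {for x, continuous (fun y => (f y, g y))}.
Proof. by move=> cf cg; apply: cvg_pair. Qed.

Lemma continuous_fst_at (T U W : topologicalType) (f : T -> U * W) x :
  {for x, continuous f} -> {for x, continuous (fun y => (f y).1)}.
Proof. by move=> cf; apply: cvg_comp cf _; apply: cvg_fst. Qed.

Lemma continuous_snd_at (T U W : topologicalType) (f : T -> U * W) x :
  {for x, continuous f} -> {for x, continuous (fun y => (f y).2)}.
Proof. by move=> cf; apply: cvg_comp cf _; apply: cvg_snd. Qed.

(** [t1] is the least point of the compact set where [h] is at most [rho]; by the intermediate value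
    theorem the value [rho] is taken no later than there. *)
Lemma first_hit (h : R -> R) (rho c : R) : continuous h ->
  0 < c -> rho < h 0 -> h c < rho ->
  exists t1, [/\ 0 < t1 < c, h t1 = rho & forall t, 0 <= t < t1 -> rho < h t].
Proof.
move=> ch c0 h0 hc.
pose A := `[0, c]%classic `&` [set t | h t <= rho].
have cA : compact A.
  apply: (subclosed_compact _ (@segment_compact _ 0 c)); last by move=> t [].
  apply: closedI; first exact: interval_closed.
  apply: (@preimage_closed _ _ h [set t | t <= rho]); first by move=> x _; exact: ch.
  exact: closed_le.
have A0 : A !=set0.
  by exists c; split; [rewrite /= in_itv /= lexx ltW|rewrite /= ltW].
have [t1 t1A min1] : exists2 t1, t1 \in A & forall t, t \in A -> t1 <= t.
  have := @compact_EVT_min _ R id A A0 cA; apply.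
  by apply: continuous_subspaceT => x; apply: cvg_id.
move: t1A; rewrite inE => -[/=]; rewrite in_itv /= => /andP [t10 t1c] ht1.
have E1 : h t1 = rho.
  have [x] : exists2 x, x \in `[0, t1]%R & h x = rho.
    apply: IVT => //; first exact: continuous_subspaceT.
    by rewrite ge_min le_max ht1 (ltW h0) orbT.
  rewrite in_itv /= => /andP [x0 xt1] hx.
  suff <- : x = t1 by [].
  apply/eqP; rewrite eq_le xt1 /=; apply: min1; rewrite inE.
  by split=> /=; rewrite ?in_itv /= ?x0 ?(le_trans xt1) ?hx.
exists t1; split=> //.
  rewrite !lt_neqAle t10 t1c !andbT; apply/andP; split.
    by apply/eqP => E; move: h0; rewrite E E1 ltxx.
  by apply/eqP => E; move: hc; rewrite -E E1 ltxx.
move=> t /andP [t0 tt1]; rewrite ltNge; apply/negP => ht.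
have : t1 <= t.
  apply: min1; rewrite inE; split => //=.
  by rewrite in_itv /= t0 (le_trans (ltW tt1)).
by rewrite leNgt tt1.
Qed.

Lemma fin_pos (I : finType) (P : I -> R -> Prop) :
  (forall i r s, s <= r -> P i r -> P i s) ->
  (forall i, exists2 r, 0 < r & P i r) -> exists2 r, 0 < r & forall i, P i r.
Proof.
move=> dc H.
have [r Hr] : exists r : I -> R, forall i, 0 < r i /\ P i (r i).
  apply: (@fin_all_exists I (fun=> R) (fun i r => 0 < r /\ P i r)) => i.
  by have [r] := H i; exists r.
exists (\big[Num.min/1]_i r i).
  elim/big_ind: _ => // [x y x0 y0|i _]; first by rewrite lt_min x0.
  by have [] := Hr i.
move=> i; have le_i : \big[Num.min/1]_i r i <= r i by apply: bigmin_le.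
exact: dc le_i (proj2 (Hr i)).
Qed.

End Clamp.

(* Unlike in [plane_drawing], arcs are continuous on the whole real line, so
   that they can be composed freely. *)
Record drw (R : realType) (V : finType) (G : {set {set V}})
    (pos : V -> R * R) (arc : {set V} -> R -> R * R) : Prop := Drw {
  drw_pos : injective pos;
  drw_cont : forall e, e \in G -> continuous (arc e);
  drw_inj : forall e s t, e \in G -> 0 <= s <= 1 -> 0 <= t <= 1 ->
    arc e s = arc e t -> s = t;
  drw_end : forall e, e \in G ->
    exists x y, [/\ e = [set x; y]%SET, arc e 0 = pos x & arc e 1 = pos y];
  drw_int : forall e t v, e \in G -> 0 < t < 1 -> arc e t <> pos v;
  drw_sep : forall e f s t, e \in G -> f \in G -> e != f ->
    0 < s < 1 -> 0 < t < 1 -> arc e s <> arc f t }.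

Section Drawing.
Variables (R : realType) (V : finType).
Implicit Types (G : {set {set V}}) (pos : V -> R * R)
  (arc : {set V} -> R -> R * R).

Lemma planar_drw G : planar R G <-> exists pos arc, @drw R V G pos arc.
Proof.
split=> [[pos [arc [pinj harc hint hsep]]]|[pos [arc D]]].
  exists pos, (fun e => arc e \o @clamp R); split => //.
  - by move=> e eG; apply: within_clamp; have [] := harc _ eG.
  - move=> e s t eG s01 t01; rewrite /= !clampK // => E.
    by have [_ I _] := harc _ eG; apply: I E; rewrite in_itv.
  - move=> e eG /=; rewrite !clampK ?lexx ?ler01 //.
    have [_ _ E] := harc _ eG.
    have [x xe Ex] : (pos @` [set` e]) (arc e 0) by rewrite -E; left.
    have [y ye Ey] : (pos @` [set` e]) (arc e 1) by rewrite -E; right.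
    exists x, y; split=> //; apply/setP => z; rewrite !inE.
    apply/idP/orP => [ze|[/eqP -> //|/eqP -> //]].
    have : (pos @` [set` e]) (pos z) by exists z.
    by rewrite -E => -[]; rewrite -?Ex -?Ey => /pinj ->; rewrite eqxx; auto.
  - move=> e t v eG t01 /=; rewrite clampK; first exact: hint.
    by case/andP: t01 => /ltW -> /ltW ->.
  - move=> e f s t eG fG ef s01 t01 /=; rewrite !clampK; first exact: hsep.
      by case/andP: t01 => /ltW -> /ltW ->.
    by case/andP: s01 => /ltW -> /ltW ->.
exists pos, arc; split.
- exact: drw_pos D.
- move=> e eG; split.
  + by apply: continuous_subspaceT; apply: drw_cont D _ eG.
  + by move=> s t; rewrite !in_itv /=; apply: drw_inj D _ _ _ eG.
  + have [x [y [-> -> ->]]] := drw_end D eG.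
    apply/seteqP; split=> z /=.
      by case=> ->; [exists x|exists y] => //=; rewrite !inE eqxx ?orbT.
    by case=> w /=; rewrite !inE => /orP [] /eqP -> <-; auto.
- by move=> e t v eG t01; exact: (drw_int D eG t01).
- by move=> e f s t eG fG ef s01 t01; exact: (drw_sep D eG fG ef s01 t01).
Qed.

Lemma drw_sub G G' pos arc : G' \subset G -> drw G pos arc -> drw G' pos arc.
Proof.
move=> /fintype.subsetP sub D; split.
- exact: drw_pos D.
- by move=> e /sub; apply: drw_cont D _.
- by move=> e s t /sub; apply: drw_inj D _ _ _.
- by move=> e /sub; apply: drw_end D _.
- by move=> e t v /sub eG t01; exact: (drw_int D eG t01).
- by move=> e f s t /sub eG /sub fG ef s01 t01; exact: (drw_sep D eG fG ef).
Qed.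

Lemma planar_sub G G' : G' \subset G -> planar R G -> planar R G'.
Proof.
move=> sub /planar_drw [pos [arc D]]; apply/planar_drw; exists pos, arc.
exact: drw_sub sub D.
Qed.

Lemma drw_pt G pos arc e (t : R) : drw G pos arc -> e \in G -> 0 <= t <= 1 ->
  (exists2 v, v \in e & arc e t = pos v) \/ 0 < t < 1.
Proof.
move=> D eG /andP [t0 t1]; have [x [y [E E0 E1]]] := drw_end D eG.
have [->|n0] := eqVneq t 0; first by left; exists x => //; rewrite E set21.
have [->|n1] := eqVneq t 1; first by left; exists y => //; rewrite E set22.
by right; rewrite !lt_neqAle eq_sym n0 n1 t0 t1.
Qed.

Lemma drw_orient G pos arc u v : drw G pos arc -> [set u; v]%SET \in G ->
  exists g : R -> R * R, [/\ continuous g, g 0 = pos u, g 1 = pos v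
   & (forall s t, 0 <= s <= 1 -> 0 <= t <= 1 -> g s = g t -> s = t) /\
   forall t, 0 < t < 1 -> exists2 s, 0 < s < 1 & g t = arc [set u; v]%SET s].
Proof.
move=> D eG; have [x [y [/set2_eqP E E0 E1]]] := drw_end D eG.
case: E E0 E1 => [[<- <-]|[<- <-]] E0 E1.
  exists (arc [set u; v]%SET); split=> //; first exact: drw_cont D _ eG.
  split; last by move=> t t01; exists t.
  by move=> s t; apply: drw_inj D _ _ _ eG.
exists (fun t => arc [set u; v]%SET (1 - t)); split.
- move=> t; apply: (@continuous_comp _ _ _ (fun t : R => 1 - t)).
    by apply: cvgB; [exact: cvg_cst|exact: cvg_id].
  exact: drw_cont D _ eG _.
- by rewrite subr0.
- by rewrite subrr.
- split=> [s t s01 t01 /(drw_inj D eG) E|t t01]; last by exists (1 - t); [lra|].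
  suff : 1 - s = 1 - t by lra.
  by apply: E; lra.
Qed.

End Drawing.

(** * Moving a drawing into a half plane *)

Section Inversion.
Variable R : realType.
Variables (q : R * R) (c s : R).
Hypothesis cs1 : c ^+ 2 + s ^+ 2 = 1.
Implicit Types z : R * R.

Definition sqdist (p z : R * R) : R := (z.1 - p.1) ^+ 2 + (z.2 - p.2) ^+ 2.

Lemma sqdist_gt0 p z : z <> p -> 0 < sqdist p z.
Proof.
move=> ne; rewrite lt_neqAle addr_ge0 ?sqr_ge0 // andbT eq_sym.
apply/eqP => /eqP; rewrite paddr_eq0 ?sqr_ge0 // !sqrf_eq0 !subr_eq0.
by case/andP=> /eqP E1 /eqP E2; apply: ne; case: z p E1 E2 => ? ? [? ?] /= -> ->.
Qed.

Lemma continuous_sqdist p z : {for z, continuous (sqdist p)}.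
Proof.
have c1 : {for z, continuous (fun y : R * R => y.1 - p.1)}.
  by apply: cvgB; [exact: cvg_fst|exact: cvg_cst].
have c2 : {for z, continuous (fun y : R * R => y.2 - p.2)}.
  by apply: cvgB; [exact: cvg_snd|exact: cvg_cst].
exact: cvgD (cvgM c1 c1) (cvgM c2 c2).
Qed.

(* Inversion at q followed by the rotation taking (c, s) to the first axis. *)
Definition inversion z : R * R :=
  ((((z.1 - q.1) * c + (z.2 - q.2) * s) / sqdist q z),
   (((z.2 - q.2) * c - (z.1 - q.1) * s) / sqdist q z)).

(** The squared norm of the image is the inverse of the squared distance to [q]. Equal images thus
    give equal denominators, and the rotation is undone by its transpose. *)
Lemma inversion_inj z z' : z <> q -> z' <> q ->
  inversion z = inversion z' -> z = z'.
Proof.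
move=> /sqdist_gt0 n0 /sqdist_gt0 n0' [].
set a := z.1 - q.1; set b := z.2 - q.2; set a' := z'.1 - q.1.
set b' := z'.2 - q.2; set n := sqdist q z; set n' := sqdist q z' => E1 E2.
have En : n = a ^+ 2 + b ^+ 2 by [].
have En' : n' = a' ^+ 2 + b' ^+ 2 by [].
have H k (x y : R) (h : k = x ^+ 2 + y ^+ 2) : 0 < k ->
    ((x * c + y * s) / k) ^+ 2 + ((y * c - x * s) / k) ^+ 2 = k^-1.
  move=> k0; rewrite !expr_div_n -mulrDl.
  have -> : (x * c + y * s) ^+ 2 + (y * c - x * s) ^+ 2
    = (x ^+ 2 + y ^+ 2) * (c ^+ 2 + s ^+ 2) by ring.
  by rewrite cs1 mulr1 -h; field; rewrite gt_eqF.
have nn : n = n'.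
  apply: invr_inj; rewrite -(H _ _ _ En n0) -(H _ _ _ En' n0').
  by rewrite E1 E2.
have nz : n^-1 != 0 by rewrite invr_eq0 gt_eqF.
move: E1 E2; rewrite -nn => /(mulIf nz) F1 /(mulIf nz) F2.
have Ea : a = a'.
  have -> : a = (a * c + b * s) * c - (b * c - a * s) * s.
    by rewrite -[LHS]mulr1 -cs1; ring.
  by rewrite F1 F2 -[RHS]mulr1 -cs1; ring.
have Eb : b = b'.
  have -> : b = (a * c + b * s) * s + (b * c - a * s) * c.
    by rewrite -[LHS]mulr1 -cs1; ring.
  by rewrite F1 F2 -[RHS]mulr1 -cs1; ring.
rewrite (surjective_pairing z) (surjective_pairing z').
by congr (_, _); [move: Ea|move: Eb]; rewrite /a /a' /b /b'; lra.
Qed.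

Lemma continuous_inversion z : z <> q -> {for z, continuous inversion}.
Proof.
move=> /sqdist_gt0 n0.
have c1 : {for z, continuous (fun y : R * R => y.1 - q.1)}.
  by apply: cvgB; [exact: cvg_fst|exact: cvg_cst].
have c2 : {for z, continuous (fun y : R * R => y.2 - q.2)}.
  by apply: cvgB; [exact: cvg_snd|exact: cvg_cst].
have ci : {for z, continuous (fun y : R * R => (sqdist q y)^-1)}.
  by apply: cvgV; [rewrite gt_eqF|exact: continuous_sqdist].
have cc (k : R) : {for z, continuous (fun=> k : R)} by apply: cvg_cst.
apply: continuous_pair; apply: cvgM => //.
  by apply: cvgD; apply: cvgM => //; apply: cc.
by apply: cvgB; apply: cvgM => //; apply: cc.
Qed.

Variables (p : R * R) (r : R).
Hypothesis r0 : 0 < r.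
Hypothesis qE : q = (p.1 + r * c, p.2 + r * s).

(** Law of cosines in the triangle [p], [q], [z], where the vector from [p] to [q] is [r] times (c,
    s). *)
Let E z : sqdist p z = sqdist q z +
  2 * r * ((z.1 - q.1) * c + (z.2 - q.2) * s) + r ^+ 2.
Proof.
rewrite qE /sqdist /=.
have -> : r ^+ 2 = r ^+ 2 * (c ^+ 2 + s ^+ 2) by rewrite cs1 mulr1.
ring.
Qed.

(** The circle with centre [p] and radius [r] passes through the pole [q], so it goes to a line,
    namely the first coordinate equal to - (2 * r)^-1, and its exterior goes to the right of that
    line. *)
Lemma inversion_out z : r ^+ 2 < sqdist p z ->
  - ((inversion z).1 + (2 * r)^-1) < 0.
Proof.
move=> out; have n0 : 0 < sqdist q z.
  apply: sqdist_gt0 => zq; move: out; rewrite E zq /sqdist !subrr.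
  by rewrite !mul0r expr0n /= !addr0 mulr0 addr0 add0r ltxx.
rewrite oppr_lt0 /inversion /=; move: out; rewrite E.
set n := sqdist q z in n0 *; set a := ((z.1 - q.1) * c + _) => out.
have -> : a / n + (2 * r)^-1 = (n + 2 * r * a) / (2 * r * n).
  by field; rewrite !gt_eqF.
by apply: divr_gt0; [lra|rewrite !mulr_gt0].
Qed.

Lemma inversion_on z : z <> q -> sqdist p z = r ^+ 2 ->
  - ((inversion z).1 + (2 * r)^-1) = 0.
Proof.
move=> /sqdist_gt0 n0 on; rewrite /inversion /=; move: on; rewrite E.
set n := sqdist q z in n0 *; set a := ((z.1 - q.1) * c + _) => on.
have -> : a / n + (2 * r)^-1 = (n + 2 * r * a) / (2 * r * n).
  by field; rewrite !gt_eqF.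
have -> : n + 2 * r * a = 0 by lra.
by rewrite mul0r oppr0.
Qed.

End Inversion.

(** Three points of the circle are tried, and two obstacles cannot exclude them all. The obstacles
    will be the two points where the arc is cut, which the pole must avoid. *)
Lemma third_point (R : realType) (p q1 q2 : R * R) (r : R) : 0 < r ->
  exists c s, [/\ c ^+ 2 + s ^+ 2 = 1, (p.1 + r * c, p.2 + r * s) <> q1
    & (p.1 + r * c, p.2 + r * s) <> q2].
Proof.
move=> r0.
pose pt (a : R * R) := (p.1 + r * a.1, p.2 + r * a.2).
have ptinj a b : a <> b -> pt a <> pt b.
  have rn : r != 0 by rewrite gt_eqF.
  case: a b => a1 a2 [b1 b2] ne [] /addrI /(mulfI rn) e1 /addrI /(mulfI rn) e2.
  by apply: ne; rewrite e1 e2.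
have n01 : pt (1, 0) <> pt (0, 1) by apply: ptinj => -[] /eqP; rewrite oner_eq0.
have n02 : pt (1, 0) <> pt (-1, 0) by apply: ptinj => -[] h; lra.
have n12 : pt (0, 1) <> pt (-1, 0) by apply: ptinj => -[] h; lra.
have [H0|H0] := pselect (pt (1, 0) <> q1 /\ pt (1, 0) <> q2).
  by exists 1, 0; case: H0; split=> //; ring.
have [H1|H1] := pselect (pt (0, 1) <> q1 /\ pt (0, 1) <> q2).
  by exists 0, 1; case: H1; split=> //; ring.
exists (-1), 0; split; first by ring.
- move=> E; change (pt (-1, 0) = q1) in E; subst q1.
  have e0 : pt (1, 0) = q2.
    by have [//|n] := eqVneq (pt (1, 0)) q2; case: H0; split=> //; apply/eqP.
  by apply: H1; split=> //; rewrite -e0; apply: nesym.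
- move=> E; change (pt (-1, 0) = q2) in E; subst q2.
  have e0 : pt (1, 0) = q1.
    by have [//|n] := eqVneq (pt (1, 0)) q1; case: H0; split=> //; apply/eqP.
  by apply: H1; split=> //; rewrite -e0; apply: nesym.
Qed.

(** One of the two ends left when the arc of an edge is cut: it runs from [u] to the point (0, y) of
    the boundary line and meets the rest of the drawing only at its start. *)
Record halfarc (R : realType) (V : finType) (G : {set {set V}})
    (pos : V -> R * R) (arc : {set V} -> R -> R * R)
    (al : R -> R * R) (u : V) (y : R) : Prop := Halfarc {
  ha_cont : continuous al;
  ha_inj : forall s t, 0 <= s <= 1 -> 0 <= t <= 1 -> al s = al t -> s = t;
  ha_0 : al 0 = pos u;
  ha_1 : al 1 = (0, y);
  ha_neg : forall t, 0 <= t < 1 -> (al t).1 < 0;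
  ha_pos : forall t w, 0 < t <= 1 -> al t <> pos w;
  ha_arc : forall t f s, 0 < t <= 1 -> f \in G -> 0 <= s <= 1 ->
    al t <> arc f s }.

(** A normal form for gluing: the two loose ends always reach the boundary at (0, 0) and (0, 1), so
    any such drawing fits the mirror image of any other. *)
Record halfplane (R : realType) (V : finType) (G : {set {set V}})
    (u v : V) (pos : V -> R * R) (arc : {set V} -> R -> R * R)
    (al be : R -> R * R) : Prop := Halfplane {
  hp_drw : drw (G :\ [set u; v])%SET pos arc;
  hp_pos : forall w, (pos w).1 < 0;
  hp_arc : forall f t, f \in (G :\ [set u; v])%SET -> 0 <= t <= 1 ->
    (arc f t).1 < 0;
  hp_al : halfarc (G :\ [set u; v])%SET pos arc al u 0;
  hp_be : halfarc (G :\ [set u; v])%SET pos arc be v 1;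
  hp_ab : forall s t, 0 <= s <= 1 -> 0 <= t <= 1 -> al s <> be t }.

Section CutDisc.
Variables (R : realType) (V : finType) (G : {set {set V}}).
Variables (pos : V -> R * R) (arc : {set V} -> R -> R * R).
Hypothesis D : drw G pos arc.
Variables (u v : V).
Hypothesis eG : [set u; v]%SET \in G.

(** The other arcs are compact and miss the chosen inner point, so their distances to it have a
    positive minimum. *)
Lemma free_disc (s : R) : 0 < s < 1 ->
  exists2 rho, 0 < rho &
    (forall w, rho < sqdist (arc [set u; v]%SET s) (pos w)) /\
    forall f t, f \in (G :\ [set u; v])%SET -> 0 <= t <= 1 ->
      rho < sqdist (arc [set u; v]%SET s) (arc f t).
Proof.
move=> s01; set p := arc _ s.
have [r1 r10 H1] : exists2 r : R, 0 < r & forall w, r < sqdist p (pos w).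
  apply: fin_pos => [i r r' le|w]; first exact: le_lt_trans le.
  have h : 0 < sqdist p (pos w).
    by apply: sqdist_gt0 => /esym; apply: drw_int D _ _ _ eG s01.
  by exists (sqdist p (pos w) / 2); lra.
have [r2 r20 H2] : exists2 r : R, 0 < r &
    forall f, f \in (G :\ [set u; v])%SET -> forall t, 0 <= t <= 1 ->
      r < sqdist p (arc f t).
  apply: fin_pos => [f r r' le H fG t t01|f].
    exact: le_lt_trans le (H fG t t01).
  have [fG|nfG] := boolP (f \in (G :\ [set u; v])%SET); last by exists 1.
  move: (fG); rewrite in_setD1 => /andP [ne fG'].
  have [c c01 Hc] : exists2 c, c \in `[0, 1]%R & forall t, t \in `[0, 1]%R ->
      sqdist p (arc f c) <= sqdist p (arc f t).
    apply: (@EVT_min R (fun t => sqdist p (arc f t)) 0 1) => //.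
    apply: continuous_subspaceT => t.
    apply: (@continuous_comp _ _ _ (arc f)); first exact: drw_cont D _ fG' _.
    exact: continuous_sqdist.
  rewrite in_itv in c01.
  have h : 0 < sqdist p (arc f c).
    apply: sqdist_gt0 => E; case: (drw_pt D fG' c01) => [[w _ Ew]|c01'].
      by apply: (drw_int D eG s01 (v := w)); rewrite -Ew E.
    exact: (drw_sep D fG' eG ne c01' s01 E).
  exists (sqdist p (arc f c) / 2); first by lra.
  by move=> _ t t01; apply: lt_le_trans (Hc t _); [lra|rewrite in_itv].
exists (Num.min r1 r2); first by rewrite lt_min r10.
split=> [w|f t fG t01]; first by rewrite gt_min H1.
by rewrite gt_min (H2 _ fG _ t01) orbT.
Qed.

End CutDisc.

Section ToHalfplane.
Variables (R : realType) (V : finType) (G : {set {set V}}).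
Variables (pos : V -> R * R) (arc : {set V} -> R -> R * R).
Hypothesis D : drw G pos arc.
Variables (u v : V).
Hypothesis eG : [set u; v]%SET \in G.

(* The arc of {u, v} is cut where it first enters and last leaves a small disc
   free of the rest of the drawing; a Moebius map with pole on the boundary
   circle then sends the outside of the disc to the half plane x < 0. *)
Lemma drw_halfplane : exists pos' arc' al be, @halfplane R V G u v pos' arc' al be.
Proof.
have [g [cg g0 g1 [ginj gint]]] := drw_orient D eG.
have hf : 0 < (1 / 2 : R) < 1 by lra.
have [s0 s001 Es0] := gint _ hf.
have [rho rho0 [rpos rarc]] := free_disc D eG s001.
rewrite -Es0 in rpos rarc; set p := g (1 / 2) in rpos rarc.
pose h t := sqdist p (g t).
have ch : continuous h.
  by move=> t; apply: (@continuous_comp _ _ _ g); [exact: cg|exact: continuous_sqdist].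
have hp : h (1 / 2) < rho by rewrite /h /sqdist !subrr expr0n addr0.
have [t1 [/andP [t10 t1h] ht1 lt1]] : exists t1,
    [/\ 0 < t1 < 1 / 2, h t1 = rho & forall t, 0 <= t < t1 -> rho < h t].
  by apply: first_hit => //; rewrite /h g0.
have [t2 [/andP [t20 t2h] ht2 lt2]] : exists t2, [/\ 0 < t2 < 1 / 2,
    h (1 - t2) = rho & forall t, 0 <= t < t2 -> rho < h (1 - t)].
  apply: (@first_hit _ (fun t => h (1 - t))) => //.
  - move=> t; apply: (@continuous_comp _ _ _ (fun t : R => 1 - t)); last exact: ch.
    by apply: cvgB; [exact: cvg_cst|exact: cvg_id].
  - by rewrite /h subr0 g1.
  - by have -> : 1 - 1 / 2 = 1 / 2 :> R by lra.
pose r := Num.sqrt rho.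
have r0 : 0 < r by rewrite sqrtr_gt0.
have rr : r ^+ 2 = rho by rewrite sqr_sqrtr // ltW.
have [c [s [cs1 q1 q2]]] := third_point p (g t1) (g (1 - t2)) r0.
set q := (_, _) in q1 q2.
have onq : sqdist p q = rho.
  rewrite -rr /sqdist /q /=; have -> : r ^+ 2 = r ^+ 2 * (c ^+ 2 + s ^+ 2) by rewrite cs1 mulr1.
  by ring.
pose I := inversion q c s.
have outq z : rho < sqdist p z -> z <> q.
  by move=> o zq; move: o; rewrite zq onq ltxx.
(* Both cut points lie on the circle, so their images have the same first coordinate; the images
   being distinct, the second coordinates differ and can be rescaled to 0 and 1. *)
have Y12 : (I (g (1 - t2))).2 - (I (g t1)).2 != 0.
  rewrite subr_eq0; apply/eqP => EY.
  suff : t1 = 1 - t2 by lra.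
  apply: ginj; [lra|lra|].
  apply: (inversion_inj cs1 (nesym q1) (nesym q2)).
  rewrite [LHS]surjective_pairing [RHS]surjective_pairing -/I EY; congr (_, _).
  have e1 := inversion_on cs1 r0 (erefl q) (nesym q1).
  have e2 := inversion_on cs1 r0 (erefl q) (nesym q2).
  rewrite rr in e1 e2; move: (e1 ht1) (e2 ht2); rewrite -/I; lra.
(* The sign puts the outside of the disc at x < 0; the affine change of the second coordinate takes
   the cut points to (0, 0) and (0, 1). *)
pose Phi z : R * R := (- ((I z).1 + (2 * r)^-1),
  ((I z).2 - (I (g t1)).2) / ((I (g (1 - t2))).2 - (I (g t1)).2)).
have Pout z : rho < sqdist p z -> (Phi z).1 < 0.
  by rewrite -rr => o; apply: (inversion_out cs1 r0 (erefl q) o).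
have Pinj z z' : z <> q -> z' <> q -> Phi z = Phi z' -> z = z'.
  move=> zq zq' [] /oppr_inj /addIr E1 /(mulIf (invr_neq0 Y12)) /addIr E2.
  apply: (inversion_inj cs1 zq zq'); rewrite -/I.
  rewrite [LHS]surjective_pairing [RHS]surjective_pairing.
  by congr (_, _); [exact: E1|exact: E2].
have Pcont z : z <> q -> {for z, continuous Phi}.
  move=> zq; have cI : {for z, continuous I} by apply: continuous_inversion.
  have cc (k : R) : {for z, continuous (fun=> k : R)} by apply: cvg_cst.
  apply: continuous_pair.
    by apply: cvgN; apply: cvgD (cc _); apply: continuous_fst_at.
  by apply: cvgM (cc _); apply: cvgB (cc _); apply: continuous_snd_at.
have Pcurve (k : R -> R * R) (a b : R) : continuous k ->
    (forall t, 0 <= t <= 1 -> k (a + b * t) <> q) ->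
    continuous (fun t => Phi (k (a + b * clamp t))).
  move=> ck kq t.
  apply: (@continuous_comp _ _ _ (fun t => k (a + b * clamp t)) Phi).
    apply: (@continuous_comp _ _ _ (fun t => a + b * clamp t) k); last exact: ck.
    apply: cvgD; first exact: cvg_cst.
    by apply: cvgM; [exact: cvg_cst|exact: continuous_clamp].
  by apply: Pcont; apply: kq; apply: clamp01.
have Glt1 t : 0 <= t < 1 -> rho < h (0 + t1 * t).
  move=> /andP [h0 h1]; apply: lt1; rewrite add0r mulr_ge0 ?(ltW t10) //=.
  by rewrite gtr_pMr.
have Glt2 t : 0 <= t < 1 -> rho < h (1 + (- t2) * t).
  move=> /andP [h0 h1]; rewrite mulNr; apply: lt2; rewrite mulr_ge0 ?(ltW t20) //=.
  by rewrite gtr_pMr.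
have Gq1 t : 0 <= t <= 1 -> g (0 + t1 * t) <> q.
  move=> /andP [h0]; rewrite le_eqVlt => /orP [/eqP ->|h1].
    by rewrite add0r mulr1; exact: nesym q1.
  by apply: outq; apply: Glt1; rewrite h0.
have Gq2 t : 0 <= t <= 1 -> g (1 + (- t2) * t) <> q.
  move=> /andP [h0]; rewrite le_eqVlt => /orP [/eqP ->|h1].
    by rewrite mulr1; exact: nesym q2.
  by apply: outq; apply: Glt2; rewrite h0.
have b1 (t : R) : 0 < t <= 1 -> 0 < 0 + t1 * t < 1.
  move=> /andP [h0 h1]; rewrite add0r mulr_gt0 //=.
  by apply: le_lt_trans (_ : t1 < 1); [rewrite ger_pMr|lra].
have b2 (t : R) : 0 < t <= 1 -> 0 < 1 + (- t2) * t < 1.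
  move=> /andP [h0 h1]; have : 0 < t2 * t by rewrite mulr_gt0.
  have : t2 * t <= t2 by rewrite ger_pMr.
  by move=> *; apply/andP; split; lra.
have sub : (G :\ [set u; v])%SET \subset G by apply: subsetDl.
have inG f : f \in (G :\ [set u; v])%SET -> f \in G by move/(fintype.subsetP sub).
have arcq f t : f \in (G :\ [set u; v])%SET -> 0 <= t <= 1 -> arc f t <> q.
  by move=> fG t01; apply: outq; apply: rarc.
have posq w : pos w <> q by apply: outq.
have gpos t w : 0 < t < 1 -> g t <> pos w.
  by move=> t01; have [t' t01' ->] := gint _ t01; apply: drw_int D _ _ _ eG t01'.
have garc t f t' : 0 < t < 1 -> f \in (G :\ [set u; v])%SET -> 0 <= t' <= 1 ->
    g t <> arc f t'.
  move=> t01 fG t01'; case: (drw_pt D (inG _ fG) t01') => [[w _ ->]|o].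
    exact: gpos.
  have [t2' o2 ->] := gint _ t01.
  move: fG; rewrite in_setD1 eq_sym => /andP [ne fG].
  exact: (drw_sep D eG fG ne o2 o).
exists (Phi \o pos), (fun f t => Phi (arc f (0 + 1 * clamp t))).
exists (fun t => Phi (g (0 + t1 * clamp t))).
exists (fun t => Phi (g (1 + (- t2) * clamp t))).
have cl0 : clamp 0 = 0 :> R by rewrite clampK ?lexx ?ler01.
have cl1 : clamp 1 = 1 :> R by rewrite clampK ?lexx ?ler01.
have cW (t : R) : 0 < t < 1 -> 0 <= t <= 1 by move=> /andP [/ltW -> /ltW ->].
have cl (t : R) : 0 <= t <= 1 -> 0 + 1 * clamp t = t.
  by move=> t01; rewrite add0r mul1r clampK.
split.
- split.
  + by move=> w w' /= /Pinj H; apply: (drw_pos D); apply: H.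
  + move=> f fG; apply: Pcurve; first exact: drw_cont D _ (inG _ fG).
    by move=> t t01; rewrite add0r mul1r; apply: arcq.
  + move=> f t t' fG t01 t01'; rewrite !cl // => /Pinj H.
    by apply: (drw_inj D (inG _ fG)) => //; apply: H; apply: arcq.
  + move=> f fG; have [x [y [E e0 e1]]] := drw_end D (inG _ fG).
    exists x, y; split=> //.
      by rewrite cl ?lexx ?ler01 // e0.
    by rewrite cl ?lexx ?ler01 // e1.
  + move=> f t w fG t01; rewrite cl ?cW // => /Pinj H.
    apply: (drw_int D (inG _ fG) t01); apply: H => //; apply: arcq => //.
    exact: cW.
  + move=> f f' t t' fG fG' ne t01 t01'; rewrite !cl ?cW // => /Pinj H.
    apply: (drw_sep D (inG _ fG) (inG _ fG') ne t01 t01').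
    by apply: H; apply: arcq => //; apply: cW.
- by move=> w; apply: Pout.
- by move=> f t fG t01; rewrite cl //; apply: Pout; apply: rarc.
- split.
  + exact: Pcurve.
  + move=> t t' t01 t01'; rewrite !clampK // => /Pinj H.
    have {H} := H (Gq1 _ t01) (Gq1 _ t01') => /ginj H.
    have hh (x : R) : 0 <= x <= 1 -> 0 <= 0 + t1 * x <= 1.
      move=> /andP [x0 x1]; rewrite add0r mulr_ge0 ?(ltW t10) //=.
      by apply: le_trans (_ : t1 <= 1); [rewrite ger_pMr|lra].
    have := H (hh _ t01) (hh _ t01'); rewrite !add0r.
    by apply: mulfI; rewrite gt_eqF.
  + by rewrite cl0 mulr0 addr0 g0.
  + rewrite cl1 mulr1 add0r /Phi subrr mul0r; congr (_, _).
    by apply: (inversion_on cs1 r0 (erefl q) (nesym q1)); rewrite rr.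
  + by move=> t /[dup] t01 /andP [? /ltW ?]; rewrite clampK ?Pout ?Glt1 //; apply/andP.
  + move=> t w /[dup] t01 /andP [/ltW ? ?]; rewrite clampK; last exact/andP.
    move=> /Pinj H; apply: (gpos _ w (b1 _ t01)); apply: H => //.
    by apply: Gq1; apply/andP.
  + move=> t f t' /[dup] t01 /andP [/ltW ? ?] fG t01'.
    rewrite clampK; last exact/andP.
    rewrite cl // => /Pinj H; apply: (garc _ _ _ (b1 _ t01) fG t01').
    by apply: H; [apply: Gq1; apply/andP|exact: arcq].
- split.
  + exact: Pcurve.
  + move=> t t' t01 t01'; rewrite !clampK // => /Pinj H.
    have {H} := H (Gq2 _ t01) (Gq2 _ t01') => /ginj H.
    have hh (x : R) : 0 <= x <= 1 -> 0 <= 1 + (- t2) * x <= 1.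
      move=> /andP [x0 x1]; have : 0 <= t2 * x by rewrite mulr_ge0 // ltW.
      have : t2 * x <= t2 by rewrite ger_pMr.
      by move=> *; apply/andP; split; lra.
    have := H (hh _ t01) (hh _ t01') => /addrI.
    by apply: mulfI; rewrite oppr_eq0 gt_eqF.
  + by rewrite cl0 mulr0 addr0 g1.
  + rewrite cl1 mulr1 /Phi divff //; congr (_, _).
    by apply: (inversion_on cs1 r0 (erefl q) (nesym q2)); rewrite rr.
  + by move=> t /[dup] t01 /andP [? /ltW ?]; rewrite clampK ?Pout ?Glt2 //; apply/andP.
  + move=> t w /[dup] t01 /andP [/ltW ? ?]; rewrite clampK; last exact/andP.
    move=> /Pinj H; apply: (gpos _ w (b2 _ t01)); apply: H => //.
    by apply: Gq2; apply/andP.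
  + move=> t f t' /[dup] t01 /andP [/ltW ? ?] fG t01'.
    rewrite clampK; last exact/andP.
    rewrite cl // => /Pinj H; apply: (garc _ _ _ (b2 _ t01) fG t01').
    by apply: H; [apply: Gq2; apply/andP|exact: arcq].
- move=> a b a01 b01; rewrite !clampK // => /Pinj H.
  have {H} := H (Gq1 _ a01) (Gq2 _ b01) => /ginj H.
  case/andP: a01 b01 => a0 a1 /andP [b0 b1'].
  have ha : t1 * a <= t1 by rewrite ger_pMr.
  have hb : t2 * b <= t2 by rewrite ger_pMr.
  have ha0 : 0 <= t1 * a by rewrite mulr_ge0 // ltW.
  have hb0 : 0 <= t2 * b by rewrite mulr_ge0 // ltW.
  by have : 0 + t1 * a = 1 + (- t2) * b; [apply: H; apply/andP; split; lra|lra].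
Qed.

End ToHalfplane.

(** * Gluing two half plane drawings *)

Section HalfCurves.
Variables (R : realType) (V : finType) (G : {set {set V}}) (u v : V).
Variables (pos : V -> R * R) (arc : {set V} -> R -> R * R).
Variables (al be : R -> R * R).
Hypothesis H : halfplane G u v pos arc al be.
Variables (a b : {set V}).
Let G' := (G :\ [set u; v])%SET.

(** The two half arcs are treated as arcs of two formal edges [a] and [b], which will be the new
    edges of the swap, so that both sides of the gluing are handled alike. *)
Definition hcurve (f : {set V}) : R -> R * R :=
  if f == a then al else if f == b then be else arc f.

Let dom f := [|| f == a, f == b | f \in G'].

Lemma hcurve_sep f g s t : dom f -> dom g -> f != g -> 0 < s < 1 ->
  0 < t < 1 -> hcurve f s <> hcurve g t.
Proof.
have W (x : R) : 0 < x < 1 -> [/\ 0 <= x <= 1, 0 < x <= 1 & 0 <= x < 1].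
  by move=> /andP [/[dup] h0 /ltW -> /[dup] h1 /ltW ->]; rewrite h0 h1.
rewrite /dom /hcurve => df dg fg /[dup] s01 /W [s1 s2 s3] /[dup] t01 /W [t1 t2 t3].
have [Ef|nfa] := eqVneq f a.
  have [Eg|nga] := eqVneq g a; first by rewrite Ef Eg eqxx in fg.
  have [Eg|ngb] := eqVneq g b; first exact: (hp_ab H s1 t1).
  rewrite (negbTE nga) (negbTE ngb) in dg.
  exact: (ha_arc (hp_al H) s2 dg t1).
have [Ef|nfb] := eqVneq f b.
  have [Eg|nga] := eqVneq g a; first by apply: nesym; exact: (hp_ab H t1 s1).
  have [Eg|ngb] := eqVneq g b; first by rewrite Ef Eg eqxx in fg.
  rewrite (negbTE nga) (negbTE ngb) in dg.
  exact: (ha_arc (hp_be H) s2 dg t1).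
rewrite (negbTE nfa) (negbTE nfb) in df.
have [Eg|nga] := eqVneq g a.
  by apply: nesym; exact: (ha_arc (hp_al H) t2 df s1).
have [Eg|ngb] := eqVneq g b.
  by apply: nesym; exact: (ha_arc (hp_be H) t2 df s1).
rewrite (negbTE nga) (negbTE ngb) in dg.
exact: (drw_sep (hp_drw H) df dg fg s01 t01).
Qed.

Lemma hcurve_pos f s w : dom f -> 0 < s < 1 -> hcurve f s <> pos w.
Proof.
rewrite /dom /hcurve => df s01.
have s2 : 0 < s <= 1 by case/andP: s01 => -> /ltW.
have [Ef|nfa] := eqVneq f a; first exact: (ha_pos (hp_al H) s2).
have [Ef|nfb] := eqVneq f b; first exact: (ha_pos (hp_be H) s2).
rewrite (negbTE nfa) (negbTE nfb) in df.
exact: (drw_int (hp_drw H) df s01).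
Qed.

End HalfCurves.

Definition reflect_x (R : realType) (z : R * R) : R * R := (- z.1, z.2).

Lemma reflect_xK (R : realType) : involutive (@reflect_x R).
Proof. by case=> x y; rewrite /reflect_x /= opprK. Qed.

Lemma continuous_reflect_x (R : realType) (g : R -> R * R) :
  continuous g -> continuous (fun t => reflect_x (g t)).
Proof.
move=> cg t; apply: (@continuous_pair _ _ _ (fun y => - (g y).1) (fun y => (g y).2)).
  by apply: cvgN; apply: continuous_fst_at; exact: cg.
by apply: continuous_snd_at; exact: cg.
Qed.

Section JoinCurves.
Variables (R : realType) (a b : R -> R * R) (y : R).
Hypotheses (ca : continuous a) (cb : continuous b).
Hypotheses (a1 : a 1 = (0, y)) (b1 : b 1 = (0, y)).

(* First a, then the reflection of b run backwards; both pass through (0, y). *)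
Definition join_curve (t : R) : R * R :=
  a (clamp (2 * t)) + reflect_x (b (clamp (2 - 2 * t))) - (0, y).

Lemma continuous_join_curve : continuous join_curve.
Proof.
move=> t; have cl (w : R -> R) : {for t, continuous w} ->
    {for t, continuous (fun s => clamp (w s))}.
  by move=> cw; apply: (@continuous_comp _ _ _ w) => //; exact: continuous_clamp.
have c1 : {for t, continuous (fun s : R => 2 * s)}.
  by apply: cvgM; [exact: cvg_cst|exact: cvg_id].
have c2 : {for t, continuous (fun s : R => 2 - 2 * s)}.
  by apply: cvgB => //; exact: cvg_cst.
have h1 : {for t, continuous (fun s : R => a (clamp (2 * s)))}.
  by apply: (@continuous_comp _ _ _ (fun s : R => clamp (2 * s)) a); [exact: cl|exact: ca].
have h2 : {for t, continuous (fun s : R => reflect_x (b (clamp (2 - 2 * s))))}.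
  apply: (@continuous_comp _ _ _ (fun s : R => clamp (2 - 2 * s))
    (fun s => reflect_x (b s))); first exact: cl.
  exact: continuous_reflect_x.
by apply: cvgB (cvg_cst _); apply: cvgD.
Qed.

Lemma join_curve_l t : 0 <= t <= 1 / 2 -> join_curve t = a (2 * t).
Proof.
move=> /andP [t0 t1]; rewrite /join_curve clampK; last by lra.
have -> : clamp (2 - 2 * t) = 1.
  by rewrite /clamp ger0_norm ?ger0_norm; lra.
by rewrite b1 /reflect_x oppr0 addrK.
Qed.

Lemma join_curve_r t : 1 / 2 <= t <= 1 -> join_curve t = reflect_x (b (2 - 2 * t)).
Proof.
move=> /andP [t0 t1]; rewrite /join_curve (@clampK _ (2 - 2 * t)); last by lra.
have -> : clamp (2 * t) = 1.
  by rewrite /clamp ger0_norm ?ger0_norm; lra.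
by rewrite a1 [(0, y) + _]addrC addrK.
Qed.

End JoinCurves.

Section PlanarSwap.
Variables (R : realType) (V : finType) (S1 S2 : {set V}).
Variables (G1 G2 : {set {set V}}) (u1 v1 u2 v2 : V).
Hypotheses (dis : fintype.disjoint (mem S1) (mem S2)).
Hypotheses (s1 : supp G1 S1) (s2 : supp G2 S2).
Hypotheses (g1 : simple_graph G1) (g2 : simple_graph G2).
Hypotheses (a1 : adj G1 u1 v1) (a2 : adj G2 u2 v2).

(** Put both graphs in the normal form [halfplane] and reflect the second into x > 0. The half arcs
    from [u1] and [u2] then meet at (0, 0), those from [v1] and [v2] at (0, 1). *)
Lemma planar_swap : planar R G1 -> planar R G2 ->
  planar R (swap G1 G2 u1 v1 u2 v2).
Proof.
move=> /planar_drw [p1 [c1 D1]] /planar_drw [p2 [c2 D2]]; apply/planar_drw.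
have [[u1S v1S u2S v2S] [uv1 uv2]] := swap_ends s1 s2 g1 g2 a1 a2.
have [{D1 c1 p1} p1 [c1 [al1 [be1 H1]]]] := drw_halfplane D1 a1.
have [{D2 c2 p2} p2 [c2 [al2 [be2 H2]]]] := drw_halfplane D2 a2.
set eu := [set u1; u2]%SET; set ev := [set v1; v2]%SET.
set G1' := (G1 :\ [set u1; v1])%SET; set G2' := (G2 :\ [set u2; v2])%SET.
have D1 := hp_drw H1; have D2 := hp_drw H2.
have neS x : x \in S1 -> (x \in S2) = false by exact: disjointFr.
have nee : eu != ev.
  apply/eqP => /set2_eqP [[E _]|[E _]]; first by rewrite E eqxx in uv1.
  by move: (neS _ u1S); rewrite E v2S.
have sub1 f : f \in G1' -> f \subset S1.
  by rewrite in_setD1 => /andP [_ /(forall_inP s1)].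
have sub2 f : f \in G2' -> f \subset S2.
  by rewrite in_setD1 => /andP [_ /(forall_inP s2)].
have eu1 : eu \notin G1'.
  apply/negP => /sub1 /fintype.subsetP /(_ u2); rewrite set22 => /(_ isT) /neS.
  by rewrite u2S.
have ev1 : ev \notin G1'.
  apply/negP => /sub1 /fintype.subsetP /(_ v2); rewrite set22 => /(_ isT) /neS.
  by rewrite v2S.
have eu2 : eu \notin G2'.
  by apply/negP => /sub2 /fintype.subsetP /(_ u1); rewrite set21 => /(_ isT); rewrite neS.
have ev2 : ev \notin G2'.
  by apply/negP => /sub2 /fintype.subsetP /(_ v1); rewrite set21 => /(_ isT); rewrite neS.
have dis12 f : f \in G2' -> f \notin G1'.
  move=> f2; apply/negP => f1; have [x [y [E _ _]]] := drw_end D1 f1.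
  have xf : x \in f by rewrite E set21.
  have /neS := fintype.subsetP (sub1 _ f1) _ xf.
  by rewrite (fintype.subsetP (sub2 _ f2) _ xf).
pose pos x := if x \in S1 then p1 x else reflect_x (p2 x).
pose ju := join_curve al1 al2 0; pose jv := join_curve be1 be2 1.
pose arc f := if f == eu then ju else if f == ev then jv
  else if f \in G1' then c1 f else (fun t => reflect_x (c2 f t)).
have al11 := ha_1 (hp_al H1); have al21 := ha_1 (hp_al H2).
have be11 := ha_1 (hp_be H1); have be21 := ha_1 (hp_be H2).
have juL := join_curve_l al1 al21; have juR := join_curve_r al2 al11.
have jvL := join_curve_l be1 be21; have jvR := join_curve_r be2 be11.
have arcu : arc eu = ju by rewrite /arc eqxx.
have arcv : arc ev = jv by rewrite /arc eq_sym (negbTE nee) eqxx.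
have arc1 f : f \in G1' -> arc f = c1 f.
  move=> f1; rewrite /arc f1; have [E|_] := eqVneq; first by rewrite E (negbTE eu1) in f1.
  by have [E|_] := eqVneq; first by rewrite E (negbTE ev1) in f1.
have arc2 f : f \in G2' -> arc f = (fun t => reflect_x (c2 f t)).
  move=> f2; rewrite /arc (negbTE (dis12 _ f2)).
  have [E|_] := eqVneq; first by rewrite E (negbTE eu2) in f2.
  by have [E|_] := eqVneq; first by rewrite E (negbTE ev2) in f2.
have Gcase f : f \in swap G1 G2 u1 v1 u2 v2 ->
    [\/ f = eu, f = ev, f \in G1' | f \in G2'].
  rewrite /swap !finset.in_setU !finset.in_set1 -/G1' -/G2' => /orP [/orP [f1|f2]|/orP [/eqP E|/eqP E]].
  - exact: Or43.
  - exact: Or44.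
  - exact: Or41.
  - exact: Or42.
have rinj z z' : reflect_x z = reflect_x z' -> z = z' :> R * R.
  by apply: can_inj; apply: reflect_xK.
have W (x : R) : 0 < x < 1 -> [/\ 0 <= x <= 1, 0 < x <= 1 & 0 <= x < 1].
  by move=> /andP [/[dup] h0 /ltW -> /[dup] h1 /ltW ->]; rewrite h0 h1.
(* An inner point of an arc lies on the left, on the right, or on the axis, where the two new edges
   have different heights. Only points of the same kind can coincide. *)
have cases f s : f \in swap G1 G2 u1 v1 u2 v2 -> 0 < s < 1 ->
    [\/ exists2 s', 0 < s' < 1 & [/\ [|| f == eu, f == ev | f \in G1'],
          arc f s = hcurve c1 al1 be1 eu ev f s' & (arc f s).1 < 0],
        (arc f s).1 = 0 /\ (f = eu /\ (arc f s).2 = 0 \/ f = ev /\ (arc f s).2 = 1)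
      | exists2 s', 0 < s' < 1 & [/\ [|| f == eu, f == ev | f \in G2'],
          reflect_x (arc f s) = hcurve c2 al2 be2 eu ev f s' & 0 < (arc f s).1]].
  move=> fG s01; case: (Gcase _ fG) => [E|E|f1|f2].
  - rewrite E arcu /hcurve eqxx; case: (ltgtP s (1 / 2)) => hs.
    + apply: Or31; exists (2 * s); first by lra.
      rewrite /ju juL; last by lra.
      by split=> //; apply: (ha_neg (hp_al H1)); lra.
    + apply: Or33; exists (2 - 2 * s); first by lra.
      rewrite /ju juR; last by lra.
      split=> //; first by rewrite reflect_xK.
      by rewrite /= oppr_gt0; apply: (ha_neg (hp_al H2)); lra.
    + apply: Or32; rewrite /ju juL; last by lra.
      have -> : 2 * s = 1 by lra.
      by rewrite al11; split=> //; left.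
  - rewrite E arcv /hcurve eq_sym (negbTE nee) eqxx.
    case: (ltgtP s (1 / 2)) => hs.
    + apply: Or31; exists (2 * s); first by lra.
      rewrite /jv jvL; last by lra.
      by split=> //; apply: (ha_neg (hp_be H1)); lra.
    + apply: Or33; exists (2 - 2 * s); first by lra.
      rewrite /jv jvR; last by lra.
      split=> //; first by rewrite reflect_xK.
      by rewrite /= oppr_gt0; apply: (ha_neg (hp_be H2)); lra.
    + apply: Or32; rewrite /jv jvL; last by lra.
      have -> : 2 * s = 1 by lra.
      by rewrite be11; split=> //; right.
  - apply: Or31; exists s => //; rewrite f1 !orbT arc1 // /hcurve.
    have [s0 _ _] := W _ s01; split=> //; last exact: (hp_arc H1).
    have [E|_] := eqVneq f eu; first by rewrite -E f1 in eu1.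
    by have [E|_] := eqVneq f ev; first by rewrite -E f1 in ev1.
  - apply: Or33; exists s => //; rewrite f2 !orbT arc2 // /hcurve reflect_xK.
    have [s0 _ _] := W _ s01.
    split=> //; last by rewrite /= oppr_gt0; exact: (hp_arc H2).
    have [E|_] := eqVneq f eu; first by rewrite -E f2 in eu2.
    by have [E|_] := eqVneq f ev; first by rewrite -E f2 in ev2.
have jinj (a b : R -> R * R) y (u v : V) G G' p p' c c' :
    halfarc G p c a u y -> halfarc G' p' c' b v y ->
    forall s t, 0 <= s <= 1 -> 0 <= t <= 1 ->
    join_curve a b y s = join_curve a b y t -> s = t.
  move=> Ha Hb.
  have key s t : 0 <= s -> s < t -> t <= 1 -> join_curve a b y s <> join_curve a b y t.
    move=> hs st ht E; have [t2|t2] := leP t (1 / 2).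
      move: E; rewrite !(join_curve_l a (ha_1 Hb)); [|lra|lra].
      by move=> /(ha_inj Ha) E; have : 2 * s = 2 * t by [apply: E; lra]; lra.
    have [sh|sh] := ltP s (1 / 2).
      move: E; rewrite (join_curve_l a (ha_1 Hb)); last by lra.
      rewrite (join_curve_r b (ha_1 Ha)); last by lra.
      have n1 : (a (2 * s)).1 < 0 by apply: (ha_neg Ha); lra.
      have n2 : (b (2 - 2 * t)).1 < 0 by apply: (ha_neg Hb); lra.
      move=> E; have : (a (2 * s)).1 = - (b (2 - 2 * t)).1 by rewrite E.
      lra.
    move: E; rewrite !(join_curve_r b (ha_1 Ha)); [|lra|lra].
    move=> /rinj /(ha_inj Hb) E.
    have : 2 - 2 * s = 2 - 2 * t by [apply: E; lra].
    lra.
  move=> s t /andP [s0' s1'] /andP [t0' t1'] E; case: (ltgtP s t) => // lt.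
    by case: (key _ _ s0' lt t1').
  by case: (key _ _ t0' lt s1').
exists pos, arc; split.
- move=> x y; rewrite /pos; have n1 := hp_pos H1; have n2 := hp_pos H2.
  case: ifP => xS; case: ifP => yS E.
  + exact: (drw_pos D1).
  + by move: (n1 x) (n2 y); rewrite E /= oppr_lt0 ltNge => /negP + /ltW.
  + by move: (n1 y) (n2 x); rewrite -E /= oppr_lt0 ltNge => /negP + /ltW.
  + by move/rinj: E; apply: (drw_pos D2).
- move=> f /Gcase [->|->|f1|f2].
  + rewrite arcu; apply: continuous_join_curve.
      exact: ha_cont (hp_al H1).
    exact: ha_cont (hp_al H2).
  + rewrite arcv; apply: continuous_join_curve.
      exact: ha_cont (hp_be H1).
    exact: ha_cont (hp_be H2).
  + by rewrite arc1 //; apply: (drw_cont D1).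
  + by rewrite arc2 //; apply: continuous_reflect_x; apply: (drw_cont D2).
- move=> f s t /Gcase [->|->|f1|f2].
  + by rewrite arcu; apply: jinj (hp_al H1) (hp_al H2) _ _.
  + by rewrite arcv; apply: jinj (hp_be H1) (hp_be H2) _ _.
  + by rewrite arc1 //; apply: (drw_inj D1).
  + by rewrite arc2 // => s01 t01 /rinj; apply: (drw_inj D2).
- move=> f /Gcase [->|->|f1|f2].
  + exists u1, u2; rewrite arcu /ju /pos u1S juL ?juR; [|lra|lra].
    rewrite mulr0 mulr1 subrr (ha_0 (hp_al H1)) (ha_0 (hp_al H2)).
    by case: ifP => // /neS; rewrite u2S.
  + exists v1, v2; rewrite arcv /jv /pos v1S jvL ?jvR; [|lra|lra].
    rewrite mulr0 mulr1 subrr (ha_0 (hp_be H1)) (ha_0 (hp_be H2)).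
    by case: ifP => // /neS; rewrite v2S.
  + have [x [y [E e0 e1]]] := drw_end D1 f1; exists x, y.
    have := sub1 _ f1; rewrite E finset.subUset !finset.sub1set => /andP [xS yS].
    by rewrite /pos xS yS -E arc1.
  + have [x [y [E e0 e1]]] := drw_end D2 f2; exists x, y.
    have := sub2 _ f2; rewrite E finset.subUset !finset.sub1set => /andP [xS yS].
    rewrite /pos -E arc2 // e0 e1; split=> //.
      by case: ifP => // /neS; rewrite xS.
    by case: ifP => // /neS; rewrite yS.
- move=> f s w fG s01; rewrite /pos.
  have n1 := hp_pos H1 w; have n2 := hp_pos H2 w.
  case: (cases f s fG s01) => [[s' s01' [df -> neg]]|[z _]|[s' s01' [df E neg]]].
  + case: ifP => _ E; first exact: (hcurve_pos H1 df s01' E).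
    by move: neg; rewrite E /=; lra.
  + by case: ifP => _ E; move: z; rewrite E /=; lra.
  + case: ifP => _ E'; first by move: neg; rewrite E' /=; lra.
    by move: E; rewrite E' reflect_xK => /esym; apply: (hcurve_pos H2 df s01').
- move=> f g s t fG gG fg s01 t01 Efg.
  case: (cases f s fG s01) => [[s' s01' [df Ef neg]]|[z Z]|[s' s01' [df Ef neg]]];
  case: (cases g t gG t01) => [[t' t01' [dg Eg ng]]|[z' Z']|[t' t01' [dg Eg ng]]];
  try (by move: ng; rewrite -Efg; lra); try (by move: z'; rewrite -Efg; lra).
  + by apply: (hcurve_sep H1 df dg fg s01' t01'); rewrite -Ef -Eg.
  + move: Z'; rewrite -Efg.
    case: Z => [[Ef E2]|[Ef E2]]; case=> [[Eg E2']|[Eg E2']].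
    * by rewrite Ef Eg eqxx in fg.
    * by move: E2'; rewrite E2; lra.
    * by move: E2'; rewrite E2; lra.
    * by rewrite Ef Eg eqxx in fg.
  + by apply: (hcurve_sep H2 df dg fg s01' t01'); rewrite -Ef -Eg Efg.
Qed.

End PlanarSwap.

(** * Chains along arcs and the absence of K_5 minors *)

Section Chains.
Variables (R : realType) (h : R).
Hypothesis h0 : 0 < h.
Implicit Types (Y : set (R * R)) (p q r : R * R).

Inductive chain Y : R * R -> R * R -> Prop :=
| Chain0 p : Y p -> chain Y p p
| ChainS p q r : Y p -> nearby h p q -> chain Y q r -> chain Y p r.

Lemma chain_in Y p q : chain Y p q -> Y p /\ Y q.
Proof. by elim=> // ? ? ? ? ? _ [_ ?]. Qed.

Lemma chain_trans Y p q r : chain Y p q -> chain Y q r -> chain Y p r.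
Proof. by elim=> // {}p {}q r' Yp n _ IH /IH; apply: ChainS. Qed.

Lemma chain_sym Y p q : chain Y p q -> chain Y q p.
Proof.
elim=> [{}p Yp|{}p {}q r Yp n c IH]; first exact: Chain0.
have [Yq _] := chain_in c; apply: chain_trans IH _.
by apply: ChainS Yq _ (Chain0 Yp); rewrite nearby_sym.
Qed.

Lemma chainS Y Y' p q : Y `<=` Y' -> chain Y p q -> chain Y' p q.
Proof.
move=> sY; elim=> [{}p Yp|{}p {}q r Yp n c IH]; first by apply: Chain0; apply: sY.
exact: ChainS (sY _ Yp) n IH.
Qed.

Lemma chain_seq Y p q : chain Y p q -> exists s,
  [/\ path (nearby h) p s, last p s = q & forall x, x \in p :: s -> Y x].
Proof.
elim=> [{}p Yp|{}p {}q r Yp n c [s [ps ls H]]].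
  by exists [::]; split=> // x; rewrite inE => /eqP ->.
exists (q :: s); split; rewrite /= ?n //.
by move=> x; rewrite inE => /predU1P [->|/H].
Qed.

Lemma nearby_continuous (g : R -> R * R) (t : R) : continuous g ->
  exists2 e : R, 0 < e & forall s, `|t - s| < e -> nearby h (g t) (g s).
Proof.
move=> cg.
have c1 : {for t, continuous (fun s => (g s).1)} by apply: continuous_fst_at; exact: cg.
have c2 : {for t, continuous (fun s => (g s).2)} by apply: continuous_snd_at; exact: cg.
have /cvgr_dist_lt /(_ _ h0) /nbhs_ballP [e1 /= e10 H1] := c1.
have /cvgr_dist_lt /(_ _ h0) /nbhs_ballP [e2 /= e20 H2] := c2.
exists (Num.min e1 e2); first by rewrite lt_min e10.
move=> s; rewrite lt_min => /andP [k1 k2].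
by rewrite /nearby (ltW (H1 s k1)) (ltW (H2 s k2)).
Qed.

(* The set of parameters reachable by a chain from g 0 is open and closed. *)
Lemma chain_curve (g : R -> R * R) : continuous g ->
  chain [set g t | t in `[0, 1]] (g 0) (g 1).
Proof.
move=> cg; set Y := [set _ | _ in _].
have inY t : 0 <= t <= 1 -> Y (g t) by move=> t01; exists t; rewrite //= in_itv.
pose A := [set t | 0 <= t <= 1 /\ chain Y (g 0) (g t)].
have A0 : A 0 by split; [rewrite lexx ler01|apply: Chain0; apply: inY; rewrite lexx ler01].
have supA : has_sup A.
  by split; [exists 0|exists 1 => t [/andP []]].
set T := sup A.
have T0 : 0 <= T by apply: sup_upper_bound.
have T1 : T <= 1 by apply: sup_le_ub; [exists 0|move=> t [/andP []]].
have [e e0 He] := nearby_continuous T cg.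
have [s As sT] := sup_adherent e0 supA.
have sT' : s <= T by apply: sup_upper_bound.
have [s01 cs] := As.
have cT : chain Y (g 0) (g T).
  apply: chain_trans cs _; apply: ChainS (inY _ s01) _ _; last first.
    by apply: Chain0; apply: inY; rewrite T0.
  by rewrite nearby_sym; apply: He; rewrite ger0_norm; rewrite -/T in sT; lra.
have [lt|ge] := ltP T 1; last by have -> : 1 = T by apply/eqP; rewrite eq_le T1 ge.
pose T' := Num.min 1 (T + e / 2).
have T'T : T < T' by rewrite lt_min lt; lra.
have : A T'.
  have T'1 : 0 <= T' <= 1 by rewrite (le_trans T0 (ltW T'T)) ge_min lexx.
  split=> //; apply: chain_trans cT _; apply: ChainS (Chain0 (inY _ T'1)).
    by apply: inY; rewrite T0.
  apply: He; rewrite ltr0_norm; last by lra.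
  have : T' <= T + e / 2 by rewrite ge_min lexx orbT.
  by lra.
by move=> /(sup_upper_bound supA); rewrite -/T leNgt T'T.
Qed.

End Chains.

Section NoK5.
Variables (R : realType) (V : finType) (G : {set {set V}}).
Hypothesis sG : simple_graph G.
Variables (pos : V -> R * R) (arc : {set V} -> R -> R * R).
Hypothesis D : drw G pos arc.

(** The arcs of two disjoint edges are disjoint compact sets, hence at positive distance, and there
    are finitely many pairs of edges. *)
Lemma arcs_far : exists2 d : R, 0 < d & forall e f s t, e \in G -> f \in G ->
  fintype.disjoint (mem e) (mem f) -> 0 <= s <= 1 -> 0 <= t <= 1 ->
  far d (arc e s) (arc f t).
Proof.
have [d d0 H] : exists2 d : R, 0 < d & forall ef : {set V} * {set V},
    ef.1 \in G -> ef.2 \in G -> fintype.disjoint (mem ef.1) (mem ef.2) ->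
    forall s t, 0 <= s <= 1 -> 0 <= t <= 1 -> far d (arc ef.1 s) (arc ef.2 t).
  apply: fin_pos => [[e f] r r' le H eG fG dis s t s01 t01|[e f] /=].
    have := H eG fG dis s t s01 t01; rewrite /far.
    by case/orP => k; rewrite (le_trans le k) ?orbT.
  have [eG|n] := boolP (e \in G); last by exists 1.
  have [fG|n] := boolP (f \in G); last by exists 1.
  have [dis|n] := boolP (fintype.disjoint (mem e) (mem f)); last by exists 1.
  pose F (z : R * R) := `|(arc e z.1).1 - (arc f z.2).1| + `|(arc e z.1).2 - (arc f z.2).2|.
  have cF : continuous F.
    move=> z.
    have ce : {for z, continuous (fun y : R * R => arc e y.1)}.
      by apply: (@continuous_comp _ _ _ fst (arc e)); [exact: cvg_fst|exact: drw_cont D _ eG _].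
    have cf : {for z, continuous (fun y : R * R => arc f y.2)}.
      by apply: (@continuous_comp _ _ _ snd (arc f)); [exact: cvg_snd|exact: drw_cont D _ fG _].
    by apply: cvgD; apply: cvg_norm; apply: cvgB;
      [exact: (continuous_fst_at ce)|exact: (continuous_fst_at cf)
      |exact: (continuous_snd_at ce)|exact: (continuous_snd_at cf)].
  have [c cA Hc] : exists2 c, c \in (`[0, 1] `*` `[0, 1])%classic &
      forall z, z \in (`[0, 1] `*` `[0, 1])%classic -> F c <= F z.
    apply: compact_EVT_min; last exact: continuous_subspaceT.
      by exists (0, 0); split; rewrite /= in_itv /= lexx ler01.
    by apply: compact_setX; apply: segment_compact.
  move: cA; rewrite inE /= => -[]; rewrite /= !in_itv /= => c1 c2.
  have Fc : 0 < F c.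
    rewrite lt_neqAle addr_ge0 // andbT eq_sym; apply/eqP => /eqP.
    rewrite paddr_eq0 // !normr_eq0 !subr_eq0 => /andP [/eqP E1 /eqP E2].
    have E : arc e c.1 = arc f c.2.
      by rewrite [LHS]surjective_pairing [RHS]surjective_pairing E1 E2.
    have nvf v w : v \in e -> w \in f -> v != w.
      by move=> ve wf; apply: contraTneq wf => <-; rewrite (disjointFr dis ve).
    case: (drw_pt D eG c1) => [[v ve Ev]|c1'].
      case: (drw_pt D fG c2) => [[w wf Ew]|c2'].
        have : pos v = pos w by rewrite -Ev -Ew.
        by move/(drw_pos D) => vw; have := nvf _ _ ve wf; rewrite vw eqxx.
      by apply: (drw_int D fG c2' (v := v)); rewrite -E.
    case: (drw_pt D fG c2) => [[w wf Ew]|c2'].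
      by apply: (drw_int D eG c1' (v := w)); rewrite E.
    apply: (drw_sep D eG fG _ c1' c2' E); apply/eqP => ef.
    have [x [y [_ Ee _]]] := simple_edgeP sG eG.
    have xe : x \in e by rewrite Ee set21.
    by have := nvf x x xe; rewrite -ef xe eqxx => /(_ isT).
  exists (F c / 2); first by lra.
  move=> _ _ _ s t s01 t01; rewrite /far.
  have : F c <= F (s, t) by apply: Hc; rewrite inE; split; rewrite /= in_itv.
  by rewrite {2}/F /=; case: leP => //= k1 k2; lra.
by exists d => // e f s t eG fG dis; apply: (H (e, f)).
Qed.

Definition arcs_in (B : {set V}) : set (R * R) :=
  [set z | exists e t, [/\ e \in G, e \subset B, 0 <= t <= 1 & z = arc e t]].

Lemma chain_step h (B : {set V}) x y : 0 < h -> x \in B -> y \in B -> adj G x y ->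
  chain h (arcs_in B) (pos x) (pos y).
Proof.
move=> h0 xB yB a; have [x' [y' [E e0 e1]]] := drw_end D a.
have c : chain h (arcs_in B) (pos x') (pos y').
  rewrite -e0 -e1; have := chain_curve h0 (drw_cont D a); apply: chainS.
  move=> z [t /=]; rewrite in_itv /= => t01 <-.
  exists [set x; y]%SET, t; split=> //.
  by rewrite finset.subUset !finset.sub1set xB.
by case: (set2_eqP E) => [[-> ->]|[-> ->]] //; apply: chain_sym.
Qed.

(** A vertex without an edge inside [B] lies on no arc of [arcs_in B]; the condition [x != y] forces
    the path to use an edge. *)
Lemma chain_connect h (B : {set V}) x y : 0 < h -> x != y ->
  connect (rin (adj G) B) x y -> chain h (arcs_in B) (pos x) (pos y).
Proof.
move=> h0 xy /connectP [p].
elim: p x xy => [|z p IH] x xy /= => [_ E|]; first by rewrite E eqxx in xy.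
case/andP=> /and3P [xB zB a] pp E.
have [zy|zy] := eqVneq z y; first by rewrite -zy; apply: chain_step.
exact: chain_trans (chain_step h0 xB zB a) (IH _ zy pp E).
Qed.

(** Choose a root [c i] in each branch set and a chain [A (i, j)] between two roots along arcs
    inside the union of their branch sets. For four distinct indices the chains of i, j and of k, l
    follow disjoint edges and so stay far apart; [winding_grid] then yields the equations that
    [k5_parity] refutes. *)
Lemma drw_no_k5 S : ~ kminor 5 (adj G) S.
Proof.
move=> [B [_ B0 Bdis Bconn Badj]].
have [d d0 Hd] := arcs_far.
pose h := d / 8; have h0 : 0 < h by rewrite divr_gt0.
have [c cB] := fin_all_exists B0.
have hd : 4 * h < d by rewrite /h; lra.
have cc i j : i != j -> c i != c j.
  move=> ij; apply: contraTneq (cB j) => <-.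
  by rewrite (disjointFr (Bdis i j ij)).
have conn i j : i != j -> connect (rin (adj G) (B i :|: B j)%SET) (c i) (c j).
  move=> ij; have [x [y [xB yB a]]] := Badj i j ij.
  have h1 := rin_sub (finset.subsetUl (B i) (B j)) (Bconn i _ _ (cB i) xB).
  have h2 := rin_sub (finset.subsetUr (B i) (B j)) (Bconn j _ _ yB (cB j)).
  apply: connect_trans h1 (connect_trans (connect1 _) h2).
  by rewrite rinE !finset.in_setU xB yB orbT.
have ex ij : exists s, ij.1 != ij.2 -> [/\ path (nearby h) (pos (c ij.1)) s,
    last (pos (c ij.1)) s = pos (c ij.2)
    & forall x, x \in pos (c ij.1) :: s -> arcs_in (B ij.1 :|: B ij.2)%SET x].
  have [E|ne] := eqVneq ij.1 ij.2; first by exists [::].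
  have := chain_connect h0 (cc _ _ ne) (conn _ _ ne).
  by move/chain_seq => [s Hs]; exists s.
have [A HA] := @fin_all_exists ('I_5 * 'I_5)%type (fun=> seq (R * R)) _ ex.
pose P i := pos (c i).
have farA i j k l : uniq [:: i; j; k; l] ->
    forall x y, x \in P i :: A (i, j) -> y \in P k :: A (k, l) -> far d x y.
  rewrite /= !inE !negb_or => /and4P [/and3P [ij ik il] /andP [jk jl] kl _] x y.
  have [_ _ H1] := HA (i, j) ij; have [_ _ H2] := HA (k, l) kl.
  move=> /H1 [e [s [eG eB s01 ->]]] /H2 [f [t [fG fB t01 ->]]].
  apply: Hd => //; rewrite disjoint_subset; apply/fintype.subsetP => z ze.
  rewrite inE; apply/negP => zf.
  have := fintype.subsetP eB _ ze; have := fintype.subsetP fB _ zf.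
  rewrite !finset.in_setU => /orP [zk|zl] /orP [zi|zj].
  - by have := disjointFr (Bdis _ _ ik) zi; rewrite zk.
  - by have := disjointFr (Bdis _ _ jk) zj; rewrite zk.
  - by have := disjointFr (Bdis _ _ il) zi; rewrite zl.
  - by have := disjointFr (Bdis _ _ jl) zj; rewrite zl.
have lastA i j : i != j -> last (P i) (A (i, j)) = P j.
  by move=> ij; have [_ ->] := HA (i, j) ij.
have pathA i j : i != j -> path (nearby h) (P i) (A (i, j)).
  by move=> ij; have [] := HA (i, j) ij.
pose w (i j k : nat) := winding (P (inord k)) (P (inord i)) (A (inord i, inord j)).
pose s (i j : nat) := upper (P (inord i) - P (inord j)).
have inj i j : (i < 5)%N -> (j < 5)%N -> (inord i == inord j :> 'I_5) = (i == j).
  by move=> i5 j5; rewrite -val_eqE /= !inordK.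
apply: (@k5_parity w s) => [i j k l u ij kl i5 j5 k5 l5|i j ij j5].
- have u' : uniq [:: inord i; inord j; inord k; inord l : 'I_5].
    by move: u; rewrite /= !inE !inj.
  have u2 : uniq [:: inord k; inord l; inord i; inord j : 'I_5].
    by rewrite -(rot_uniq 2).
  have nij : (inord i : 'I_5) != inord j by rewrite inj // ltn_eqF.
  have nkl : (inord k : 'I_5) != inord l by rewrite inj // ltn_eqF.
  have F := farA _ _ _ _ u'.
  have := @winding_grid R h d (ltW h0) hd (P (inord k)) (A (inord k, inord l))
    (P (inord i)) (A (inord i, inord j)) (pathA _ _ nkl) (pathA _ _ nij).
  have F' c' : c' \in P (inord k) :: A (inord k, inord l) ->
      all (far d c') (P (inord i) :: A (inord i, inord j)).
    by move=> ic; apply/allP => x xi; rewrite far_sym; apply: F.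
  move=> /(_ F'); rewrite !lastA //.
  have ini : P (inord i) \in P (inord i) :: A (inord i, inord j) by rewrite mem_head.
  have inj' : P (inord j) \in P (inord i) :: A (inord i, inord j).
    by rewrite -(lastA _ _ nij) mem_last.
  have G1 p : p \in P (inord i) :: A (inord i, inord j) ->
      all (far d p) (P (inord k) :: A (inord k, inord l)).
    by move=> pi; apply/allP => x xi; apply: F.
  rewrite !(co_windingE (ltW h0) hd (pathA _ _ nkl)) ?G1 // !lastA //.
  rewrite -/(w i j k) -/(w i j l) -/(w k l i) -/(w k l j).
  rewrite -/(s k i) -/(s l i) -/(s k j) -/(s l j).
  by move: (w _ _ _) (w _ _ _) (w _ _ _) (w _ _ _) (s _ _) (s _ _) (s _ _) (s _ _)
    => [] [] [] [] [] [] [] [].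
- have i5 : (i < 5)%N by apply: ltn_trans ij j5.
  rewrite /s -opprB upperN // subr_eq0; apply/eqP => /(drw_pos D).
  apply/eqP; apply: cc; rewrite inj // ltn_eqF //.
Qed.

End NoK5.

Lemma planar_no_k5 (R : realType) (V : finType) (G : {set {set V}}) S :
  simple_graph G -> planar R G -> ~ kminor 5 (adj G) S.
Proof. by move=> sG /planar_drw [pos [arc D]]; apply: drw_no_k5 sG _ _ D S. Qed.

End Drawings.
Import Drawings.

(** * Relabelling and straight-line drawings *)

Module Straight.
Import ZArith.
Import all_boot all_order all_algebra all_classical all_reals all_analysis zify ssrZ ring lra.
Import Order.TTheory GRing.Theory Num.Theory.
Import numFieldNormedType.Exports.
Local Open Scope classical_set_scope.
Local Open Scope ring_scope.

Lemma fin_bound (R : realType) (I : finType) (P : I -> R -> Prop) :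
  (forall i r s, r <= s -> P i r -> P i s) ->
  (forall i, exists r, P i r) -> exists r, forall i, P i r.
Proof.
move=> up H; have [r Hr] := @fin_all_exists I (fun=> R) P H.
exists (\big[Num.max/0]_i r i) => i; apply: up (Hr i).
exact: le_bigmax.
Qed.

Section PlanarMap.
Variables (R : realType) (V W : finType) (f : V -> W).
Hypothesis finj : injective f.
Variable G : {set {set V}}.

Lemma planar_gmap_inv : planar R (gmap f G) -> planar R G.
Proof.
move=> /planar_drw [pos [arc D]]; apply/planar_drw.
have inG e : e \in G -> (f @: e)%SET \in gmap f G by rewrite mem_gmap.
exists (pos \o f), (fun e : {set V} => arc (f @: e)%SET); split.
- by apply: inj_comp finj; apply: drw_pos D.
- by move=> e /inG; apply: drw_cont D _.
- by move=> e s t /inG; apply: drw_inj D _ _ _.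
- move=> e eG; have [a [b [E e0 e1]]] := drw_end D (inG _ eG).
  have : a \in (f @: e)%SET by rewrite E set21.
  case/imsetP=> x xe Ea; have : b \in (f @: e)%SET by rewrite E set22.
  case/imsetP=> y ye Eb; exists x, y; rewrite /= -Ea -Eb; split=> //.
  by apply: (imset_inj finj); rewrite imset_set2 E Ea Eb.
- by move=> e t v /inG eG t01; apply: (drw_int D eG t01).
- move=> e g s t /[dup] eG0 /inG eG /[dup] gG0 /inG gG ne s01 t01.
  apply: (drw_sep D eG gG _ s01 t01).
  by apply: contraNneq ne => /(imset_inj finj) ->.
Qed.

Lemma drw_bounded pos arc : @drw R V G pos arc -> exists M : R,
  (forall v, (pos v).1 < M) /\
  (forall e t, e \in G -> 0 <= t <= 1 -> (arc e t).1 < M).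
Proof.
move=> D.
have [M1 H1] : exists M : R, forall v, (pos v).1 < M.
  apply: fin_bound => [i r s rs ir|v]; first exact: lt_le_trans rs.
  by exists ((pos v).1 + 1); rewrite ltrDl.
have [M2 H2] : exists M : R,
    forall e, e \in G -> forall t, 0 <= t <= 1 -> (arc e t).1 < M.
  apply: fin_bound => [e r s rs ir eG t t01|e].
    exact: lt_le_trans (ir eG t t01) rs.
  have [eG|n] := boolP (e \in G); last by exists 0.
  have [c _ Hc] : exists2 c, c \in `[0, 1]%R & forall t, t \in `[0, 1]%R ->
      (arc e t).1 <= (arc e c).1.
    apply: (@EVT_max R (fun t => (arc e t).1) 0 1) => //.
    apply: continuous_subspaceT => t; apply: continuous_fst_at.
    exact: drw_cont D _ eG _.
  exists ((arc e c).1 + 1) => _ t t01.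
  by apply: le_lt_trans (Hc t _) _; rewrite ?in_itv ?ltrDl.
exists (Num.max M1 M2); split=> [v|e t eG t01]; rewrite lt_max ?H1 //.
by rewrite (H2 e) ?orbT.
Qed.

(** The drawing is bounded, so the vertices outside the image of [f] fit on a horizontal line to the
    right of it. *)
Lemma planar_gmap : planar R G -> planar R (gmap f G).
Proof.
move=> /planar_drw [pos [arc D]]; apply/planar_drw.
have [M [Mpos Marc]] := drw_bounded D.
pose far (w : W) : R * R := (M + (enum_rank w)%:R, 0).
have farM w : M <= (far w).1 by rewrite lerDl.
pose pos' w := if [pick v | f v == w] is Some v then pos v else far w.
have posE v : pos' (f v) = pos v.
  rewrite /pos'; case: pickP => [v' /eqP /finj -> //|/(_ v)].
  by rewrite eqxx.
have posP w : (exists2 v, w = f v & pos' w = pos v) \/ pos' w = far w.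
  rewrite /pos'; case: pickP => [v /eqP <-|_]; last by right.
  by left; exists v.
pose arc' (e : {set W}) := arc (f @^-1: e)%SET.
have arcE (e : {set V}) : arc' (f @: e)%SET = arc e.
  by congr arc; apply/setP => x; rewrite /preimset finset.in_set /= finset.mem_imset.
have inG e : e \in gmap f G -> exists2 e' : {set V}, e' \in G & e = (f @: e')%SET.
  by case/imsetP=> e'; exists e'.
exists pos', arc'; split.
- move=> a b; case: (posP a) => [[x -> ->]|->]; case: (posP b) => [[y -> ->]|->].
  + by move/(drw_pos D) ->.
  + by move=> E; have := farM b; rewrite -E leNgt Mpos.
  + by move=> E; have := farM a; rewrite E leNgt Mpos.
  + case=> /addrI /eqP; rewrite eqr_nat => /eqP h.
    by apply: enum_rank_inj; apply: ord_inj.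
- by move=> e /inG [e' eG ->]; rewrite arcE; apply: drw_cont D _ eG.
- by move=> e s t /inG [e' eG ->]; rewrite arcE; apply: drw_inj D _ _ _ eG.
- move=> e /inG [e' eG ->]; have [x [y [E e0 e1]]] := drw_end D eG.
  by exists (f x), (f y); rewrite arcE !posE e0 e1 E imset_set2.
- move=> e t w /inG [e' eG ->] t01; rewrite arcE.
  case: (posP w) => [[x _ ->]|->]; first exact: (drw_int D eG t01).
  move=> E; have := farM w; rewrite -E leNgt Marc //.
  by case/andP: t01 => /ltW -> /ltW ->.
- move=> e g s t /inG [e' eG ->] /inG [g' gG ->] ne s01 t01; rewrite !arcE.
  apply: (drw_sep D eG gG _ s01 t01).
  by apply: contraNneq ne => ->.
Qed.

End PlanarMap.

(** Twice the signed area of the triangle [a], [b], [c]; over a general ring, so that it can be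
    computed in [Z] and used in the reals. *)
Definition orient (T : pzRingType) (a b c : T * T) : T :=
  (b.1 - a.1) * (c.2 - a.2) - (b.2 - a.2) * (c.1 - a.1).

Section Straight.
Variables (R : realType) (V : finType) (G : {set {set V}}).
Variable pos : V -> R * R.
Hypothesis sG : simple_graph G.
Hypothesis pinj : injective pos.
Hypothesis offline : forall x y z, adj G x y -> z != x -> z != y ->
  orient (pos x) (pos y) (pos z) != 0.
Hypothesis apart : forall x y z w, adj G x y -> adj G z w ->
  z != x -> z != y -> w != x -> w != y ->
  0 < orient (pos x) (pos y) (pos z) * orient (pos x) (pos y) (pos w) \/
  0 < orient (pos z) (pos w) (pos x) * orient (pos z) (pos w) (pos y).

Let seg (p q : R * R) (t : R) : R * R :=
  (p.1 + t * (q.1 - p.1), p.2 + t * (q.2 - p.2)).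

Let orient_seg (a b p q : R * R) t :
  orient a b (seg p q t) = (1 - t) * orient a b p + t * orient a b q.
Proof. rewrite /orient /seg /=; ring. Qed.

Let orient1 (a b : R * R) : orient a b a = 0.
Proof. rewrite /orient; ring. Qed.

Let orient2 (a b : R * R) : orient a b b = 0.
Proof. rewrite /orient; ring. Qed.

Let orient_on (a b : R * R) t : orient a b (seg a b t) = 0.
Proof. by rewrite orient_seg orient1 orient2 !mulr0 addr0. Qed.

Let conv_neq0 (a b t : R) : 0 < t < 1 -> 0 < a * b -> (1 - t) * a + t * b != 0.
Proof.
move=> /andP [t0 t1] ab; apply/eqP => E.
have t1' : 0 < 1 - t by lra.
have h1 : 0 < (1 - t) * (a * b) by rewrite mulr_gt0.
have h2 : 0 <= t * b ^+ 2 by rewrite mulr_ge0 ?sqr_ge0 // ltW.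
have : ((1 - t) * a + t * b) * b = (1 - t) * (a * b) + t * b ^+ 2 by ring.
by rewrite E mul0r; lra.
Qed.

(** At a common inner point of two segments the orientation with respect to either one vanishes. For
    disjoint edges it is, on one of the segments, an interpolation of two values of the same sign;
    for edges with a common end it is a nonzero multiple of a value excluded by [offline]. *)
Lemma planar_straight : planar R G.
Proof.
apply/planar_drw.
pose ends (e : {set V}) := [pick p : V * V | (e == [set p.1; p.2]%SET) && adj G p.1 p.2].
pose arc e t := if ends e is Some p then seg (pos p.1) (pos p.2) t else (0, 0).
have arcP e : e \in G -> exists x y, [/\ e = [set x; y]%SET, x != y, adj G x y &
    arc e = seg (pos x) (pos y)].
  move=> eG; rewrite /arc /ends; case: pickP => [[x y] /andP [/eqP E a]|].
    by exists x, y; rewrite (simple_neq sG a).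
  have [x [y [xy -> a]]] := simple_edgeP sG eG.
  by move/(_ (x, y)); rewrite /= eqxx a.
have offl x y v t : adj G x y -> 0 < t < 1 -> seg (pos x) (pos y) t <> pos v.
  move=> a t01 E; have [Ex|nx] := eqVneq v x; last first.
    have [Ey|ny] := eqVneq v y; last first.
      by have := offline a nx ny; rewrite -E orient_on eqxx.
    suff : pos x = pos y.
      by move/pinj => xy; have := simple_neq sG a; rewrite xy eqxx.
    move: (congr1 fst E) (congr1 snd E); rewrite Ey /seg /= => E1 E2.
    rewrite [LHS]surjective_pairing [RHS]surjective_pairing.
    have t1 : 1 - t != 0 by lra.
    by congr (_, _); apply: (mulfI t1); lra.
  suff : pos y = pos x.
    by move/pinj => xy; have := simple_neq sG a; rewrite xy eqxx.
  move: (congr1 fst E) (congr1 snd E); rewrite Ex /seg /= => E1 E2.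
  rewrite [LHS]surjective_pairing [RHS]surjective_pairing.
  have t1 : t != 0 by lra.
  by congr (_, _); apply: (mulfI t1); lra.
exists pos, arc; split=> //.
- move=> e /arcP [x [y [_ _ _ ->]]] t.
  have ca (a b : R) : {for t, continuous (fun t : R => a + t * b)}.
    by apply: cvgD (cvg_cst _) _; apply: cvgM (cvg_cst _); apply: cvg_id.
  exact: continuous_pair (ca (pos x).1 ((pos y).1 - (pos x).1))
    (ca (pos x).2 ((pos y).2 - (pos x).2)).
- move=> e s t /arcP [x [y [_ xy _ ->]]] s01 t01 [/addrI E1 /addrI E2].
  have [E|n1] := eqVneq ((pos y).1 - (pos x).1) 0; last exact: (mulIf n1).
  have [E'|n2] := eqVneq ((pos y).2 - (pos x).2) 0; last exact: (mulIf n2).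
  have : pos x = pos y.
    rewrite [LHS]surjective_pairing [RHS]surjective_pairing.
    by congr (_, _); lra.
  by move/pinj => Exy; rewrite Exy eqxx in xy.
- move=> e /arcP [x [y [-> _ _ ->]]]; exists x, y; split=> //.
    by rewrite /seg !mul0r !addr0 -surjective_pairing.
  by rewrite /seg !mul1r !subrKC -surjective_pairing.
- by move=> e t v /arcP [x [y [_ _ a ->]]] t01; apply: offl.
- move=> e g s t /arcP [x [y [Ee xy a ->]]] /arcP [z [w [Eg zw a' ->]]] ne s01 t01 E.
  have o1 : (1 - t) * orient (pos x) (pos y) (pos z) +
      t * orient (pos x) (pos y) (pos w) = 0.
    by rewrite -orient_seg -E orient_on.
  have o2 : (1 - s) * orient (pos z) (pos w) (pos x) +
      s * orient (pos z) (pos w) (pos y) = 0.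
    by rewrite -orient_seg E orient_on.
  have t0 : t != 0 by case/andP: t01 => /lt0r_neq0.
  have t1 : 1 - t != 0 by rewrite subr_eq0 gt_eqF //; case/andP: t01.
  have [zx|zx] := eqVneq z x.
    have wy : w != y by apply: contraNneq ne => wy; rewrite Ee Eg zx wy.
    have wx : w != x by rewrite -zx eq_sym.
    move/eqP: o1; rewrite zx orient1 mulr0 add0r mulf_eq0 (negbTE t0) /=.
    by apply/negP; apply: offline.
  have [zy|zy] := eqVneq z y.
    have wx : w != x by apply: contraNneq ne => wx; rewrite Ee Eg zy wx finset.setUC.
    have wy : w != y by rewrite -zy eq_sym.
    move/eqP: o1; rewrite zy orient2 mulr0 add0r mulf_eq0 (negbTE t0) /=.
    by apply/negP; apply: offline.
  have [wx|wx] := eqVneq w x.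
    move/eqP: o1; rewrite wx orient1 mulr0 addr0 mulf_eq0 (negbTE t1) /=.
    by apply/negP; apply: offline.
  have [wy|wy] := eqVneq w y.
    move/eqP: o1; rewrite wy orient2 mulr0 addr0 mulf_eq0 (negbTE t1) /=.
    by apply/negP; apply: offline.
  case: (apart a a' zx zy wx wy) => h.
    by have := conv_neq0 t01 h; rewrite o1 eqxx.
  by have := conv_neq0 s01 h; rewrite o2 eqxx.
Qed.

End Straight.

Section Star.
Variables (R : realType) (V : finType) (x : V).

Definition star (L : {set V}) : {set {set V}} := [set [set x; l] | l in L]%SET.

Lemma adj_star (L : {set V}) a b : x \notin L ->
  adj (star L) a b = (a == x) && (b \in L) || (b == x) && (a \in L).
Proof.
move=> xL; apply/imsetP/orP => [[l lL /set2_eqP [[-> ->]|[-> ->]]]|].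
- by left; rewrite eqxx.
- by right; rewrite eqxx.
- by case=> /andP [/eqP -> h]; [exists b|exists a; rewrite // finset.setUC].
Qed.

Lemma simple_star (L : {set V}) : x \notin L -> simple_graph (star L).
Proof.
move=> xL; apply/forall_inP => e /imsetP [l lL ->]; rewrite cards2.
by have [E|//] := eqVneq x l; rewrite E lL in xL.
Qed.

(** The centre is at the origin and all other vertices lie on the line x = 1 at different heights;
    any two edges share the centre. *)
Lemma planar_star (L : {set V}) : x \notin L -> planar R (star L).
Proof.
move=> xL; pose rk (v : V) : R := (enum_rank v)%:R.
have rkinj : injective rk.
  by move=> a b /eqP; rewrite eqr_nat => /eqP h; apply: enum_rank_inj; apply: ord_inj.
pose pos v : R * R := if v == x then (0, 0) else (1, rk v).
apply: (@planar_straight _ _ _ pos (simple_star xL)).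
- move=> a b; rewrite /pos; case: eqVneq => [->|na]; case: eqVneq => [->|nb] //.
  + by case=> /eqP; rewrite eq_sym oner_eq0.
  + by case=> /eqP; rewrite oner_eq0.
  + by case=> /rkinj.
- have key l z : l != x -> z != x -> z != l -> rk z - rk l != 0.
    by move=> lx zx zl; rewrite subr_eq0; apply: contraNneq zl => /rkinj ->.
  have neL l : l \in L -> l != x by move=> lL; apply: contraNneq xL => <-.
  move=> a b z; rewrite adj_star // => /orP [/andP [/eqP -> bL]|/andP [/eqP -> aL]] nz nz'.
    rewrite /orient /pos eqxx (negbTE (neL _ bL)) (negbTE nz) /=.
    rewrite !subr0 mul1r mulr1; apply: key => //; exact: neL.
  rewrite /orient /pos eqxx (negbTE (neL _ aL)) (negbTE nz') /= subrr mulr0 subr0.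
  by rewrite sub0r mulN1r oppr_eq0; apply: key => //; apply: neL.
- move=> a b z w; rewrite !adj_star // => /orP [/andP [/eqP -> _]|/andP [/eqP -> _]];
  by move=> /orP [/andP [/eqP -> _]|/andP [/eqP -> _]]; rewrite eqxx.
Qed.

End Star.

End Straight.
Import Straight.

(** * Explicit planar graphs *)

Module ListGraphs.
Import ZArith.
Import all_boot all_order all_algebra all_classical all_reals all_analysis zify ssrZ ring lra.
Import Order.TTheory GRing.Theory Num.Theory.

Definition adjl (l : seq (nat * nat)) (a b : nat) : bool :=
  ((a, b) \in l) || ((b, a) \in l).

Definition list_graph (s : nat) (l : seq (nat * nat)) : {set {set 'I_s}} :=
  [set [set p.1; p.2] | p : 'I_s * 'I_s & adjl l p.1 p.2]%SET.

Section ListGraph.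
Variables (s : nat) (l : seq (nat * nat)).
Hypothesis irr : all (fun p => p.1 != p.2) l.

Lemma adj_list_graph (a b : 'I_s) : adj (list_graph s l) a b = adjl l a b.
Proof.
apply/imsetP/idP => [[[c d]]|h]; last by exists (a, b); rewrite ?inE.
rewrite inE /= => h /set2_eqP [[-> ->]|[-> ->]] //.
by rewrite /adjl orbC.
Qed.

Lemma simple_list_graph : simple_graph (list_graph s l).
Proof.
apply/forall_inP => e /imsetP [[a b]]; rewrite inE /= => h ->; rewrite cards2.
have [E|//] := eqVneq a b; move: h; rewrite /adjl E orbb.
by move/(allP irr); rewrite /= eqxx.
Qed.

Lemma degree_list_graph (a : 'I_s) :
  degree (list_graph s l) a = count (adjl l a) (iota 0 s).
Proof.
rewrite degree_nbr; last exact: simple_list_graph.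
rewrite -sum1_card -sum1_count -[s in iota 0 s]subn0 -/(index_iota 0 s) big_mkord.
by apply: eq_bigl => b; rewrite inE adj_list_graph.
Qed.

Definition degree_check (p : pred nat) : bool :=
  all (fun i => p (count (adjl l i) (iota 0 s))) (iota 0 s).

Lemma degree_checkP (p : pred nat) : degree_check p ->
  forall a : 'I_s, p (degree (list_graph s l) a).
Proof.
by move=> /allP H a; rewrite degree_list_graph; apply: H; rewrite mem_iota /=.
Qed.

(* Every vertex but the first has an earlier neighbour along an edge not in rm. *)
Definition order_check (rm : seq (nat * nat)) : bool :=
  all (fun i => has (fun j => adjl l j i && ~~ adjl rm j i) (iota 0 i))
    (iota 1 s.-1).

Lemma order_checkP rm (G : {set {set 'I_s}}) : order_check rm ->
  (forall a b : 'I_s, adjl l a b -> ~~ adjl rm a b -> adj G a b) ->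
  conn G [set: 'I_s].
Proof.
move=> /allP H sub; have [s0|s0] := posnP s.
  by apply/forall_inP => -[m lt]; exfalso; rewrite s0 in lt.
apply: (@conn_root _ _ _ (Ordinal s0)) => x _.
have [k] := ubnP (val x); elim: k x => // k IH x xk.
have [E|x0] := posnP (val x).
  by have -> : x = Ordinal s0 by [apply: val_inj]; rewrite connect0.
have xin : val x \in iota 1 s.-1.
  by rewrite mem_iota x0 add1n prednK //; exact: ltn_ord.
have /hasP [j] := H _ xin.
rewrite mem_iota /= add0n => jx /andP [a na].
have jn : j < s by apply: ltn_trans jx (ltn_ord x).
have jk : j < k by apply: leq_trans jx _.
apply: connect_trans (IH (Ordinal jn) jk) (connect1 _).
exact: sub.
Qed.

(** Decides the hypotheses of [planar_straight] for integer coordinates; [l2] has every edge in both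
    directions because those hypotheses concern oriented edges. *)
Definition plane_check (cs : seq (Z * Z)) : bool :=
  let P i := nth (Z0, Z0) cs i in
  let l2 := l ++ [seq (p.2, p.1) | p <- l] in
  [&& all (fun i => all (fun j => (i == j) || (P i != P j)) (iota 0 s)) (iota 0 s),
    all (fun e => all (fun k => [|| k == e.1, k == e.2 |
      orient (P e.1) (P e.2) (P k) != Z0]) (iota 0 s)) l2 &
    all (fun e => all (fun f => [|| f.1 == e.1, f.1 == e.2, f.2 == e.1, f.2 == e.2,
      Z.ltb Z0 (orient (P e.1) (P e.2) (P f.1) * orient (P e.1) (P e.2) (P f.2))%R |
      Z.ltb Z0 (orient (P f.1) (P f.2) (P e.1) * orient (P f.1) (P f.2) (P e.2))%R])
      l2) l2].

Local Open Scope ring_scope.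

Lemma planar_list_graph (R : realType) cs : plane_check cs ->
  planar R (list_graph s l).
Proof.
set P := fun i => nth (Z0, Z0) cs i.
case/and3P=> H1 H2 H3.
(* [zr] is an injective ring morphism that preserves positivity, so signs computed in [Z] carry
   over. *)
pose zr (z : Z) : R := (int_of_Z z)%:~R.
have zrD x y : zr (x + y) = zr x + zr y by rewrite /zr rmorphD /= intrD.
have zrN x : zr (- x) = - zr x by rewrite /zr rmorphN /= mulrNz.
have zrM x y : zr (x * y) = zr x * zr y by rewrite /zr rmorphM /= intrM.
have zr_inj : injective zr.
  by move=> x y /intr_inj /(can_inj int_of_ZK).
have zr0 : zr Z0 = 0 by [].
have zr_gt0 (x : Z) : Z.ltb Z0 x -> 0 < zr x.
  rewrite /zr ltr0z => /Z.ltb_lt; case: x => //= p _.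
  by have := Pos2Nat.is_pos p; lia.
pose pos (i : 'I_s) : R * R := (zr (P i).1, zr (P i).2).
have oE (i j k : 'I_s) : orient (pos i) (pos j) (pos k) = zr (orient (P i) (P j) (P k)).
  by rewrite /orient !(zrD, zrN, zrM).
have in2 (a b : 'I_s) : adj (list_graph s l) a b ->
    (val a, val b) \in l ++ [seq (p.2, p.1) | p <- l].
  rewrite adj_list_graph mem_cat => /orP [->//|h].
  by apply/orP; right; apply/mapP; exists (val b, val a).
have inI (a : 'I_s) : val a \in iota 0 s by rewrite mem_iota /=.
apply: (@planar_straight _ _ _ pos simple_list_graph).
- move=> a b [/zr_inj e1 /zr_inj e2]; have := allP (allP H1 _ (inI a)) _ (inI b).
  case/orP => [/eqP h|/eqP []]; first exact: val_inj.
  by rewrite [LHS]surjective_pairing [RHS]surjective_pairing; congr (_, _).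
- move=> x y z /in2 /(allP H2) /allP /(_ _ (inI z)) /= /or3P [/eqP h|/eqP h|h].
  + by rewrite (val_inj h) eqxx.
  + by move=> _; rewrite (val_inj h) eqxx.
  + by move=> _ _; rewrite oE -zr0 (inj_eq zr_inj).
- move=> x y z w /in2 h1 /in2 h2 zx zy wx wy.
  have := allP (allP H3 _ h1) _ h2 => /=.
  case/or4P => [h|h|h|/or3P [h|/zr_gt0 h|/zr_gt0 h]].
  + by rewrite (_ : z == x) in zx.
  + by rewrite (_ : z == y) in zy.
  + by rewrite (_ : w == x) in wx.
  + by rewrite (_ : w == y) in wy.
  + by left; rewrite !oE -zrM.
  + by right; rewrite !oE -zrM.
Qed.

End ListGraph.

(** * Explicit edge lists and integer drawings *)

Definition k3_edges : seq (nat * nat) := [:: (0, 1); (0, 2); (1, 2)].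
Definition paw_edges : seq (nat * nat) := [:: (0, 1); (0, 2); (1, 2); (1, 3)].
Definition k4_edges : seq (nat * nat) := [:: (0, 1); (0, 2); (0, 3); (1, 2);
  (1, 3); (2, 3)].
Definition w4_edges : seq (nat * nat) := [:: (0, 1); (0, 2); (0, 3); (0, 4);
  (1, 2); (1, 4); (2, 3); (3, 4)].
Definition prism_edges : seq (nat * nat) := [:: (0, 1); (0, 2); (0, 3); (1,
  2); (1, 4); (2, 5); (3, 4); (3, 5); (4, 5)].
Definition octa_edges : seq (nat * nat) := [:: (0, 1); (0, 2); (0, 3); (0, 4);
  (1, 3); (1, 4); (1, 5); (2, 3); (2, 4); (2, 5); (3, 5); (4, 5)].
Definition ico_edges : seq (nat * nat) := [:: (0, 1); (0, 2); (0, 3); (0, 4);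
  (0, 5); (1, 2); (1, 5); (1, 6); (1, 7); (2, 3); (2, 7); (2, 8); (3, 4); (3,
  8); (3, 9); (4, 5); (4, 9); (4, 10); (5, 6); (5, 10); (6, 7); (6, 10); (6,
  11); (7, 8); (7, 11); (8, 9); (8, 11); (9, 10); (9, 11); (10, 11)].
(** A 4-regular graph of order 13. With the octahedron as joining gadget, 6 + 6 and 13 + 6 are
    coprime, so all large orders are reached. *)
Definition o13_edges : seq (nat * nat) := [:: (0, 1); (0, 2); (0, 3); (0, 4);
  (1, 3); (1, 5); (1, 6); (2, 3); (2, 5); (2, 6); (3, 6); (4, 5); (4, 7); (4,
  8); (5, 6); (7, 9); (7, 10); (7, 11); (8, 9); (8, 10); (8, 12); (9, 11); (9,
  12); (10, 11); (10, 12); (11, 12)].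
(** A 5-regular graph of order 26. With the icosahedron, 12 + 12 and 26 + 12 have greatest common
    divisor 2, as they must: a 5-regular graph has even order. *)
Definition r26_edges : seq (nat * nat) := [:: (0, 1); (0, 2); (0, 3); (0, 4);
  (0, 5); (1, 2); (1, 6); (1, 7); (1, 8); (2, 3); (2, 8); (2, 9); (3, 9); (3,
  10); (3, 11); (4, 5); (4, 10); (4, 12); (4, 13); (5, 6); (5, 12); (5, 14);
  (6, 7); (6, 10); (6, 15); (7, 8); (7, 15); (7, 16); (8, 9); (8, 16); (9,
  11); (9, 16); (10, 11); (10, 15); (11, 15); (11, 16); (12, 17); (12, 18);
  (12, 19); (13, 14); (13, 19); (13, 20); (13, 21); (14, 17); (14, 21); (14,
  22); (15, 16); (17, 18); (17, 22); (17, 23); (18, 19); (18, 23); (18, 24);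
  (19, 20); (19, 24); (20, 21); (20, 24); (20, 25); (21, 22); (21, 25); (22,
  23); (22, 25); (23, 24); (23, 25); (24, 25)].
(** Degrees 5 and 6 with odd order: it gives the odd orders when degree 6 is allowed, and the copies
    around a hub are made from it. *)
Definition z15_edges : seq (nat * nat) := [:: (0, 1); (0, 2); (0, 3); (0, 4);
  (0, 5); (0, 8); (1, 3); (1, 5); (1, 6); (1, 7); (2, 4); (2, 8); (2, 9); (2,
  10); (3, 6); (3, 8); (3, 11); (4, 5); (4, 9); (4, 12); (5, 7); (5, 12); (6,
  7); (6, 11); (6, 13); (6, 14); (7, 12); (7, 13); (8, 10); (8, 11); (9, 10);
  (9, 12); (9, 13); (9, 14); (10, 11); (10, 14); (11, 14); (12, 13); (13,
  14)].

Section Points.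
Local Open Scope Z_scope.

Definition k3_points : seq (Z * Z) := [:: (0, 0); (1, 0); (0, 1)].
Definition paw_points : seq (Z * Z) := [:: (0, 0); (0, 1); (1, 0); ((-1),
  3)].
Definition k4_points : seq (Z * Z) := [:: (0, 0); (0, 4); (1, 1); (4, 0)].
Definition w4_points : seq (Z * Z) := [:: (1, 0); (9, 1); (1, 7); ((-8),
  (-1)); (0, (-9))].
Definition prism_points : seq (Z * Z) := [:: ((-3), (-2)); (2, (-4)); (1, 3);
  ((-1), (-2)); (1, (-1)); (0, 0)].
Definition octa_points : seq (Z * Z) := [:: ((-3), (-3)); (0, 3); (0, (-2));
  ((-1), 0); (3, (-3)); (1, 0)].
Definition ico_points : seq (Z * Z) := [:: ((-10), (-8)); (0, 9); ((-2),
  (-1)); ((-3), (-5)); (0, (-6)); (11, (-9)); (4, (-1)); (1, 1); (0, (-2));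
  ((-1), (-4)); (3, (-4)); (1, (-2))].
Definition o13_points : seq (Z * Z) := [:: (6, 6); (10, 1); (6, 1); (8, 2);
  (0, 0); (5, (-6)); (7, (-2)); ((-5), 5); ((-5), (-6)); ((-10), 1); ((-6),
  1); ((-7), 2); ((-6), (-1))].
Definition r26_points : seq (Z * Z) := [:: (36, 0); (62, (-18)); (57, (-1));
  (62, 17); (0, 79); (0, (-80)); (80, (-63)); (69, (-18)); (64, (-6)); (64,
  6); (80, 65); (69, 18); ((-36), 0); ((-80), 64); ((-80), (-64)); (73, 1);
  (67, 0); ((-61), (-17)); ((-57), 1); ((-62), 18); ((-69), 17); ((-74), 1);
  ((-70), (-17)); ((-63), (-6)); ((-65), 6); ((-68), 0)].
Definition z15_points : seq (Z * Z) := [:: ((-2), (-2)); (0, (-7)); ((-1), 5);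
  (2, (-3)); ((-5), 0); ((-6), (-8)); (6, (-7)); (0, (-11)); (1, 1); (1, 20);
  (3, 5); (4, (-1)); ((-19), (-18)); (20, (-19)); (6, 0)].

End Points.

Definition graph_check s l cs rm p :=
  [&& all (fun e => e.1 != e.2) l, plane_check s l cs, order_check s l rm &
    degree_check s l p].

(** For K_4, the octahedron and the icosahedron the two edges given to [order_check] are those along
    which they will be joined; connectedness is checked without them. *)
Lemma checks :
  [/\ graph_check 3 k3_edges k3_points [::] (pred1 2) &
      graph_check 4 paw_edges paw_points [::] (fun x => 1 <= x <= 3)] /\
  [/\ graph_check 4 k4_edges k4_points [:: (0, 3); (1, 2)] (pred1 3),
      graph_check 6 octa_edges octa_points [:: (0, 4); (3, 5)] (pred1 4) &
      graph_check 12 ico_edges ico_points [:: (0, 5); (9, 11)] (pred1 5)] /\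
  [/\ graph_check 5 w4_edges w4_points [::] (fun x => 3 <= x <= 4),
      graph_check 6 prism_edges prism_points [::] (pred1 3),
      graph_check 13 o13_edges o13_points [::] (pred1 4),
      graph_check 26 r26_edges r26_points [::] (pred1 5) &
      graph_check 15 z15_edges z15_points [:: (0, 8)] (fun x => 5 <= x <= 6)].
Proof. by vm_compute. Qed.

End ListGraphs.
Import ListGraphs.

(** * Counting by joining and inserting *)

Module Counting.
Import boolp reals zify.

Lemma supp_connect (V : finType) (G : {set {set V}}) (S : {set V}) x y :
  supp G S -> connect (adj G) x y -> x \in S -> y \in S.
Proof.
move=> sG /connectP [q]; elim: q x => [|z q IH] w /= => [_ ->//|/andP [a pq] E] wS.
by apply: IH pq E _; have [] := suppP sG a.
Qed.

Section DegreeSwap.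
Variables (V : finType) (S1 S2 : {set V}) (G1 G2 : {set {set V}}).
Variables (u1 v1 u2 v2 : V).
Hypotheses (dis : [disjoint S1 & S2]).
Hypotheses (s1 : supp G1 S1) (s2 : supp G2 S2).
Hypotheses (g1 : simple_graph G1) (g2 : simple_graph G2).
Hypotheses (a1 : adj G1 u1 v1) (a2 : adj G2 u2 v2).
Let G := swap G1 G2 u1 v1 u2 v2.

Let ends := swap_ends s1 s2 g1 g2 a1 a2.

Lemma nbr_swap_other x : x \in S1 -> x != u1 -> x != v1 -> nbr G x = nbr G1 x.
Proof.
move=> xS xu xv; apply/setP => y; rewrite !inE.
have [yS|nyS] := boolP (y \in S1).
  rewrite (adj_swap1 dis s1 s2 g1 g2 a1 a2) //.
  case: eqP => //= /set2_eqP [[E _]|[E _]]; first by rewrite E eqxx in xu.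
  by rewrite E eqxx in xv.
apply/idP/idP => a; last by have [_ yS] := suppP s1 a; rewrite yS in nyS.
have [_ yU] := suppP (supp_swap s1 s2 g1 g2 a1 a2) a.
move: yU; rewrite inE (negbTE nyS) /= => yS2.
case: (swap_cross dis s1 s2 g1 g2 a1 a2 xS yS2 a) => [[E _]|[E _]].
  by rewrite E eqxx in xu.
by rewrite E eqxx in xv.
Qed.

Lemma nbr_swap_end : nbr G u1 = u2 |: (nbr G1 u1 :\ v1).
Proof.
have [[h1 h2 h3 h4] [h5 h6]] := ends.
apply/setP => y; rewrite !inE.
have [yS|nyS] := boolP (y \in S1).
  rewrite (adj_swap1 dis s1 s2 g1 g2 a1 a2) //.
  have -> : (y == u2) = false.
    by apply: contraTF yS => /eqP ->; rewrite (disjointFl dis h3).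
  congr (~~ _ && _); apply/eqP/eqP => [/set2_eqP [[_ //]|[E _]]|->//].
  by rewrite E eqxx in h5.
apply/idP/idP => [a|].
  have [_ yU] := suppP (supp_swap s1 s2 g1 g2 a1 a2) a.
  move: yU; rewrite inE (negbTE nyS) /= => yS2.
  case: (swap_cross dis s1 s2 g1 g2 a1 a2 h1 yS2 a) => [[_ ->]|[E _]].
    by rewrite eqxx.
  by rewrite E eqxx in h5.
case/orP=> [/eqP ->|/andP [_ a]]; first exact: adj_swap_u.
by have [_ yS] := suppP s1 a; rewrite yS in nyS.
Qed.

End DegreeSwap.

Lemma degree_swap (V : finType) (S1 S2 : {set V}) (G1 G2 : {set {set V}})
    (u1 v1 u2 v2 x : V) : [disjoint S1 & S2] -> supp G1 S1 -> supp G2 S2 ->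
  simple_graph G1 -> simple_graph G2 -> adj G1 u1 v1 -> adj G2 u2 v2 ->
  x \in S1 -> degree (swap G1 G2 u1 v1 u2 v2) x = degree G1 x.
Proof.
move=> dis s1 s2 g1 g2 a1 a2 xS.
have [[h1 h2 h3 h4] [h5 h6]] := swap_ends s1 s2 g1 g2 a1 a2.
have sG := simple_swap dis s1 s2 g1 g2 a1 a2.
rewrite !degree_nbr //.
have key u w (N : {set V}) : u \in N -> w \notin N -> #|w |: (N :\ u)| = #|N|.
  move=> uN wN; rewrite cardsU1 !inE (negbTE wN) andbF /= add1n.
  by rewrite [RHS](cardsD1 u) uN.
have out y z : z \in S2 -> z \notin nbr G1 y.
  move=> zS; apply/negP => /(subsetP (supp_nbr _ s1)).
  by rewrite (disjointFl dis zS).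
have [->|xu] := eqVneq x u1.
  rewrite (nbr_swap_end dis s1 s2 g1 g2 a1 a2) key ?out //; first by rewrite inE.
have [->|xv] := eqVneq x v1.
  rewrite swapV (nbr_swap_end dis s1 s2 g1 g2) 1?adjC // key ?out // ?inE 1?adjC //.
by rewrite (nbr_swap_other dis s1 s2 g1 g2 a1 a2).
Qed.

(** * Classes of planar graphs by degree, and their components *)

Section Classes.
Variable R : realType.
Implicit Types (cn : bool) (p q : pred nat) (k n : nat).

(* The bound k limits how many gadgets can have been inserted, hence how many
   preimages an insertion has. *)
Definition gcls (V : finType) (cn : bool) (p q : pred nat) (k : nat)
    (S : {set V}) : {set {set {set V}}} :=
  [set G : {set {set V}} | [&& simple_graph G, supp G S,
    [forall v in S, p (degree G v)], `[< planar R G >], cn ==> conn G S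
    & #|[set v in S | ~~ q (degree G v)]| <= k]].

Lemma gclsP (V : finType) cn p q k (S : {set V}) G :
  reflect [/\ simple_graph G, supp G S, forall v, v \in S -> p (degree G v),
    planar R G & (cn -> conn G S) /\ #|[set v in S | ~~ q (degree G v)]| <= k]
  (G \in gcls cn p q k S).
Proof.
rewrite inE; apply: (iffP and5P).
  by case=> h1 h2 /forall_inP h3 /asboolP h4 /andP [/implyP h5 h6].
case=> h1 h2 h3 h4 [h5 h6]; split=> //; first exact/forall_inP.
  exact/asboolP.
by rewrite h6 andbT; apply/implyP.
Qed.

Definition cnt cn p q k n := #|gcls cn p q k [set: 'I_n]|.

Lemma gcls_gmap (V W : finType) (f : V -> W) cn p q k (S : {set V}) G :
  injective f -> (gmap f G \in gcls cn p q k (f @: S)) = (G \in gcls cn p q k S).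
Proof.
move=> finj.
have E : #|[set v in f @: S | ~~ q (degree (gmap f G) v)]| =
         #|[set v in S | ~~ q (degree G v)]|.
  rewrite -(card_imset _ finj); congr #|pred_of_set _|; apply/setP => w; rewrite inE.
  apply/andP/imsetP => [[/imsetP [v vS ->]]|[v]].
    by rewrite degree_gmap // => h; exists v; rewrite ?inE ?vS.
  by rewrite inE => /andP [vS h] ->; rewrite imset_f // degree_gmap.
apply/gclsP/gclsP; rewrite simple_gmap // supp_gmap // E.
  case=> h1 h2 h3 h4 [h5 h6]; split=> //.
  - by move=> v vS; rewrite -(degree_gmap finj); apply: h3; apply: imset_f.
  - exact: (planar_gmap_inv finj h4).
  - by split=> // /h5; rewrite conn_gmap.
case=> h1 h2 h3 h4 [h5 h6]; split=> //.
- by move=> w /imsetP [v vS ->]; rewrite degree_gmap // h3.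
- exact: planar_gmap.
- by split=> // /h5; rewrite conn_gmap.
Qed.

Lemma gmap_ex (V W : finType) (f : V -> W) (G : {set {set W}}) :
  injective f -> supp G (f @: [set: V]) -> exists G', G = gmap f G'.
Proof.
move=> finj sG; exists [set e : {set V} | f @: e \in G].
apply/setP => e; apply/idP/imsetP => [eG|[e']]; last by rewrite inE => ? ->.
have E : f @: (f @^-1: e) = e.
  apply/setP => w; apply/imsetP/idP => [[v]|we]; first by rewrite inE => ? ->.
  have /imsetP [v _ E] := subsetP (forall_inP sG _ eG) _ we.
  by exists v; rewrite // inE -E.
by exists (f @^-1: e); rewrite ?inE E.
Qed.

Lemma card_gcls (V : finType) cn p q k (S : {set V}) :
  #|gcls cn p q k S| = cnt cn p q k #|S|.
Proof.
pose f : 'I_#|S| -> V := enum_val.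
have finj : injective f by apply: enum_val_inj.
have fS : f @: [set: 'I_#|S|] = S.
  apply/setP => x; apply/imsetP/idP => [[i _ ->]|xS]; first exact: enum_valP.
  by exists (enum_rank_in xS x); rewrite // /f enum_rankK_in.
rewrite /cnt -(card_imset _ (gmap_inj finj)); congr #|pred_of_set _|.
apply/setP => G; apply/idP/imsetP => [GS|[G' GT ->]]; last first.
  by rewrite -[X in _ \in gcls _ _ _ _ X]fS gcls_gmap.
have [_ suG _ _ _] := gclsP _ _ _ _ _ _ GS.
have [|G' E] := @gmap_ex _ _ f G finj; first by rewrite fS.
by exists G' => //; rewrite -(gcls_gmap _ _ _ _ _ _ finj) fS -E.
Qed.

Lemma leq_cnt cn p p' q q' k k' n : subpred p p' -> subpred q q' -> k <= k' ->
  cnt cn p q k n <= cnt cn p' q' k' n.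
Proof.
move=> pp qq kk; apply: subset_leq_card; apply/subsetP => G /gclsP [h1 h2 h3 h4 [h5 h6]].
apply/gclsP; split=> //; first by move=> v /h3 /pp.
split=> //; apply: leq_trans kk; apply: leq_trans h6; apply: subset_leq_card.
by apply/subsetP => v; rewrite !inE => /andP [vS] /=; apply: contra; apply: qq.
Qed.

(** No edge leaves the component of [v0], so the graph is determined by this component and its
    traces on it and on the rest; degrees are unchanged in the traces. *)
Lemma gcls_component (V : finType) p (S : {set V}) v0 : v0 \in S ->
  #|gcls false p p 0 S| <= \sum_(C : {set V} | (v0 \in C) && (C \subset S))
    #|gcls true p p 0 C| * #|gcls false p p 0 (S :\: C)|.
Proof.
move=> v0S.
pose comp G : {set V} := [set x | connect (adj G) v0 x].
pose res (G : {set {set V}}) (C : {set V}) := [set e in G | e \subset C].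
pose code G := (comp G, (res G (comp G), res G (S :\: comp G))).
have compS G : supp G S -> comp G \subset S.
  by move=> sG; apply/subsetP => x; rewrite inE => /(supp_connect sG); apply.
have closed G e : simple_graph G -> e \in G ->
    (e \subset comp G) || (e \subset ~: comp G).
  move=> sG eG; have [x [y [_ -> a]]] := simple_edgeP sG eG.
  rewrite !subUset !sub1set !inE.
  have -> : connect (adj G) v0 y = connect (adj G) v0 x.
    apply/idP/idP => h; apply: connect_trans h (connect1 _) => //.
    by rewrite adjC.
  by case: (connect _ _ _).
have resdeg G (C : {set V}) v : simple_graph G -> v \in C ->
    (forall e, e \in G -> v \in e -> e \subset C) -> degree (res G C) v = degree G v.
  move=> sG vC H; rewrite /degree; congr #|pred_of_set _|; apply/setP => e; rewrite !inE.
  case eG: (e \in G) => //=; case ve: (v \in e); rewrite ?andbF ?andbT //.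
  exact: H.
have inj : {in gcls false p p 0 S &, injective code}.
  move=> G G' /gclsP [sG suG _ _ _] /gclsP [sG' suG' _ _ _] [Ec E1 E2].
  have rec H : simple_graph H -> supp H S -> H = res H (comp H) :|: res H (S :\: comp H).
    move=> sH suH; apply/setP => e; rewrite !inE -andb_orr.
    case eH: (e \in H) => //=; have h := closed _ _ sH eH.
    by rewrite setDE subsetI (forall_inP suH) //= h.
  by rewrite (rec G) // (rec G') // E1 E2.
rewrite -(card_in_imset inj).
apply: leq_trans (_ : #|[set x : {set V} * ({set {set V}} * {set {set V}}) |
    ((v0 \in x.1) && (x.1 \subset S)) &&
    (x.2 \in setX (gcls true p p 0 x.1) (gcls false p p 0 (S :\: x.1)))]| <= _).
  apply: subset_leq_card; apply/subsetP => c /imsetP [G /gclsP [sG suG dG pG _] ->].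
  have cS := compS _ suG; have v0C : v0 \in comp G by rewrite inE connect0.
  rewrite inE /= cS v0C /=.
  have subr C : res G C \subset G by apply/subsetP => e; rewrite inE => /andP [].
  have z (C : {set V}) (H : {set {set V}}) : (forall v, v \in C -> p (degree H v)) ->
      #|[set v in C | ~~ p (degree H v)]| <= 0.
    move=> h; rewrite leqn0 cards_eq0; apply/eqP/setP => v; rewrite !inE.
    by case vC: (v \in C); rewrite //= h.
  have d1 v : v \in comp G -> degree (res G (comp G)) v = degree G v.
    move=> vC; apply: resdeg => // e eG ve; case/orP: (closed _ _ sG eG) => //.
    by move/subsetP/(_ _ ve); rewrite inE vC.
  have d2 v : v \in S :\: comp G -> degree (res G (S :\: comp G)) v = degree G v.
    move=> /[dup] vC; rewrite in_setD => /andP [nC vS]; apply: resdeg => // e eG ve.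
    rewrite setDE subsetI (forall_inP suG) //=; case/orP: (closed _ _ sG eG) => //.
    by move/subsetP/(_ _ ve); rewrite (negbTE nC).
  have h1 v : v \in comp G -> p (degree (res G (comp G)) v).
    by move=> vC; rewrite d1 // dG // (subsetP cS).
  have h2 v : v \in S :\: comp G -> p (degree (res G (S :\: comp G)) v).
    by move=> vC; rewrite d2 // dG //; move: vC; rewrite in_setD => /andP [].
  apply/setXP; split; apply/gclsP; split => //.
  - exact: simple_sub (subr _) sG.
  - by apply/forall_inP => e; rewrite inE => /andP [].
  - exact: planar_sub (subr _) pG.
  - split; last exact: z.
    move=> _; apply: (@conn_root _ _ _ v0) => x; rewrite inE => /connectP [q].
    suff H (q0 : seq V) w : w \in comp G -> path (adj G) w q0 ->
        connect (adj (res G (comp G))) w (last w q0).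
      by move=> pq ->; apply: H.
    elim: q0 w => [|y q0 IH] w wC /= => [_|/andP [a pq]]; first exact: connect0.
    have yC : y \in comp G.
      by move: wC; rewrite !inE => h; apply: connect_trans h (connect1 a).
    apply: connect_trans (IH _ yC pq); apply: connect1.
    by rewrite /adj inE -/(adj G w y) a /= subUset !sub1set wC.
  - exact: simple_sub (subr _) sG.
  - by apply/forall_inP => e; rewrite inE => /andP [].
  - exact: planar_sub (subr _) pG.
  - by split=> //; apply: z.
rewrite -sum1_card.
under [X in _ <= X]eq_bigr => C _ do rewrite -cardsX -sum1_card.
rewrite pair_big_dep /=; apply: eq_leq; apply: eq_bigl => x; by rewrite inE.
Qed.

Lemma cnt_component p n :
  cnt false p p 0 n.+1 <= \sum_(k < n.+1)
    'C(n, k) * (cnt true p p 0 k.+1 * cnt false p p 0 (n - k)).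
Proof.
apply: leq_trans (gcls_component p (in_setT (ord0 : 'I_n.+1))) _.
rewrite (eq_bigr (fun C : {set 'I_n.+1} => cnt true p p 0 #|C| * cnt false p p 0 (n.+1 - #|C|))); last first.
  move=> C _; rewrite !card_gcls; congr (_ * cnt _ _ _ _ _).
  by rewrite setTD cardsCs setCK card_ord.
(* Components of the vertex 0 are grouped by the number of their other vertices. *)
rewrite (partition_big (fun C : {set 'I_n.+1} => inord #|C|.-1 : 'I_n.+1) xpredT) //=.
apply: leq_sum => k _.
have sizeC (C : {set 'I_n.+1}) : ord0 \in C -> (inord #|C|.-1 == k) = (#|C| == k.+1).
  move=> oC; have C0 : 0 < #|C| by rewrite (cardD1 ord0) oC.
  have := max_card (mem C); rewrite card_ord; move: C0.
  by case: #|C| => // m _ mn; rewrite -val_eqE /= inordK // eqSS.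
rewrite (eq_bigr (fun _ => cnt true p p 0 k.+1 * cnt false p p 0 (n - k))); last first.
  by move=> C /andP [/andP [oC _]]; rewrite sizeC // => /eqP ->; rewrite subSS.
rewrite sum_nat_const leq_mul2r; apply/orP; right.
have cn : #|[set~ (ord0 : 'I_n.+1)]| = n by rewrite cardsC1 card_ord.
rewrite -[X in 'C(X, k)]cn -cards_draws -(@card_in_imset _ _ (fun C : {set 'I_n.+1} => C :\ ord0)); last first.
  move=> C C' /andP [/andP [oC _] _] /andP [/andP [oC' _] _] E.
  by rewrite -(setD1K oC) -(setD1K oC') E.
apply: subset_leq_card; apply/subsetP => D /imsetP [C].
case/andP => /andP [oC _]; rewrite sizeC // => /eqP cC ->.
rewrite inE; apply/andP; split.
  by apply/subsetP => x; rewrite !inE => /andP [].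
by have := cardsD1 ord0 C; rewrite oC cC add1n => -[<-].
Qed.

End Classes.

(** * Recovering a gadget inside a larger graph *)

Section Ball.
Variables (V : finType) (G : {set {set V}}) (d : nat).

(* Growing only through vertices of degree at most d keeps the ball small
   whatever the other degrees: a glued copy of a fixed graph lies in the ball
   around any of its vertices, so it can be recovered up to bounded ambiguity. *)
Fixpoint ball (L : nat) (v : V) : {set V} :=
  if L is L'.+1 then
    ball L' v :|: \bigcup_(u in ball L' v | #|nbr G u| <= d) nbr G u
  else [set v].

Lemma card_ball L v : #|ball L v| <= d.+1 ^ L.
Proof.
elim: L => [|L IH] /=; first by rewrite cards1.
apply: leq_trans (leq_card_setU _ _) _.
apply: leq_trans (_ : #|ball L v| + #|ball L v| * d <= _); last first.
  by rewrite -mulnS expnS mulnC leq_mul2l IH orbT.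
rewrite leq_add2l.
apply: leq_trans (_ : \sum_(u in ball L v | #|nbr G u| <= d) #|nbr G u| <= _).
  elim/big_rec2: _ => [|u c B _ h]; first by rewrite cards0.
  by apply: leq_trans (leq_card_setU _ _) _; rewrite leq_add2l.
rewrite -sum_nat_const big_mkcondr /=; apply: leq_sum => u _.
by case: ifP.
Qed.

Lemma ball_mono L L' v : L <= L' -> ball L v \subset ball L' v.
Proof.
elim: L' => [|L' IH]; first by rewrite leqn0 => /eqP ->.
rewrite leq_eqVlt => /predU1P [-> //|h]; apply: subset_trans (IH h) _.
exact: subsetUl.
Qed.

Lemma ball_step L v u w : u \in ball L v -> #|nbr G u| <= d -> adj G u w ->
  w \in ball L.+1 v.
Proof.
move=> uB du a; rewrite inE; apply/orP; right; apply/bigcupP.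
by exists u; rewrite ?uB // inE.
Qed.

(** A path without repetition has at most #|T| vertices, and the images of its vertices have degree
    at most [d], so the ball grows along the whole path. *)
Lemma ball_hom (T : finType) (H : {set {set T}}) (tau : T -> V) r i :
  (forall a b, adj H a b -> adj G (tau a) (tau b)) ->
  (forall a, #|nbr G (tau a)| <= d) ->
  connect (adj H) r i -> tau i \in ball #|T| (tau r).
Proof.
move=> hom deg /connectP [p0 pp0 ->]; case/shortenP: pp0 => p pp up _.
have sz : size p <= #|T|.
  by have := max_card (mem (r :: p)); rewrite (card_uniqP up) => /ltnW.
apply: (subsetP (ball_mono _ sz)).
elim/last_ind: p pp {up sz} => [|p z IH] /=; first by rewrite inE.
rewrite rcons_path last_rcons size_rcons => /andP [pp a].
exact: ball_step (IH pp) (deg _) (hom _ _ a).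
Qed.

(** The candidates for the placement of a gadget in a given graph: the root ranges over [Rt], and
    the other vertices over a set of bounded size around it. *)
Definition codes (s : nat) (r : 'I_s) (Rt : {set V}) : {set {ffun 'I_s -> V}} :=
  [set tau : {ffun 'I_s -> V} | (tau r \in Rt) && [forall i, tau i \in ball s (tau r)]].

Lemma card_codes s (r : 'I_s) (Rt : {set V}) :
  #|codes r Rt| <= #|Rt| * (d.+1 ^ s) ^ s.
Proof.
pose Q v := [set tau : {ffun 'I_s -> V} | tau \in ffun_on (mem (ball s v))].
apply: leq_trans (@card_dep_le _ _ Rt Q _ _); last first.
  move=> v _; rewrite cardsE card_ffun_on card_ord.
  by case: (s) => // k; rewrite leq_exp2r // card_ball.
have inj : injective (fun tau : {ffun 'I_s -> V} => (tau r, tau)) by move=> ? ? [].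
rewrite -(card_imset _ inj); apply: subset_leq_card; apply/subsetP => z.
case/imsetP=> tau Htau ->; move: Htau.
rewrite {1}/codes [in X in X -> _]inE => /andP [h1 /forallP h2].
by rewrite inE h1 inE; apply/ffun_onP => i; apply: h2.
Qed.

End Ball.

(** Every vertex begins an oriented edge. These edges are the places where the graph can be cut, and
    their number is the gain in each join or insertion. *)
Lemma arcs_ge (V : finType) (G : {set {set V}}) (S : {set V}) :
  conn G S -> 1 < #|S| -> #|S| <= #|[set uv : V * V | adj G uv.1 uv.2]|.
Proof.
move=> cG S1; apply: leq_trans (leq_imset_card fst _); apply: subset_leq_card.
apply/subsetP => x xS.
have [y yS yx] : exists2 y, y \in S & y != x.
  have : 0 < #|S :\ x| by move: S1; rewrite (cardsD1 x S) xS.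
  by rewrite card_gt0 => /set0Pn [y]; rewrite !inE => /andP [? ?]; exists y.
have /connectP [[|z p] /=] := connP cG xS yS.
  by move=> _ E; rewrite E eqxx in yx.
by case/andP=> a _ _; apply/imsetP; exists (x, z); rewrite ?inE.
Qed.

Section SwapInj.
Variables (V : finType) (S1 S2 : {set V}) (G1 G2 G1' G2' : {set {set V}}).
Variables (u1 v1 u2 v2 u1' v1' : V).
Hypotheses (dis : [disjoint S1 & S2]).
Hypotheses (s1 : supp G1 S1) (s2 : supp G2 S2) (s1' : supp G1' S1) (s2' : supp G2' S2).
Hypotheses (g1 : simple_graph G1) (g2 : simple_graph G2).
Hypotheses (g1' : simple_graph G1') (g2' : simple_graph G2').
Hypotheses (a1 : adj G1 u1 v1) (a2 : adj G2 u2 v2).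
Hypotheses (a1' : adj G1' u1' v1') (a2' : adj G2' u2 v2).
Hypothesis E : swap G1 G2 u1 v1 u2 v2 = swap G1' G2' u1' v1' u2 v2.

(** The neighbours of [u2] and [v2] on the other side are [u1] and [v1]; the graphs are then the
    induced subgraphs with the cut edges put back. *)
Lemma swap_inj : [/\ G1 = G1', G2 = G2', u1 = u1' & v1 = v1'].
Proof.
have [[h1 h2 h3 h4] [h5 h6]] := swap_ends s1 s2 g1 g2 a1 a2.
have [[k1 k2 k3 k4] [k5 k6]] := swap_ends s1' s2' g1' g2' a1' a2'.
have Eu : u1 = u1'.
  have a : adj (swap G1 G2 u1 v1 u2 v2) u1' u2 by rewrite E; apply: adj_swap_u.
  case: (swap_cross dis s1 s2 g1 g2 a1 a2 k1 h3 a) => [[-> //]|[_ E2]].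
  by rewrite E2 eqxx in h6.
have Ev : v1 = v1'.
  have a : adj (swap G1 G2 u1 v1 u2 v2) v1' v2 by rewrite E; apply: adj_swap_v.
  case: (swap_cross dis s1 s2 g1 g2 a1 a2 k2 h4 a) => [[_ E2]|[-> //]].
  by rewrite E2 eqxx in h6.
have dis' : [disjoint S2 & S1] by rewrite disjoint_sym.
split=> //.
  have e1 := swap_side1 dis s1 s2 g1 g2 a1 a2.
  have e2 := swap_side1 dis s1' s2' g1' g2' a1' a2'.
  by rewrite -(setD1K a1) -(setD1K a1') -e1 -e2 E Eu Ev.
have e1 := swap_side1 dis' s2 s1 g2 g1 a2 a1; rewrite swapC in e1.
have e2 := swap_side1 dis' s2' s1' g2' g1' a2' a1'; rewrite swapC in e2.
by rewrite -(setD1K a2) -(setD1K a2') -e1 -e2 E.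
Qed.

End SwapInj.

Section SwapClass.
Variable R : realType.
Variables (V : finType) (S1 S2 : {set V}) (p q : pred nat) (k1 k2 : nat).
Variables (G1 G2 : {set {set V}}) (u1 v1 u2 v2 : V).
Hypotheses (dis : [disjoint S1 & S2]).
Hypotheses (a1 : adj G1 u1 v1) (a2 : adj G2 u2 v2).

Lemma swap_gcls (c2 : bool) : G1 \in gcls R true p q k1 S1 -> G2 \in gcls R c2 p q k2 S2 ->
  conn (G2 :\ [set u2; v2]) S2 ->
  swap G1 G2 u1 v1 u2 v2 \in gcls R true p q (k1 + k2) (S1 :|: S2).
Proof.
case/gclsP=> g1 s1 d1 p1 [/(_ isT) c1 n1]; case/gclsP=> g2 s2 d2 p2 [_ n2] c2'.
have D1 x : x \in S1 -> degree (swap G1 G2 u1 v1 u2 v2) x = degree G1 x.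
  exact: degree_swap dis s1 s2 g1 g2 a1 a2.
have D2 x : x \in S2 -> degree (swap G1 G2 u1 v1 u2 v2) x = degree G2 x.
  by rewrite swapC; apply: degree_swap s2 s1 g2 g1 a2 a1; rewrite disjoint_sym.
apply/gclsP; split.
- exact: simple_swap dis s1 s2 g1 g2 a1 a2.
- exact: supp_swap.
- by move=> x; rewrite inE => /orP [xS|xS]; [rewrite D1 ?d1|rewrite D2 ?d2].
- exact: planar_swap dis s1 s2 g1 g2 a1 a2 p1 p2.
- split; first by move=> _; apply: conn_swap.
  apply: leq_trans (leq_add n1 n2); apply: leq_trans (leq_card_setU _ _).
  apply: subset_leq_card; apply/subsetP => x; rewrite !inE => /andP [/orP [] xS].
    by rewrite D1 // xS => ->.
  by rewrite D2 // xS => ->; rewrite orbT.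
Qed.

End SwapClass.

(** * Joining two graphs through a gadget *)

Section Join.
Variables (R : realType) (p : pred nat) (s : nat) (H : {set {set 'I_s}}).
Variables (x1 y1 x2 y2 : 'I_s).
Hypothesis HH : H \in gcls R true p p 0 [set: 'I_s].
Hypotheses (a1 : adj H x1 y1) (a2 : adj H x2 y2).
Hypothesis ne : [&& x2 != x1, x2 != y1, y2 != x1 & y2 != y1].
Hypothesis cH : conn (H :\ [set x1; y1] :\ [set x2; y2]) [set: 'I_s].

Let gH : simple_graph H. Proof. by case/gclsP: HH. Qed.

Lemma conn_del (V : finType) (G : {set {set V}}) (S : {set V}) e :
  conn (G :\ e) S -> conn G S.
Proof.
move=> c; apply/forall_inP => a aS; apply/forall_inP => b bS.
apply: connect_adj_sub (connP c aS bS) => u v /setD1P [_ h].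
exact: connect1.
Qed.

Section Glue.
Variables (V : finType) (tau : {ffun 'I_s -> V}) (S1 : {set V}) (k : nat) (q : pred nat).
Hypothesis tinj : injective tau.
Let T := tau @: [set: 'I_s].
Variables (G1 : {set {set V}}) (u1 v1 : V).
Hypothesis dis : [disjoint S1 & T].
Hypothesis c1 : G1 \in gcls R true p q k S1.
Hypothesis b1 : adj G1 u1 v1.
Let Ht := gmap tau H.
Let K := swap G1 Ht u1 v1 (tau x1) (tau y1).

Lemma ne_edges : [set tau x2; tau y2] != [set tau x1; tau y1].
Proof.
apply/eqP => /set2_eqP [[/tinj E _]|[/tinj E _]]; case/and4P: ne.
  by rewrite E eqxx.
by rewrite E eqxx => ? /negP.
Qed.

Lemma glue_gcls (kH : nat) : H \in gcls R true p q kH [set: 'I_s] ->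
  K \in gcls R true p q (k + kH) (S1 :|: T).
Proof.
move=> HH'; apply: (@swap_gcls _ _ _ _ _ _ _ _ _ _ _ _ _ _ dis b1 _ true) => //.
- by rewrite adj_gmap.
- by rewrite gcls_gmap.
- rewrite -gmap_setD1 // conn_gmap //; first exact: conn_del cH.
  exact: simple_sub (subsetDl _ _) gH.
Qed.

Lemma adj_glue : adj K (tau x2) (tau y2).
Proof. by rewrite adj_swap ne_edges adj_gmap // a2 orbT. Qed.

(** The deletion takes place inside the gadget and commutes with the swap. This is what allows the
    second graph to be cut at a bridge. *)
Lemma glue_conn : conn (K :\ [set tau x2; tau y2]) (S1 :|: T).
Proof.
have [g1 s1 _ _ [/(_ isT) cc1 _]] := gclsP _ _ _ _ _ _ _ c1.
have E : K :\ [set tau x2; tau y2] =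
    swap G1 (gmap tau (H :\ [set x2; y2])) u1 v1 (tau x1) (tau y1).
  have inT i : tau i \in T by apply: imset_f.
  have nS x : x \in S1 -> forall i, x != tau i.
    by move=> xS i; apply: contraTneq (inT i) => <-; rewrite (disjointFr dis xS).
  have [u1S v1S] := suppP s1 b1.
  have n1 : (G1 :\ [set u1; v1]) :\ [set tau x2; tau y2] = G1 :\ [set u1; v1].
    apply/setP => e; rewrite !inE; case: eqP => //= ->; symmetry; apply/negP.
    case/andP=> _ /(forall_inP s1); rewrite subUset !sub1set => /andP [tS _].
    by have := nS _ tS x2; rewrite eqxx.
  have n2 w z : w \in S1 -> [set [set w; tau z]] :\ [set tau x2; tau y2] = [set [set w; tau z]].
    move=> wS; apply/setP => e; rewrite !inE andbC.
    case: eqP => //= ->; apply/eqP => /set2_eqP [[E _]|[E _]].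
      by have := nS _ wS x2; rewrite E eqxx.
    by have := nS _ wS y2; rewrite E eqxx.
  rewrite /K /swap !setDUl n1 !n2 // gmap_setD1 //; congr (_ :|: _ :|: _).
  by apply/setP => e; rewrite !inE andbCA.
rewrite E; apply: conn_swap => //.
- have -> : T = tau @: [set: 'I_s] by [].
  by rewrite supp_gmap //; apply/forall_inP => e _; apply: subsetT.
- by rewrite simple_gmap //; apply: simple_sub gH; apply: subsetDl.
- rewrite adj_gmap // adj_setD1 a1 andbT; apply/eqP => E1.
  by have := ne_edges; rewrite -!imset_set2 E1 eqxx.
- rewrite -gmap_setD1 // conn_gmap //; last first.
    apply: (simple_sub _ gH).
    exact: subset_trans (subD1set _ _) (subD1set _ _).
  suff -> : H :\ [set x2; y2] :\ [set x1; y1] = H :\ [set x1; y1] :\ [set x2; y2] by [].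
  by apply/setP => e; rewrite !inE andbCA.
Qed.

End Glue.

Definition rooted (V : finType) (X : {set {set {set V}}}) : {set {set {set V}} * (V * V)} :=
  [set x : {set {set V}} * (V * V) | (x.1 \in X) && (x.2 \in [set uv | adj x.1 uv.1 uv.2])].

Lemma card_rooted (V : finType) q k (S : {set V}) : 1 < #|S| ->
  cnt R true p q k #|S| * #|S| <= #|rooted (gcls R true p q k S)|.
Proof.
move=> S1; rewrite -card_gcls.
apply: (@card_dep_ge _ _ (gcls R true p q k S) (fun G => [set uv | adj G uv.1 uv.2])).
by move=> G /gclsP [_ _ _ _ [/(_ isT) c _]]; apply: arcs_ge.
Qed.

(** A vertex of degree at most 5 bounds the minimum degree by 5, as the ambient class of the theorem
    demands. *)
Definition low_gcls (V : finType) (S : {set V}) : {set {set {set V}}} :=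
  [set G in gcls R true p p 0 S | [exists v in S, degree G v <= 5]].

Hypothesis lowH : exists i, degree H i <= 5.

Section Count.
Variables (V : finType) (m n : nat).
Hypotheses (m1 : 1 < m) (n1 : 1 < n) (cV : #|V| = m + n + s).

Let im (tau : {ffun 'I_s -> V}) : {set V} := tau @: [set: 'I_s].
Let GT := ({set {set V}} * (V * V))%type.

Let Q (tau : {ffun 'I_s -> V}) : {set {set V} * (GT * GT)} :=
  [set y : {set V} * (GT * GT) | (y.1 \in [set A : {set V} | A \subset ~: im tau & #|A| == m]) &&
    (y.2 \in setX (rooted (gcls R true p p 0 y.1))
                  (rooted (gcls R true p p 0 (~: (y.1 :|: im tau)))))].

(** The data of a join: the placement of the gadget, the vertex set of the first graph, and two
    connected graphs with an oriented edge each, the second on all remaining vertices. *)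
Let tuples : {set {ffun 'I_s -> V} * ({set V} * (GT * GT))} :=
  [set x : {ffun 'I_s -> V} * ({set V} * (GT * GT)) |
    (x.1 \in [set f : {ffun 'I_s -> V} | injectiveb f]) && (x.2 \in Q x.1)].

Let K (x : {ffun 'I_s -> V} * ({set V} * (GT * GT))) : {set {set V}} :=
  swap x.2.2.1.1 (gmap x.1 H) x.2.2.1.2.1 x.2.2.1.2.2 (x.1 x1) (x.1 y1).

Let joined (x : {ffun 'I_s -> V} * ({set V} * (GT * GT))) : {set {set V}} :=
  swap (K x) x.2.2.2.1 (x.1 x2) (x.1 y2) x.2.2.2.2.1 x.2.2.2.2.2.

Let card_im (tau : {ffun 'I_s -> V}) : injective tau -> #|im tau| = s.
Proof. by move=> ti; rewrite card_imset // cardsT card_ord. Qed.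

Lemma card_tuples : (m + n + s) ^_ s * ('C(m + n, m) *
  ((cnt R true p p 0 m * m) * (cnt R true p p 0 n * n))) <= #|tuples|.
Proof.
rewrite -{1}cV -{1}(card_ord s) -card_inj_ffuns; apply: (@card_dep_ge _ _ _ Q) => tau.
rewrite inE => /injectiveP ti.
have cC : #|~: im tau| = m + n by rewrite cardsCs setCK cV card_im // addnK.
rewrite -cC -cards_draws.
apply: (@card_dep_ge _ _ _ (fun A => setX (rooted (gcls R true p p 0 A))
  (rooted (gcls R true p p 0 (~: (A :|: im tau)))))) => A.
rewrite inE => /andP [sA /eqP cA].
have cB : #|~: (A :|: im tau)| = n.
  rewrite cardsCs setCK cV cardsU card_im // cA.
  have -> : A :&: im tau = set0.
    by apply/eqP; rewrite setI_eq0 disjoint_sym disjoints_subset -setCS setCK.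
  by rewrite cards0 subn0; lia.
rewrite cardsX; apply: leq_mul.
  by have := @card_rooted _ p 0 A; rewrite cA; apply.
by have := @card_rooted _ p 0 (~: (A :|: im tau)); rewrite cB; apply.
Qed.

Let facts tau A (G1 : {set {set V}}) u1 v1 (G2 : {set {set V}}) u2 v2 :
  (tau, (A, ((G1, (u1, v1)), (G2, (u2, v2))))) \in tuples ->
  [/\ injective tau, [disjoint A & im tau],
      G1 \in gcls R true p p 0 A /\ adj G1 u1 v1,
      G2 \in gcls R true p p 0 (~: (A :|: im tau)) /\ adj G2 u2 v2 &
      [disjoint (A :|: im tau) & ~: (A :|: im tau)]].
Proof.
rewrite inE /= => /andP [H1 H2]; move: H1 H2; rewrite inE => /injectiveP ti.
rewrite inE /= => /andP [HA /setXP [X1 X2]].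
move: HA; rewrite inE => /andP [sA _].
move: X1; rewrite inE /= => /andP [h1]; rewrite inE /= => h2.
move: X2; rewrite inE /= => /andP [h3]; rewrite inE /= => h4.
by split=> //; rewrite disjoints_subset // setCK.
Qed.

(** Recovers the vertices of the second graph: those reached, off the gadget, from the outer
    neighbours of the ends of the second gadget edge. Both ends are used since the cut edge may have
    been a bridge. *)
Let outer (G : {set {set V}}) (tau : {ffun 'I_s -> V}) : {set V} :=
  [set z | [exists a, [&& a \notin im tau, adj G a (tau x2) || adj G a (tau y2) &
     connect (rin (adj G) (~: im tau)) a z]]].

Let outerP x : x \in tuples -> outer (joined x) x.1 = ~: (x.2.1 :|: im x.1).
Proof.
case: x => tau [A [[G1 [u1 v1]] [G2 [u2 v2]]]] /= Hx.
have [ti dA [h1 b1] [h2 b2] dAB] := facts Hx.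
set B := ~: (A :|: im tau); set x := (tau, _); pose KK := K x; set J := joined x.
have KC : KK \in gcls R true p p (0 + 0) (A :|: im tau) by apply: glue_gcls.
have [gK sK _ _ _] := gclsP _ _ _ _ _ _ _ KC.
have [g1 s1 _ _ _] := gclsP _ _ _ _ _ _ _ h1.
have [g2 s2 _ _ [/(_ isT) c2 _]] := gclsP _ _ _ _ _ _ _ h2.
have aK : adj KK (tau x2) (tau y2) by apply: adj_glue.
have dBA : [disjoint B & A :|: im tau] by rewrite disjoint_sym.
have JE : J = swap G2 KK u2 v2 (tau x2) (tau y2) by rewrite /J /joined /= swapC.
have sJ : supp J (B :|: (A :|: im tau)) by rewrite JE; apply: supp_swap.
have [[e1 e2 e3 e4] [e5 e6]] := swap_ends s2 sK g2 gK b2 aK.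
have inT i : tau i \in im tau by apply: imset_f.
have BT z : z \in B -> z \notin im tau by rewrite !inE negb_or => /andP [].
have AT z : z \in A -> z \notin im tau by move=> zA; rewrite (disjointFr dA zA).
have noAB a b : a \in B -> b \in A -> ~~ adj J a b.
  move=> aB bA; apply/negP; rewrite JE => a'.
  have bU : b \in A :|: im tau by rewrite inE bA.
  have := swap_cross dBA s2 sK g2 gK b2 aK aB bU a'.
  by case=> [[_ E]|[_ E]]; have := AT _ bA; rewrite E inT.
(* By [ne] the ends of the second gadget edge differ from those of the first, so the swap with the
   first graph gives them no neighbour in [A]. *)
have noA2 a i : a \in A -> i \in [set x2; y2] -> ~~ adj J a (tau i).
  move=> aA iH; apply/negP.
  have aU : a \in A :|: im tau by rewrite inE aA.
  have tU : tau i \in A :|: im tau by rewrite inE inT orbT.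
  have sH : supp (gmap tau H) (im tau).
    by rewrite supp_gmap //; apply/forall_inP => e _; apply: subsetT.
  have gT : simple_graph (gmap tau H) by rewrite simple_gmap.
  have aT : adj (gmap tau H) (tau x1) (tau y1) by rewrite adj_gmap.
  rewrite JE swapC (adj_swap1 dAB sK s2 gK g2 aK b2) // => /andP [_ aK'].
  have := swap_cross dA s1 sH g1 gT b1 aT aA (inT i) aK'.
  move: iH ne; rewrite !inE => /orP [] /eqP -> /and4P [n1' n2' n3' n4'];
    by case=> [[_ /ti E]|[_ /ti E]]; move: n1' n2' n3' n4'; rewrite E eqxx.
apply/setP => z; rewrite inE; apply/existsP/idP => [[a /and3P [aT aa ca]]|zB].
  have aB : a \in B.
    have [aU _] : a \in B :|: (A :|: im tau) /\ True.
      by case/orP: aa => /(suppP sJ) [].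
    move: aU; rewrite inE => /orP [//|]; rewrite inE (negbTE aT) orbF => aA.
    case/orP: aa => h; last by have := noA2 a y2 aA; rewrite set22 h => /(_ isT).
    by have := noA2 a x2 aA; rewrite set21 h => /(_ isT).
  case/connectP: ca => q; elim: q a aB {aT aa} => [|b q IH] a aB /= => [_ ->//|].
  case/andP=> /and3P [_ bT ab] pq E; apply: IH pq E.
  have [_ bU] := suppP sJ ab; move: bU; rewrite inE => /orP [//|].
  move: bT; rewrite in_setC inE => /negbTE ->; rewrite orbF => bA.
  by have := noAB _ _ aB bA; rewrite ab.
have cz : connect (adj G2) u2 z by apply: connP c2 _ _.
have lift a : a \in B -> connect (adj (G2 :\ [set u2; v2])) a z ->
    connect (rin (adj J) (~: im tau)) a z.
  move=> aB /connectP [q]; elim: q a aB => [|b q IH] a aB /= => [_ ->|]; first exact: connect0.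
  case/andP=> ab pq E; have := ab; rewrite adj_setD1 => /andP [_ ab2].
  have [_ bB] := suppP s2 ab2.
  apply: connect_trans (connect1 _) (IH _ bB pq E).
  rewrite rinE !in_setC !BT //= JE (adj_swap1 dBA s2 sK g2 gK b2 aK) //.
  by rewrite -adj_setD1.
have auJ : adj J u2 (tau x2) by rewrite JE; apply: adj_swap_u.
have avJ : adj J v2 (tau y2) by rewrite JE; apply: adj_swap_v.
case/orP: (connect_cut v2 cz) => h.
  by exists u2; rewrite BT // auJ lift.
by exists v2; rewrite BT // avJ orbT lift.
Qed.

Lemma joined_inj : {in tuples &, injective (fun x => (joined x, x.1))}.
Proof.
move=> x x' Hx Hx' [EJ Et].
have EO : ~: (x.2.1 :|: im x.1) = ~: (x'.2.1 :|: im x'.1).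
  by rewrite -!outerP // EJ Et.
case: x Hx EJ Et EO => tau [A [[G1 [u1 v1]] [G2 [u2 v2]]]] Hx EJ Et EO.
case: x' Hx' EJ Et EO => tau' [A' [[G1' [u1' v1']] [G2' [u2' v2']]]] Hx' EJ /= Et EO.
subst tau'.
have [ti dA [h1 b1] [h2 b2] dAB] := facts Hx.
have [_ dA' [h1' b1'] [h2' b2'] dAB'] := facts Hx'.
move/setC_inj: EO => EO.
have EA : A = A'.
  have E (B : {set V}) : [disjoint B & im tau] -> B = (B :|: im tau) :\: im tau.
    by rewrite setDUl setDv setU0 => /disjoint_setI0 d; rewrite setDE; apply/esym/setIidPl; rewrite -disjoints_subset -setI_eq0 d.
  by rewrite (E _ dA) (E _ dA') EO.
subst A'.
have KC := glue_gcls ti dA h1 b1 HH; have KC' := glue_gcls ti dA h1' b1' HH.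
have [gK sK _ _ _] := gclsP _ _ _ _ _ _ _ KC.
have [gK' sK' _ _ _] := gclsP _ _ _ _ _ _ _ KC'.
have [g1 s1 _ _ _] := gclsP _ _ _ _ _ _ _ h1.
have [g2 s2 _ _ _] := gclsP _ _ _ _ _ _ _ h2.
have [g1' s1' _ _ _] := gclsP _ _ _ _ _ _ _ h1'.
have [g2' s2' _ _ _] := gclsP _ _ _ _ _ _ _ h2'.
have aK : adj (swap G1 (gmap tau H) u1 v1 (tau x1) (tau y1)) (tau x2) (tau y2).
  exact: adj_glue.
have aK' : adj (swap G1' (gmap tau H) u1' v1' (tau x1) (tau y1)) (tau x2) (tau y2).
  exact: adj_glue.
have dBA : [disjoint ~: (A :|: im tau) & A :|: im tau] by rewrite disjoint_sym.
move: EJ; rewrite /joined /= swapC [RHS]swapC => EJ.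
have [-> EK -> ->] := swap_inj dBA s2 sK s2' sK' g2 gK g2' gK' b2 aK b2' aK' EJ.
have sH : supp (gmap tau H) (im tau).
  by rewrite supp_gmap //; apply/forall_inP => e _; apply: subsetT.
have gT : simple_graph (gmap tau H) by rewrite simple_gmap.
have aT : adj (gmap tau H) (tau x1) (tau y1) by rewrite adj_gmap.
by have [-> _ -> ->] := swap_inj dA s1 sH s1' sH g1 gT g1' gT b1 aT b1' aT EK.
Qed.

Lemma joined_low x : x \in tuples ->
  (joined x \in low_gcls [set: V]) && (x.1 \in codes (joined x) s x1 [set: V]).
Proof.
case: x => tau [A [[G1 [u1 v1]] [G2 [u2 v2]]]] Hx.
have [ti dA [h1 b1] [h2 b2] dAB] := facts Hx.
set x := (tau, _); have KC : K x \in gcls R true p p (0 + 0) (A :|: im tau) by apply: glue_gcls.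
have [gK sK _ _ _] := gclsP _ _ _ _ _ _ _ KC.
have [g1 s1 _ _ _] := gclsP _ _ _ _ _ _ _ h1.
have [g2 s2 _ _ _] := gclsP _ _ _ _ _ _ _ h2.
have aK : adj (K x) (tau x2) (tau y2) by apply: adj_glue.
have dBA : [disjoint ~: (A :|: im tau) & A :|: im tau] by rewrite disjoint_sym.
have cK : conn (K x :\ [set tau x2; tau y2]) (A :|: im tau) by exact: (glue_conn ti dA h1 b1).
have JC : joined x \in gcls R true p p 0 [set: V].
  rewrite /joined swapC.
  have := swap_gcls dBA b2 aK h2 KC cK.
  by rewrite addn0 setUC setUCr.
have sH : supp (gmap tau H) (im tau).
  by rewrite supp_gmap //; apply/forall_inP => e _; apply: subsetT.
have gT : simple_graph (gmap tau H) by rewrite simple_gmap.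
have aT : adj (gmap tau H) (tau x1) (tau y1) by rewrite adj_gmap.
have inT i : tau i \in im tau by apply: imset_f.
have degT i : degree (joined x) (tau i) = degree H i.
  rewrite (degree_swap dAB sK s2 gK g2 aK b2) ?inE ?inT ?orbT //.
  rewrite /K swapC (degree_swap _ sH s1 gT g1 aT b1) ?inT ?degree_gmap //.
  by rewrite disjoint_sym.
have [gJ _ _ _ _] := gclsP _ _ _ _ _ _ _ JC.
rewrite inE JC /=; apply/andP; split.
  have [i di] := lowH; apply/exists_inP; exists (tau i) => //.
  by rewrite degT.
rewrite inE in_setT /=; apply/forallP => i.
have -> : ball (joined x) s s (tau x1) = ball (joined x) s #|'I_s| (tau x1).
  by rewrite card_ord.
apply: (@ball_hom _ _ _ _ (H :\ [set x1; y1] :\ [set x2; y2])).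
- move=> a b; rewrite !adj_setD1 => /and3P [n2 n1' ab].
  have abT : adj (gmap tau H) (tau a) (tau b) by rewrite adj_gmap.
  have n1t : [set tau a; tau b] != [set tau x1; tau y1].
    by rewrite -!imset_set2; apply: contraNneq n1' => /(imset_inj ti) ->.
  have n2t : [set tau a; tau b] != [set tau x2; tau y2].
    by rewrite -!imset_set2; apply: contraNneq n2 => /(imset_inj ti) ->.
  by rewrite adj_swap n2t /= /K adj_swap n1t abT orbT.
- move=> a; rewrite -degree_nbr // degT degree_nbr //.
  by apply: leq_trans (max_card _) _; rewrite card_ord.
- by apply: connP cH _ _; rewrite inE.
Qed.

(** By [joined_inj] a join is determined by the resulting graph and the placement of the gadget. Any
    of the m + n + s vertices may be the image of [x1]; the rest of the placement lies in a bounded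
    ball around it. *)
Lemma join_count : (m + n + s) ^_ s * ('C(m + n, m) *
  ((cnt R true p p 0 m * m) * (cnt R true p p 0 n * n))) <=
  #|low_gcls [set: V]| * ((m + n + s) * (s.+1 ^ s) ^ s).
Proof.
apply: leq_trans card_tuples _; rewrite -(card_in_imset joined_inj).
apply: leq_trans (@card_dep_le _ _ (low_gcls [set: V])
  (fun G => codes G s x1 [set: V]) _ _).
  by apply: subset_leq_card; apply/subsetP => z /imsetP [x Hx ->]; rewrite inE joined_low.
by move=> G _; apply: leq_trans (card_codes _ _ _ _) _; rewrite cardsT cV.
Qed.

End Count.

End Join.

Lemma gcls_any (R : realType) (V : finType) c (p q : pred nat) (S : {set V}) G :
  G \in gcls R c p p 0 S -> G \in gcls R c p q #|S| S.
Proof.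
case/gclsP=> h1 h2 h3 h4 [h5 _]; apply/gclsP; split=> //; split=> //.
by apply: subset_leq_card; apply/subsetP => v; rewrite inE => /andP [].
Qed.

(** * Inserting a gadget with a forbidden degree *)

Section Insert.
Variables (R : realType) (p q : pred nat) (g : nat) (K : {set {set 'I_g}}).
Variables (x y r : 'I_g).
Hypothesis KC : K \in gcls R true p p 0 [set: 'I_g].
Hypothesis axy : adj K x y.
Hypothesis cK : conn (K :\ [set x; y]) [set: 'I_g].
Hypothesis sr : ~~ q (degree K r).

Let gK : simple_graph K. Proof. by case/gclsP: KC. Qed.

Let KC' : K \in gcls R true p q g [set: 'I_g].
Proof. by have := gcls_any q KC; rewrite cardsT card_ord. Qed.

Section Count.
Variables (V : finType) (n k : nat).
Hypotheses (n1 : 1 < n) (cV : #|V| = n + g).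

Let im (tau : {ffun 'I_g -> V}) : {set V} := tau @: [set: 'I_g].
Let GT := ({set {set V}} * (V * V))%type.

Let tuples : {set {ffun 'I_g -> V} * GT} :=
  [set z : {ffun 'I_g -> V} * GT | (z.1 \in [set f : {ffun 'I_g -> V} | injectiveb f])
    && (z.2 \in rooted (gcls R true p q k (~: im z.1)))].

Let inserted (z : {ffun 'I_g -> V} * GT) : {set {set V}} :=
  swap z.2.1 (gmap z.1 K) z.2.2.1 z.2.2.2 (z.1 x) (z.1 y).

Let special (G : {set {set V}}) : {set V} := [set v | ~~ q (degree G v)].

Let card_tuples : (n + g) ^_ g * (cnt R true p q k n * n) <= #|tuples|.
Proof.
rewrite -{1}cV -{1}(card_ord g) -card_inj_ffuns.
apply: (@card_dep_ge _ _ _ (fun tau => rooted (gcls R true p q k (~: im tau)))) => tau.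
rewrite inE => /injectiveP ti.
have cC : #|~: im tau| = n.
  by rewrite cardsCs setCK cV card_imset // cardsT card_ord addnK.
by have := @card_rooted R p _ q k (~: im tau); rewrite cC; apply.
Qed.

Let facts tau (G1 : {set {set V}}) u v : (tau, (G1, (u, v))) \in tuples ->
  [/\ injective tau, [disjoint ~: im tau & im tau],
      G1 \in gcls R true p q k (~: im tau) & adj G1 u v].
Proof.
rewrite inE /= => /andP [H1 H2]; move: H1 H2; rewrite inE => /injectiveP ti.
rewrite inE /= => /andP [h1]; rewrite inE /= => h2.
by split=> //; rewrite disjoint_sym disjoints_subset setCK.
Qed.

Let facts2 (tau : {ffun 'I_g -> V}) : injective tau ->
  [/\ supp (gmap tau K) (im tau), simple_graph (gmap tau K),
      adj (gmap tau K) (tau x) (tau y) & gmap tau K \in gcls R true p q g (im tau)].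
Proof.
move=> ti; split; rewrite ?simple_gmap ?adj_gmap ?gcls_gmap //.
by rewrite supp_gmap //; apply/forall_inP => e _; apply: subsetT.
Qed.

Let inserted_inj : {in tuples &, injective (fun z => (inserted z, z.1))}.
Proof.
move=> [tau [G1 [u v]]] [tau' [G1' [u' v']]] Hz Hz' [E /= Et]; subst tau'.
have [ti d h1 b1] := facts Hz; have [_ _ h1' b1'] := facts Hz'.
have [s2 g2 b2 _] := facts2 ti.
have [g1 s1 _ _ _] := gclsP _ _ _ _ _ _ _ h1.
have [g1' s1' _ _ _] := gclsP _ _ _ _ _ _ _ h1'.
by have [-> _ -> ->] := swap_inj d s1 s2 s1' s2 g1 g2 g1' g2 b1 b2 b1' b2 E.
Qed.

Let inserted_in z : z \in tuples ->
  (inserted z \in gcls R true p q (k + g) [set: V]) &&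
  (z.1 \in codes (inserted z) g r (special (inserted z))).
Proof.
case: z => tau [G1 [u v]] Hz; set z := (tau, _).
have [ti d h1 b1] := facts Hz; have [s2 g2 b2 h2] := facts2 ti.
have [g1 s1 _ _ _] := gclsP _ _ _ _ _ _ _ h1.
have C : inserted z \in gcls R true p q (k + g) [set: V].
  have all : ~: im tau :|: im tau = [set: V] by rewrite setUC setUCr.
  have := swap_gcls d b1 b2 h1 h2; rewrite all; apply.
  by rewrite -gmap_setD1 // conn_gmap //; apply: simple_sub (subD1set _ _) gK.
have degT i : degree (inserted z) (tau i) = degree K i.
  rewrite /inserted swapC (degree_swap _ s2 s1 g2 g1 b2 b1) ?degree_gmap ?imset_f //.
  by rewrite disjoint_sym.
have [gJ _ _ _ _] := gclsP _ _ _ _ _ _ _ C.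
rewrite C inE inE degT sr /=; apply/forallP => i.
have -> : ball (inserted z) g g (tau r) = ball (inserted z) g #|{: 'I_g}| (tau r).
  by rewrite card_ord.
apply: (@ball_hom _ _ _ _ (K :\ [set x; y])).
- move=> a b; rewrite adj_setD1 => /andP [n2 ab].
  have n2t : [set tau a; tau b] != [set tau x; tau y].
    by rewrite -!imset_set2; apply: contraNneq n2 => /(imset_inj ti) ->.
  by rewrite adj_swap n2t adj_gmap // ab orbT.
- move=> a; rewrite -degree_nbr // degT degree_nbr //.
  by apply: leq_trans (max_card _) _; rewrite card_ord.
- by apply: connP cK _ _; rewrite inE.
Qed.

(** The root [r] has a degree violating [q], so its image is one of at most k + g such vertices of
    the result, while there are at least [n] places for the insertion. The quotient of these two
    numbers is the gain. *)
Lemma insert_count : (n + g) ^_ g * (cnt R true p q k n * n) <=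
  cnt R true p q (k + g) (n + g) * ((k + g) * (g.+1 ^ g) ^ g).
Proof.
apply: leq_trans card_tuples _; rewrite -(card_in_imset inserted_inj).
have -> : cnt R true p q (k + g) (n + g) = #|gcls R true p q (k + g) [set: V]|.
  by rewrite card_gcls cardsT cV.
apply: leq_trans (@card_dep_le _ _ (gcls R true p q (k + g) [set: V])
  (fun G => codes G g r (special G)) _ _).
  by apply: subset_leq_card; apply/subsetP => z /imsetP [t Ht ->]; rewrite inE inserted_in.
move=> G /gclsP [_ _ _ _ [_ sp]]; apply: leq_trans (card_codes _ _ _ _) _.
rewrite leq_mul2r; apply/orP; right; apply: leq_trans sp.
by apply: subset_leq_card; apply/subsetP => v; rewrite !inE.
Qed.

End Count.

End Insert.

(* An edge of a gadget can be made a non-bridge by joining the gadget to H. *)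
Lemma gadget_extend (R : realType) (p : pred nat) (t s : nat)
    (X : {set {set 'I_t}}) (a b r : 'I_t) (H : {set {set 'I_s}}) (x1 y1 x2 y2 : 'I_s) :
  X \in gcls R true p p 0 [set: 'I_t] -> adj X a b ->
  H \in gcls R true p p 0 [set: 'I_s] -> adj H x1 y1 -> adj H x2 y2 ->
  [&& x2 != x1, x2 != y1, y2 != x1 & y2 != y1] ->
  conn (H :\ [set x1; y1] :\ [set x2; y2]) [set: 'I_s] ->
  exists (K : {set {set 'I_(t + s)}}) (x y r' : 'I_(t + s)),
    [/\ K \in gcls R true p p 0 [set: 'I_(t + s)], adj K x y,
        conn (K :\ [set x; y]) [set: 'I_(t + s)] & degree K r' = degree X r].
Proof.
move=> XC ab HC a1 a2 ne cH.
pose f := @lshift t s; pose tau := [ffun i => @rshift t s i].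
have finj : injective f by apply: lshift_inj.
have ti : injective tau by move=> i j; rewrite !ffunE => /rshift_inj.
pose S1 := f @: [set: 'I_t]; pose T := tau @: [set: 'I_s].
have dis : [disjoint S1 & T].
  apply/pred0P => z /=; apply/negP => /andP [/imsetP [i _ ->] /imsetP [j _]].
  by rewrite ffunE => /eqP; rewrite eq_lrshift.
have all : S1 :|: T = [set: 'I_(t + s)].
  apply/setP => z; rewrite !inE -(splitK z); case: (split z) => i /=.
    by rewrite imset_f.
  by apply/orP; right; apply/imsetP; exists i; rewrite ?ffunE.
have C1 : gmap f X \in gcls R true p p 0 S1 by rewrite gcls_gmap.
have b1 : adj (gmap f X) (f a) (f b) by rewrite adj_gmap.
have := glue_gcls HC a1 cH ti dis C1 b1 HC.
have := glue_conn HC a1 ne cH ti dis C1 b1.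
have := adj_glue a2 ne ti (gmap f X) (f a) (f b).
set K := swap _ _ _ _ _ _ => h1 h2 h3.
exists K, (tau x2), (tau y2), (f r); rewrite -all; split=> //.
have [gX suX _ _ _] := gclsP _ _ _ _ _ _ _ C1.
have [gH suH _ _ _] := gclsP _ _ _ _ _ _ _ HC.
have suT : supp (gmap tau H) T by rewrite supp_gmap.
have gT : simple_graph (gmap tau H) by rewrite simple_gmap.
rewrite (degree_swap dis suX suT gX gT b1) ?degree_gmap ?imset_f //.
by rewrite adj_gmap.
Qed.

End Counting.
Import Counting.

(** * Growth rates *)

Module Growth.
Import classical_sets reals exp ring lra zify.
Import Order.TTheory GRing.Theory Num.Theory.
Local Open Scope ring_scope.

Section Growth.
Variable R : realType.
Implicit Types (c k b l : nat -> R).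

Lemma bernoulli (x : R) n : 0 <= x -> 1 + n%:R * x <= (1 + x) ^+ n.
Proof.
move=> x0; elim: n => [|n IH]; first by rewrite mul0r addr0 expr0.
rewrite exprS; have h : (1 + x) * (1 + n%:R * x) <= (1 + x) * (1 + x) ^+ n.
  by rewrite ler_wpM2l // addr_ge0.
apply: le_trans h; rewrite -addn1 natrD mulrDl mul1r.
have : 0 <= n%:R * x ^+ 2 by rewrite mulr_ge0 ?sqr_ge0.
by rewrite expr2; lra.
Qed.

Lemma bernoulli_sub (x : R) n : 0 <= x <= 1 -> 1 - n%:R * x <= (1 - x) ^+ n.
Proof.
move=> /andP [x0 x1]; elim: n => [|n IH]; first by rewrite mul0r subr0 expr0.
rewrite exprS; have h : (1 - x) * (1 - n%:R * x) <= (1 - x) * (1 - x) ^+ n.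
  by rewrite ler_wpM2l // subr_ge0.
apply: le_trans h; rewrite -addn1 natrD mulrDl mul1r.
have : 0 <= n%:R * x ^+ 2 by rewrite mulr_ge0 ?sqr_ge0.
by rewrite expr2; lra.
Qed.

Lemma archi (x : R) : exists n : nat, x <= n%:R.
Proof.
exists (Num.bound `|x|); apply: le_trans (ler_norm x) (ltW _).
exact: archi_boundP.
Qed.

Lemma fin_upper (f : nat -> R) N : exists2 K, 0 < K & forall n, (n < N)%N -> f n <= K.
Proof.
exists (1 + \sum_(i < N) `|f i|); first by rewrite ltr_pwDl // sumr_ge0.
move=> n nN; apply: le_trans (ler_norm _) _.
rewrite (bigD1 (Ordinal nN)) //= addrCA lerDl addr_ge0 ?ler01 // sumr_ge0 //.
Qed.

Lemma fin_lower (f : nat -> R) N : (forall n, (n < N)%N -> 0 < f n) ->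
  exists2 K, 0 < K & forall n, (n < N)%N -> K <= f n.
Proof.
elim: N => [|N IH] H; first by exists 1.
have [|K K0 HK] := IH; first by move=> n nN; apply: H; apply: leqW.
exists (Num.min K (f N)); first by rewrite lt_min K0 H.
move=> n; rewrite ltnS leq_eqVlt => /predU1P [->|nN].
  by rewrite ge_min lexx orbT.
by rewrite ge_min HK.
Qed.

Lemma fact_le n : (n`! <= n ^ n)%N.
Proof.
elim: n => // n IH; rewrite factS expnS leq_mul2l /=.
by apply: leq_trans IH _; case: n => // n; rewrite leq_exp2r.
Qed.

(* Insertion bound with j = m / q, for q a large constant. *)
Lemma insertion_decay c k (g : nat) (U K1 L2 : R) : 0 < U -> 0 < K1 -> 0 < L2 ->
  (forall n, c n <= K1 * U ^+ n) -> (forall n, 0 <= k n) ->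
  (forall m j, (1 < m)%N -> k m * m%:R ^+ j <= c (m + g * j)%N * (L2 ^+ j * (j`!)%:R)) ->
  exists rho K2, [/\ 0 < rho < 1, 0 < K2 & forall m, k m <= K2 * (rho * U) ^+ m].
Proof.
move=> U0 K10 L20 cU k0 Hk.
(* [q] is chosen such that for j = m / q the product U ^ g * L2 * j is at most m / 2: every
   insertion then gains a factor 2. *)
have [q Hq] := archi (2 * (U ^+ g * L2)).
have UL0 : 0 < U ^+ g * L2 by rewrite mulr_gt0 ?exprn_gt0.
have q0 : (0 < q)%N by rewrite lt0n; apply/eqP => E; move: Hq; rewrite E; lra.
have qR : 1 <= q%:R :> R by rewrite ler1n.
have q20 : 0 < 2 * q%:R :> R by lra.
pose e : R := (2 * q%:R)^-1.
have e0 : 0 < e by rewrite invr_gt0.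
have qe : q%:R * e = 1 / 2 by rewrite /e; field; rewrite pnatr_eq0 -lt0n.
have e1 : e <= 1 / 2.
  by rewrite -qe ler_peMl // ltW.
(* By Bernoulli's inequality rho ^ q is at least 1 / 2, which turns (1 / 2) ^ j into at most 2 * rho
   ^ m. *)
pose rho : R := 1 - e.
have rho01 : 0 < rho < 1 by rewrite /rho; apply/andP; split; lra.
have rho0 : 0 < rho by case/andP: rho01.
have rhoq : 1 / 2 <= rho ^+ q.
  have e01 : 0 <= e <= 1 by apply/andP; split; lra.
  by apply: le_trans (bernoulli_sub q e01); rewrite qe; lra.
have [K3 K30 HK3] := fin_upper (fun m => k m / (rho * U) ^+ m) 2.
have rU0 : 0 < rho * U by rewrite mulr_gt0.
have big m : (1 < m)%N -> k m <= 2 * K1 * (rho * U) ^+ m.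
  move=> m1; pose j := (m %/ q)%N.
  have m0 : 0 < m%:R :> R by rewrite ltr0n (ltn_trans _ m1).
  have jm : U ^+ g * L2 * j%:R <= m%:R / 2.
    have : (q%:R * j%:R <= m%:R :> R) by rewrite -natrM ler_nat mulnC leq_trunc_div.
    have : U ^+ g * L2 * j%:R <= q%:R / 2 * j%:R.
      by rewrite ler_wpM2r //; move: Hq; lra.
    by lra.
  have h1 : k m * m%:R ^+ j <= K1 * U ^+ m * (U ^+ g * L2 * j%:R) ^+ j.
    apply: le_trans (Hk m j m1) _.
    apply: le_trans (_ : K1 * U ^+ (m + g * j) * (L2 ^+ j * j%:R ^+ j) <= _).
      apply: le_trans (_ : K1 * U ^+ (m + g * j) * (L2 ^+ j * (j`!)%:R) <= _).
        by rewrite ler_wpM2r // mulr_ge0 // exprn_ge0 // ltW.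
      rewrite ler_wpM2l //; first by rewrite mulr_ge0 ?exprn_ge0 // ltW.
      by rewrite ler_wpM2l ?exprn_ge0 ?(ltW L20) // -natrX ler_nat fact_le.
    by rewrite exprD exprM !exprMn le_eqVlt; apply/orP; left; apply/eqP; ring.
  have h2 : k m <= K1 * U ^+ m * (1 / 2) ^+ j.
    rewrite -(ler_pM2r (exprn_gt0 j m0)); apply: le_trans h1 _.
    rewrite -[X in _ <= X]mulrA -exprMn ler_wpM2l ?mulr_ge0 ?exprn_ge0 ?(ltW K10) ?(ltW U0) //.
    by apply: lerXn2r; rewrite ?nnegrE ?mulr_ge0 ?exprn_ge0 ?(ltW U0) ?(ltW L20) //; move: jm m0; lra.
  have rq : 0 <= rho by apply: ltW.
  have h3 : (1 / 2) ^+ j <= 2 * rho ^+ m.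
    apply: le_trans (_ : rho ^+ (q * j) <= _).
      by rewrite exprM; apply: lerXn2r; rewrite ?nnegrE ?exprn_ge0 // divr_ge0.
    rewrite {1}(divn_eq m q) -/j (mulnC j) exprD.
    have hr : 1 / 2 <= rho ^+ (m %% q).
      apply: le_trans rhoq _; apply: ler_wiXn2l; rewrite ?(ltnW (ltn_pmod _ _)) //.
      by lra.
    have r0 : 0 <= rho ^+ (q * j) by rewrite exprn_ge0.
    have : rho ^+ (q * j) * (1 / 2) <= rho ^+ (q * j) * rho ^+ (m %% q).
      by rewrite ler_wpM2l.
    by rewrite mulrCA; lra.
  apply: le_trans h2 _; rewrite [(rho * U) ^+ m]exprMn.
  have : K1 * U ^+ m * (1 / 2) ^+ j <= K1 * U ^+ m * (2 * rho ^+ m).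
    by rewrite ler_wpM2l // mulr_ge0 ?exprn_ge0 // ltW.
  move/le_trans; apply; rewrite le_eqVlt; apply/orP; left; apply/eqP; ring.
exists rho, (K3 + 2 * K1); split=> //; first by rewrite addr_gt0 // mulr_gt0.
move=> m; have pm : 0 < (rho * U) ^+ m by rewrite exprn_gt0.
have [m2|m2] := ltnP m 2.
  have := HK3 _ m2; rewrite ler_pdivrMr // => /le_trans; apply.
  by rewrite ler_pM2r // lerDl mulr_ge0 // ltW.
apply: le_trans (big _ m2) _; rewrite ler_pM2r //.
by rewrite lerDr ltW.
Qed.

(** The sum is [x] times the derivative of a geometric sum, whose closed form is the identity
    [E]. *)
Lemma sum_geometric_deriv (x : R) n : 0 <= x <= 1 ->
  (1 - x) ^+ 2 * (\sum_(i < n) i.+1%:R * x ^+ i.+1) <= 1.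
Proof.
move=> /andP [x0 x1].
have E : (1 - x) ^+ 2 * (\sum_(i < n) i.+1%:R * x ^+ i) =
         1 - x ^+ n * (n.+1%:R - n%:R * x).
  elim: n => [|n IH]; first by rewrite big_ord0 expr0; ring.
  by rewrite big_ord_recr /= mulrDr IH (exprS x n); ring.
have -> : \sum_(i < n) i.+1%:R * x ^+ i.+1 = x * \sum_(i < n) i.+1%:R * x ^+ i.
  by rewrite mulr_sumr; apply: eq_bigr => i _; rewrite exprS mulrCA.
rewrite mulrCA E; apply: le_trans (_ : x * 1 <= 1); last by rewrite mulr1.
rewrite ler_wpM2l // gerBl mulr_ge0 ?exprn_ge0 // subr_ge0.
apply: le_trans (_ : n%:R <= _); last by rewrite ler_nat.
by rewrite ler_piMr.
Qed.

(** Inserting the bound B * W ^ n into the recursion leaves a series in x = V / W, bounded by K2 /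
    (1 - x) ^ 2. Once n.+1 exceeds this constant, the factor n.+1 on the left absorbs it. So all
    graphs grow no faster than any rate [W] above the rate [V] of the connected ones. *)
Lemma recursion_growth k b (V W K2 : R) : 0 < V -> V < W -> 0 < K2 ->
  (forall m, 0 <= k m) -> (forall m, k m <= K2 * V ^+ m) -> (forall n, 0 <= b n) ->
  (forall n, b n.+1 * n.+1%:R <= \sum_(i < n.+1) i.+1%:R * k i.+1 * b (n - i)%N) ->
  exists2 K3, 0 < K3 & forall n, b n <= K3 * W ^+ n.
Proof.
move=> V0 VW K20 k0 kV b0 rec.
have W0 : 0 < W by apply: lt_trans VW.
pose x := V / W.
have x01 : 0 <= x <= 1.
  by rewrite /x divr_ge0 ?(ltW V0) ?(ltW W0) //= ler_pdivrMr // mul1r ltW.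
have x1 : 0 < (1 - x) ^+ 2.
  by rewrite exprn_gt0 // subr_gt0 /x ltr_pdivrMr // mul1r.
have [N HN] := archi (K2 / (1 - x) ^+ 2).
have [B B0 HB] := fin_upper (fun n => b n / W ^+ n) N.+1.
exists B => // n; have pW m : 0 < W ^+ m by rewrite exprn_gt0.
elim: n {-2}n (leqnn n) => [|m IH] n nm.
  have n0 : n = 0%N by lia.
  by have := HB n; rewrite ler_pdivrMr //; apply; rewrite n0.
have [nN|nN] := ltnP n N.+1.
  by have := HB n nN; rewrite ler_pdivrMr.
case: n nm nN => // n nm nN.
have n1 : 0 < n.+1%:R :> R by rewrite ltr0n.
rewrite -(ler_pM2r n1); apply: le_trans (rec n) _.
apply: le_trans (_ : B * K2 * W ^+ n.+1 * \sum_(i < n.+1) i.+1%:R * x ^+ i.+1 <= _).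
  rewrite mulr_sumr; apply: ler_sum => i _.
  have -> : B * K2 * W ^+ n.+1 * (i.+1%:R * x ^+ i.+1) =
            i.+1%:R * (K2 * V ^+ i.+1) * (B * W ^+ (n - i)).
    have -> : W ^+ n.+1 = W ^+ (i.+1 + (n - i))%N.
      by congr (_ ^+ _); have := ltn_ord i; lia.
    by rewrite /x expr_div_n exprD; field; rewrite expf_neq0 // gt_eqF.
  apply: ler_pM => //; last by apply: IH; lia.
  - by rewrite mulr_ge0.
  - by rewrite ler_wpM2l.
have Sle := sum_geometric_deriv n.+1 x01.
set S := \sum_(i < _) _ in Sle *.
have SN : K2 * S <= n.+1%:R.
  apply: le_trans (_ : N%:R <= _); last by rewrite ler_nat; lia.
  apply: le_trans HN; rewrite ler_wpM2l ?(ltW K20) //.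
  by rewrite -[X in _ <= X]mul1r ler_pdivlMr // mulrC.
have -> : B * K2 * W ^+ n.+1 * S = B * W ^+ n.+1 * (K2 * S) by ring.
by rewrite ler_wpM2l // mulr_ge0 // ltW.
Qed.

Lemma nth_root (a : R) n : 0 <= a -> (0 < n)%N -> exists2 y, 0 <= y & y ^+ n = a.
Proof.
move=> a0 n0; exists (a `^ n%:R^-1); first exact: powR_ge0.
by rewrite -powR_mulrn ?powR_ge0 // -powRrM mulVf ?powRr1 // pnatr_eq0 -lt0n.
Qed.

(* U is the supremum of the (n + s)-th roots of c n / L1; the limit of the roots
   is not needed, since by [low_growth] a single good m serves all large n. *)
Lemma sup_growth c (L1 C : R) s : 1 <= L1 -> 1 <= C ->
  (forall n, 0 <= c n) -> (forall n, c n <= 256%:R * C ^+ n) ->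
  (exists2 n, (1 < n)%N & 0 < c n) ->
  exists U K1, [/\ 0 < U, 0 < K1, forall n, c n <= K1 * U ^+ n &
    forall t, 0 < t < 1 -> exists2 m, (1 < m)%N & L1 * (t * U) ^+ (m + s) <= c m].
Proof.
move=> L11 C1 c0 cC [n1 n11 cn1].
have L10 : 0 < L1 by lra.
pose E : classical_sets.set R :=
  [set x | 0 <= x /\ exists2 n, (1 < n)%N & L1 * x ^+ (n + s) <= c n]%classic.
have Eroot n : (1 < n)%N -> exists2 y, E y & c n = L1 * y ^+ (n + s).
  move=> n2; have [||y y0 yE] := @nth_root (c n / L1) (n + s).
  - by rewrite divr_ge0 // ltW.
  - by lia.
  have Ey : L1 * y ^+ (n + s) = c n by rewrite yE mulrC divfK // gt_eqF.
  by exists y => //; split=> //; exists n => //; rewrite Ey.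
have ubE : ubound E (256%:R * C).
  move=> x [x0 [n n2 h]]; rewrite leNgt; apply/negP => xC.
  have : L1 * x ^+ (n + s) <= 256%:R * C ^+ n by apply: le_trans h _.
  apply/negP; rewrite -ltNge.
  have x1 : 1 <= x by lra.
  have y1 : x ^+ n <= x ^+ (n + s) by rewrite ler_weXn2l // leq_addr.
  have y0 : 0 <= x ^+ (n + s) by rewrite exprn_ge0.
  have y2 : x ^+ (n + s) <= L1 * x ^+ (n + s) by rewrite ler_peMl.
  have y3 : (256%:R * C) ^+ n < x ^+ n.
    have C0 : 0 <= 256%:R * C by rewrite mulr_ge0 //; lra.
    by rewrite ltrXn2r // -lt0n ltnW.
  have y4 : 256%:R * C ^+ n <= (256%:R * C) ^+ n.
    rewrite exprMn ler_wpM2r ?exprn_ge0 //; first by lra.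
    by rewrite -[X in X <= _]expr1 ler_weXn2l ?ler1n // ltnW.
  by apply: lt_le_trans y2; apply: lt_le_trans y1; apply: le_lt_trans y3.
have [y Ey cy] := Eroot n1 n11.
have hE : has_sup E by split; [exists y | exists (256%:R * C)].
have leU x : E x -> x <= sup E by apply: ub_le_sup; case: hE.
have U0 : 0 < sup E.
  apply: lt_le_trans (leU _ Ey); rewrite lt_def; case: Ey => -> _; rewrite andbT.
  by apply: contraTneq cn1 => y0; rewrite cy y0 expr0n addn_eq0 (gtn_eqF (ltnW n11)) /= mulr0 ltxx.
have [K K0 HK] := fin_upper (fun n => c n / sup E ^+ n) 2.
exists (sup E), (K + L1 * sup E ^+ s); split=> //.
- by rewrite addr_gt0 // mulr_gt0 // exprn_gt0.
- move=> n; have p n' : 0 < sup E ^+ n' by rewrite exprn_gt0.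
  have [n2|n2] := ltnP n 2.
    have := HK _ n2; rewrite ler_pdivrMr // => /le_trans; apply.
    by rewrite ler_pM2r // lerDl mulr_ge0 // ltW.
  have [z Ez ->] := Eroot _ n2; rewrite mulrDl -mulrA -exprD (addnC s).
  apply: le_trans (_ : L1 * sup E ^+ (n + s) <= _).
    by rewrite ler_pM2l //; apply: lerXn2r; rewrite ?nnegrE ?(ltW U0) ?leU //; case: Ez.
  by rewrite lerDr mulr_ge0 ?ltW.
move=> t /andP [t0 t1].
have h : 0 < sup E - t * sup E by rewrite subr_gt0 gtr_pMl.
have [x Ex tx] := sup_adherent h hE.
have [x0 [m m2 hm]] := Ex; exists m => //; apply: le_trans hm.
rewrite ler_pM2l //; apply: lerXn2r; rewrite ?nnegrE //; first by rewrite mulr_ge0 ?ltW.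
by apply: ltW; move: tx; rewrite opprB addrC subrK.
Qed.

(** Since c m >= L1 * T ^ (m + s), joining with graphs of order [m] multiplies the count by at least
    T ^ (m + s) while the order grows by m + s. The induction starts from a window of m + s
    consecutive orders where [c] is positive. *)
Lemma low_growth c l (L1 T : R) s m : 0 < L1 -> (1 < m)%N -> 0 < T ->
  L1 * T ^+ (m + s) <= c m ->
  (forall i j, (1 < i)%N -> (1 < j)%N -> c i * c j <= L1 * l (i + j + s)%N) ->
  (forall n, l n <= c n) -> (exists N, forall n, (N <= n)%N -> 0 < c n) ->
  exists2 k, 0 < k & exists N, forall n, (N <= n)%N -> k * T ^+ n <= l n.
Proof.
move=> L10 m1 T0 cm cc lc [N0 HN0]; pose N := maxn N0 2.
have pT n : 0 < T ^+ n by rewrite exprn_gt0.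
have step n : (1 < n)%N -> 0 <= c n -> T ^+ (m + s) * c n <= l (n + (m + s))%N.
  move=> n1 c0; rewrite -(ler_pM2l L10).
  have -> : (n + (m + s))%N = (m + n + s)%N by lia.
  apply: le_trans (cc _ _ m1 n1); rewrite mulrA ler_wpM2r //.
have [k k0 Hk] : exists2 k, 0 < k & forall i, (i < m + s)%N -> k <= c (N + i)%N / T ^+ (N + i).
  apply: (fin_lower (f := fun i => c (N + i)%N / T ^+ (N + i))) => i _.
  by rewrite divr_gt0 ?HN0 //; rewrite /N; lia.
have all n : (N <= n)%N -> k * T ^+ n <= c n.
  elim: n {-2}n (leqnn n) => [|u IH] n nu nN; first by rewrite /N in nN; lia.
  have [h|h] := ltnP n (N + (m + s)).
    have := Hk (n - N)%N; rewrite subnKC // ler_pdivlMr //; apply; lia.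
  have e : n = (n - (m + s) + (m + s))%N by lia.
  apply: le_trans (lc n); rewrite e.
  have h2 : (N <= n - (m + s))%N by lia.
  have h3 := IH (n - (m + s))%N ltac:(lia) h2.
  have c0 : 0 <= c (n - (m + s))%N.
    by apply: le_trans h3; rewrite mulr_ge0 ?ltW.
  apply: le_trans (step _ _ c0); last by rewrite /N in h2; lia.
  by rewrite exprD mulrA mulrC ler_wpM2l // ltW.
exists k => //; exists (N + (m + s))%N => n nN.
have e : n = (n - (m + s) + (m + s))%N by lia.
rewrite e; have h2 : (N <= n - (m + s))%N by lia.
have h3 := all _ h2.
have c0 : 0 <= c (n - (m + s))%N by apply: le_trans h3; rewrite mulr_ge0 ?ltW.
apply: le_trans (step _ _ c0); last by rewrite /N in h2; lia.
by rewrite exprD mulrA mulrC ler_wpM2l // ltW.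
Qed.

Lemma exp_ratio (W T M : R) : 0 < W -> W < T ->
  exists N, forall n, (N <= n)%N -> M * W ^+ n <= T ^+ n.
Proof.
move=> W0 WT; pose x := T / W - 1.
have x0 : 0 < x by rewrite subr_gt0 ltr_pdivlMr // mul1r.
have [N HN] := archi (M / x); exists N => n nN.
have p : 0 < W ^+ n by rewrite exprn_gt0.
rewrite -ler_pdivlMr // -expr_div_n.
have -> : T / W = 1 + x by rewrite addrC subrK.
apply: le_trans (bernoulli n (ltW x0)).
have : M <= N%:R * x by rewrite -ler_pdivrMr.
have : N%:R * x <= n%:R * x by rewrite ler_wpM2r ?(ltW x0) // ler_nat.
by lra.
Qed.

(** The order of the quantifiers is the point: [m] is fixed before [c'] and [l'] are given. A
    sequence counting graphs of bounded degree can then replace [c], provided it is as large at this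
    single [m]. *)
Lemma ratio_limit c k b (L1 L2 C : R) (s g : nat) : 1 <= L1 -> 0 < L2 -> 1 <= C ->
  (forall n, 0 <= c n) -> (forall n, 0 <= k n) -> (forall n, 0 <= b n) ->
  (forall n, c n <= 256%:R * C ^+ n) -> (exists2 n, (1 < n)%N & 0 < c n) ->
  (forall m j, (1 < m)%N -> k m * m%:R ^+ j <= c (m + g * j)%N * (L2 ^+ j * (j`!)%:R)) ->
  (forall n, b n.+1 * n.+1%:R <= \sum_(i < n.+1) i.+1%:R * k i.+1 * b (n - i)%N) ->
  exists2 m, (1 < m)%N & forall c' l' : nat -> R,
    (forall i j, (1 < i)%N -> (1 < j)%N -> c' i * c' j <= L1 * l' (i + j + s)%N) ->
    (forall n, l' n <= c' n) -> (exists N, forall n, (N <= n)%N -> 0 < c' n) ->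
    c m <= c' m -> forall M, exists N, forall n, (N <= n)%N -> M * b n <= l' n.
Proof.
move=> L11 L20 C1 c0 k0 b0 cC cpos ins rec.
have [U [K1 [U0 K10 cU sup]]] := sup_growth s L11 C1 c0 cC cpos.
have [rho [K2 [/andP [r0 r1] K20 kV]]] := insertion_decay U0 K10 L20 cU k0 ins.
(* Three rates are separated: rho * U for the connected graphs counted by [k], [W] for all those
   counted by [b], and t * U for the lower bound on [l']. *)
pose W := (1 + rho) / 2 * U; pose t := (1 + (1 + rho) / 2) / 2.
have VW : rho * U < W by rewrite ltr_pM2r //; lra.
have V0 : 0 < rho * U by rewrite mulr_gt0.
have [K3 K30 bW] := recursion_growth V0 VW K20 k0 kV b0 rec.
have t01 : 0 < t < 1 by rewrite /t; apply/andP; split; lra.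
have WT : W < t * U by rewrite ltr_pM2r // /t; lra.
have [m m1 cm] := sup t t01; exists m => // c' l' cc lc cp cm' M.
have T0 : 0 < t * U by rewrite mulr_gt0 //; case/andP: t01.
have L10 : 0 < L1 by lra.
have [kap kap0 [N1 low]] := low_growth L10 m1 T0 (le_trans cm cm') cc lc cp.
have W0 : 0 < W by apply: lt_trans VW.
have [N2 HN2] := exp_ratio (`|M| * K3 / kap) W0 WT.
exists (maxn N1 N2) => n; rewrite geq_max => /andP [n1 n2].
apply: le_trans (low n n1).
apply: le_trans (_ : `|M| * b n <= _); first by rewrite ler_wpM2r // ler_norm.
apply: le_trans (_ : `|M| * (K3 * W ^+ n) <= _); first by rewrite ler_wpM2l.
have := HN2 n n2; rewrite mulrAC ler_pdivrMr // [X in _ <= X]mulrC.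
by rewrite mulrA.
Qed.
End Growth.

End Growth.
Import Growth.

(** * From counting inequalities to growth rates *)

Module Density.
Import boolp reals zify ring lra.
Import Order.TTheory GRing.Theory Num.Theory.

Definition joinable (R : realType) (p : pred nat) (s : nat) : Prop :=
  exists (H : {set {set 'I_s}}) (x1 y1 x2 y2 : 'I_s),
  [/\ H \in gcls R true p p 0 [set: 'I_s], adj H x1 y1, adj H x2 y2,
      [&& x2 != x1, x2 != y1, y2 != x1 & y2 != y1] &
      conn (H :\ [set x1; y1] :\ [set x2; y2]) [set: 'I_s]] /\
  exists i, degree H i <= 5.

Definition gadget (R : realType) (p q : pred nat) (g : nat) : Prop :=
  exists (K : {set {set 'I_g}}) (x y r : 'I_g),
  [/\ K \in gcls R true p p 0 [set: 'I_g], adj K x y,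
      conn (K :\ [set x; y]) [set: 'I_g] & ~~ q (degree K r)].

Section Bridge.
Variable R : realType.
Implicit Types p q : pred nat.

Definition low p n := #|low_gcls R p [set: 'I_n]|.

Lemma low_cnt p n : low p n <= cnt R true p p 0 n.
Proof. by apply/subset_leq_card/subsetP => G; rewrite inE => /andP []. Qed.

Lemma join_nat p s m n : joinable R p s -> 1 < m -> 1 < n ->
  (m + n + s)`! * (cnt R true p p 0 m * cnt R true p p 0 n) <=
  low p (m + n + s) * (s.+1 * (s.+1 ^ s) ^ s * (m`! * n`!)).
Proof.
case=> H [x1] [y1] [x2] [y2] [[h1 h2 h3 h4 h5] h6] m1 n1.
have := join_count h1 h2 h3 h4 h5 h6 m1 n1 (card_ord (m + n + s)).
rewrite -/(low p _); set N := m + n + s.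
move: (cnt R true p p 0 m) (cnt R true p p 0 n) (low p N) ((s.+1 ^ s) ^ s).
move=> cm cn l B H1.
have fN : N ^_ s * (m + n)`! = N`!.
  by rewrite -(ffact_fact (_ : s <= N)) ?leq_addl // /N addnK.
have fmn : 'C(m + n, m) * (m`! * n`!) = (m + n)`!.
  by rewrite -(bin_fact (leq_addr n m)) addKn.
(* The [N] possible roots of the gadget are paid for by the m * n choices of the two cut edges. *)
have NL : N <= s.+1 * (m * n).
  rewrite /N mulSn; apply: leq_add; last by rewrite leq_pmulr // muln_gt0; lia.
  by case: m n m1 n1 {H1 h1 N fN fmn} => [|[|m]] [|[|n]] // _ _; nia.
have mn0 : 0 < m * n by rewrite muln_gt0; lia.
rewrite -(leq_pmul2r mn0) -fN -fmn.
have -> : N ^_ s * ('C(m + n, m) * (m`! * n`!)) * (cm * cn) * (m * n) =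
   N ^_ s * ('C(m + n, m) * ((cm * m) * (cn * n))) * (m`! * n`!) by ring.
apply: leq_trans (_ : l * (N * B) * (m`! * n`!) <= _); first by rewrite leq_mul2r H1 orbT.
have -> : l * (s.+1 * B * (m`! * n`!)) * (m * n) = l * ((s.+1 * (m * n)) * B) * (m`! * n`!) by ring.
by rewrite leq_mul2r leq_mul2l leq_mul2r NL !orbT.
Qed.

Lemma cnt_all p q k n : cnt R true p q k n <= cnt R true p p 0 n.
Proof.
apply/subset_leq_card/subsetP => G /gclsP [h1 h2 h3 h4 [h5 _]].
apply/gclsP; split=> //; split=> //; rewrite leqn0 cards_eq0; apply/eqP/setP => v.
by rewrite !inE h3.
Qed.

(** Iterates [insert_count]. After i insertions at most g * i vertices violate [q], so the
    ambiguities multiply to a power times j!, against [m] choices each time. *)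
Lemma insert_nat p q g m j : gadget R p q g -> 1 < m ->
  (m + g * j)`! * (cnt R true p q 0 m * m ^ j) <=
  cnt R true p q (g * j) (m + g * j) * (m`! * ((g * (g.+1 ^ g) ^ g) ^ j * j`!)).
Proof.
move=> [K [x [y [r [h1 h2 h3 h4]]]]] m1.
elim: j => [|j IH]; first by rewrite muln0 addn0 !expn0 !muln1 mulnC.
have n1 : 1 < m + g * j by lia.
have := insert_count h1 h2 h3 h4 (g * j) n1 (card_ord (m + g * j + g)).
have -> : g * j.+1 = g * j + g by rewrite mulnS addnC.
rewrite addnA -mulnSr; set N := m + g * j in n1 IH *.
move: (cnt R true p q 0 m) (cnt R true p q (g * j) N) (cnt R true p q _ (N + g)) IH.
move: ((g.+1 ^ g) ^ g) => B a b c IH H.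
have fN : (N + g) ^_ g * N`! = (N + g)`!.
  by rewrite -(ffact_fact (leq_addl N g)) addnK.
rewrite -fN expnS factS expnSr.
have mN : m <= N by rewrite leq_addr.
apply: leq_trans (_ : (N + g) ^_ g * (N`! * (a * m ^ j)) * N <= _).
  have -> : (N + g) ^_ g * N`! * (a * (m * m ^ j)) =
            (N + g) ^_ g * (N`! * (a * m ^ j)) * m by ring.
  by rewrite leq_mul2l mN orbT.
apply: leq_trans (_ : (N + g) ^_ g * (b * (m`! * ((g * B) ^ j * j`!))) * N <= _).
  by rewrite leq_mul2r leq_mul2l IH !orbT.
have -> : (N + g) ^_ g * (b * (m`! * ((g * B) ^ j * j`!))) * N =
          (N + g) ^_ g * (b * N) * (m`! * ((g * B) ^ j * j`!)) by ring.
apply: leq_trans (_ : c * (g * j.+1 * B) * (m`! * ((g * B) ^ j * j`!)) <= _).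
  by rewrite leq_mul2r H orbT.
by rewrite leq_eqVlt; apply/orP; left; apply/eqP; ring.
Qed.

Lemma cnt_small p n : cnt R true p p 0 n <= 2 ^ 8 * (4 * code_bound) ^ n * n`!.
Proof.
have := card_k5_free_graphs [set: 'I_n]; rewrite cardsT card_ord; apply: leq_trans.
apply/subset_leq_card/subsetP => G /gclsP [h1 h2 _ h4 _].
by rewrite inE h1 h2; apply/asboolP; apply: planar_no_k5 h1 h4.
Qed.

Local Open Scope ring_scope.

(** A coefficient of the exponential generating function; binomial factors from the choice of labels
    disappear in this normalisation. *)
Definition egf (f : nat -> nat) (n : nat) : R := (f n)%:R / (n`!)%:R.

Lemma egf_ge0 f n : 0 <= egf f n.
Proof. by rewrite divr_ge0. Qed.

Let fpos n : 0 < (n`!)%:R :> R. Proof. by rewrite ltr0n fact_gt0. Qed.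
Let fne n : (n`!)%:R != 0 :> R. Proof. by rewrite gt_eqF. Qed.

Lemma egf_le f h n : (f n <= h n)%N -> egf f n <= egf h n.
Proof. by move=> fh; rewrite ler_pM2r ?invr_gt0 // ler_nat. Qed.

Lemma join_egf p s m n : joinable R p s -> (1 < m)%N -> (1 < n)%N ->
  egf (cnt R true p p 0) m * egf (cnt R true p p 0) n <=
  (s.+1 * (s.+1 ^ s) ^ s)%N%:R * egf (low p) (m + n + s).
Proof.
move=> J m1 n1; have := join_nat J m1 n1; rewrite -(ler_nat R) !natrM /egf.
move: (cnt R true p p 0 m) (cnt R true p p 0 n) (low p _) ((s.+1 ^ s) ^ s)%N.
move=> cm cn l B h.
have -> : cm%:R / m`!%:R * (cn%:R / n`!%:R) =
  (m + n + s)`!%:R * (cm%:R * cn%:R) / ((m + n + s)`!%:R * (m`!%:R * n`!%:R)) :> R.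
  by field; rewrite !fne.
rewrite ler_pdivrMr ?mulr_gt0 //; apply: le_trans h _.
rewrite le_eqVlt; apply/orP; left; apply/eqP; field; exact: fne.
Qed.

Lemma insert_egf p q g m j : subpred q p -> gadget R p q g -> (1 < m)%N ->
  egf (cnt R true q q 0) m * m%:R ^+ j <=
  egf (cnt R true p p 0) (m + g * j) * ((g * (g.+1 ^ g) ^ g)%N%:R ^+ j * (j`!)%:R).
Proof.
move=> qp G m1; have h := insert_nat j G m1.
have c1 : (cnt R true q q 0 m <= cnt R true p q 0 m)%N by apply: leq_cnt.
have c2 := cnt_all p q (g * j) (m + g * j).
rewrite -(ler_nat R) !natrM !natrX !natrM in h.
apply: le_trans (_ : egf (cnt R true p q 0) m * m%:R ^+ j <= _).
  by rewrite ler_wpM2r ?exprn_ge0 // egf_le.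
apply: le_trans (_ : egf (cnt R true p q (g * j)) (m + g * j) *
  ((g * (g.+1 ^ g) ^ g)%N%:R ^+ j * (j`!)%:R) <= _); last first.
  by rewrite ler_wpM2r ?mulr_ge0 ?exprn_ge0 // egf_le.
rewrite /egf mulrAC ler_pdivrMr // mulrAC; rewrite -[X in _ <= X]mulrA.
rewrite -(ler_pM2l (fpos (m + g * j))); apply: le_trans h _.
rewrite !natrM le_eqVlt; apply/orP; left; apply/eqP; field; exact: fne.
Qed.

Lemma component_egf p n :
  egf (cnt R false p p 0) n.+1 * n.+1%:R <=
  \sum_(i < n.+1) i.+1%:R * egf (cnt R true p p 0) i.+1 *
     egf (cnt R false p p 0) (n - i)%N.
Proof.
have h := cnt_component R p n.
have -> : egf (cnt R false p p 0) n.+1 * n.+1%:R = (cnt R false p p 0 n.+1)%:R / n`!%:R.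
  rewrite /egf factS natrM; field.
  by rewrite fne addrC natr1 pnatr_eq0.
rewrite ler_pdivrMr // mulr_suml.
apply: le_trans (_ : (\sum_(i < n.+1) 'C(n, i) *
    (cnt R true p p 0 i.+1 * cnt R false p p 0 (n - i)))%N%:R <= _).
  by rewrite ler_nat.
rewrite natr_sum; apply: ler_sum => i _; have iN : (i <= n)%N by rewrite -ltnS.
rewrite /egf -(bin_fact iN) factS !natrM.
rewrite le_eqVlt; apply/orP; left; apply/eqP; field.
by rewrite !fne /= addrC natr1 pnatr_eq0.
Qed.

(** As in [ratio_limit], [m] is found before [p'] is chosen: any joinable class [p'], eventually
    nonempty and with at least as many connected graphs of order [m] as [p], outweighs the graphs
    with degrees in [q]. *)
Lemma density p q s g : subpred q p -> gadget R p q g ->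
  (exists2 n, (1 < n)%N & (0 < cnt R true p p 0 n)%N) ->
  exists2 m, (1 < m)%N & forall p', joinable R p' s ->
    (exists N, forall n, (N <= n)%N -> (0 < cnt R true p' p' 0 n)%N) ->
    (cnt R true p p 0 m <= cnt R true p' p' 0 m)%N ->
    forall M : nat, exists N, forall n, (N <= n)%N ->
      (M * cnt R false q q 0 n <= low p' n)%N.
Proof.
move=> qp G [n0 n01 cn0].
pose B := ((s.+1 ^ s) ^ s)%N; pose B' := ((g.+1 ^ g) ^ g)%N.
have B0 : (0 < s.+1 * B)%N by rewrite muln_gt0 /= !expn_gt0.
have g0 : (0 < g)%N by case: G => K [[x lt] _]; apply: leq_ltn_trans lt.
have B'0 : (0 < g * B')%N by rewrite muln_gt0 g0 !expn_gt0.
have C0 : (0 < 4 * code_bound)%N by rewrite muln_gt0 /= /code_bound -lock !expn_gt0.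
have [||||||||||m m1 H] := @ratio_limit R (egf (cnt R true p p 0)) (egf (cnt R true q q 0))
  (egf (cnt R false q q 0)) (s.+1 * B)%N%:R (g * B')%N%:R (4 * code_bound)%N%:R s g.
- by rewrite ler1n.
- by rewrite ltr0n.
- by rewrite ler1n.
- exact: egf_ge0.
- exact: egf_ge0.
- exact: egf_ge0.
- move=> n; rewrite /egf ler_pdivrMr // -natrX -!natrM ler_nat.
  exact: cnt_small.
- by exists n0; rewrite // divr_gt0 // ltr0n.
- by move=> u j u1; apply: insert_egf.
- by move=> u; apply: component_egf.
exists m => // p' J [N HN] cm M.
have [||||N' HN'] := H (egf (cnt R true p' p' 0)) (egf (low p')) _ _ _ _ M%:R.
- by move=> i j i1 j1; apply: join_egf.
- by move=> n; apply: egf_le; apply: low_cnt.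
- by exists N => n nN; rewrite divr_gt0 // ltr0n HN.
- exact: egf_le.
exists N' => n nN; have := HN' n nN; rewrite /egf mulrA ler_pM2r ?invr_gt0 //.
by rewrite -natrM ler_nat.
Qed.

End Bridge.

End Density.
Import Density.

(** * Graphs with bounded degrees *)

Module Classes.
Import boolp reals zify.

(** Joining i graphs of order u and j of order v through gadgets of order s gives order i * (u + s)
    + j * (v + s) - s. As 8 is 1 modulo 7, [j] can be the remainder of n + 4. *)
Lemma span_7_8 n : 100 <= n ->
  exists i j, 1 < i /\ n = i * (3 + 4) + j * (4 + 4) - 4.
Proof. by move=> h; exists ((n + 4) %/ 7 - (n + 4) %% 7), ((n + 4) %% 7); lia. Qed.

Lemma span_8_9 n : 100 <= n ->
  exists i j, 1 < i /\ n = i * (4 + 4) + j * (5 + 4) - 4.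
Proof. by move=> h; exists ((n + 4) %/ 8 - (n + 4) %% 8), ((n + 4) %% 8); lia. Qed.

Lemma span_8_10 n : 100 <= n -> ~~ odd n ->
  exists i j, 1 < i /\ n = i * (4 + 4) + j * (6 + 4) - 4.
Proof.
by move=> h ev; exists ((n + 4) %/ 2 %/ 4 - (n + 4) %/ 2 %% 4), ((n + 4) %/ 2 %% 4); lia.
Qed.

(** Modulo 12, 19 is 7 and 7 is its own inverse; hence the choice of [j]. *)
Lemma span_12_19 n : 400 <= n ->
  exists i j, 1 < i /\ n = i * 12 + j * 19.
Proof.
by move=> h; exists ((n - 19 * ((7 * n) %% 12)) %/ 12), ((7 * n) %% 12); lia.
Qed.

Lemma span_24_38 n : 1000 <= n -> ~~ odd n ->
  exists i j, 1 < i /\ n = i * (12 + 12) + j * (26 + 12) - 12.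
Proof.
move=> h ev; have [|i [j [i1 e]]] := @span_12_19 ((n + 12) %/ 2); first by lia.
by exists i, j; split=> //; lia.
Qed.

Section Concrete.
Variable R : realType.
Implicit Types P : pred nat.

Lemma list_graph_gcls s l cs rm (q : pred nat) P : graph_check s l cs rm q ->
  subpred q P -> list_graph s l \in gcls R true P P 0 [set: 'I_s].
Proof.
case/and4P=> irr pl ord deg qP; have dP := degree_checkP irr deg.
apply/gclsP; split.
- exact: simple_list_graph.
- by apply/forall_inP => e _; apply: subsetT.
- by move=> v _; apply: qP.
- exact: planar_list_graph pl.
split=> [_|]; first by apply: order_checkP ord _ => a b ab _; rewrite adj_list_graph.
rewrite leqn0 cards_eq0; apply/eqP/setP => v; rewrite !inE.
by rewrite (qP _ (dP v)).
Qed.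

Definition join_check (s : nat) (l : seq (nat * nat)) (e f : nat * nat) : bool :=
  [&& all (fun x => x < s) [:: e.1; e.2; f.1; f.2], uniq [:: e.1; e.2; f.1; f.2],
      adjl l e.1 e.2 & adjl l f.1 f.2].

Lemma joinable_list s l cs e f d P : graph_check s l cs [:: e; f] (pred1 d) ->
  join_check s l e f -> d <= 5 -> P d -> joinable R P s.
Proof.
case: e f => [a b] [a' b'] gc /and4P [/= /and5P [h1 h2 h3 h4 _] u ae af] d5 Pd.
have [irr pl ord deg] := and4P gc; have dP := degree_checkP irr deg.
exists (list_graph s l), (Ordinal h1), (Ordinal h2), (Ordinal h3), (Ordinal h4).
split; last by exists (Ordinal h1); rewrite (eqP (dP _)).
split.
- by apply: list_graph_gcls gc _ => _ /eqP ->.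
- by rewrite adj_list_graph.
- by rewrite adj_list_graph.
- move: u; rewrite !inE !negb_or -!(inj_eq val_inj) /=.
  by do 3 rewrite ![_ == a'%N]eq_sym ![_ == b'%N]eq_sym; lia.
apply: order_checkP ord _ => x y xy.
rewrite !adj_setD1 adj_list_graph // xy andbT => h.
apply/andP; split; apply: contraNneq h => /set2_eqP [[-> ->]|[-> ->]];
  by rewrite /adjl !inE eqxx ?orbT.
Qed.

Let pos P n := (1 < n) && (0 < cnt R true P P 0 n).

Lemma list_graph_pos s l cs rm (q : pred nat) P : graph_check s l cs rm q ->
  1 < s -> subpred q P -> pos P s.
Proof.
move=> gc s1 qP; rewrite /pos s1; apply/card_gt0P.
by exists (list_graph s l); apply: list_graph_gcls gc qP.
Qed.

Lemma joinable_low P s m n : joinable R P s -> pos P m -> pos P n ->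
  0 < low R P (m + n + s).
Proof.
move=> J /andP [m1 cm] /andP [n1 cn]; have := join_nat J m1 n1.
rewrite lt0n; apply: contraTneq => ->; rewrite mul0n -ltnNge.
by rewrite !muln_gt0 fact_gt0 cm.
Qed.

Lemma joinable_pos P s m n : joinable R P s -> pos P m -> pos P n ->
  pos P (m + n + s).
Proof.
move=> J pm pn; have := joinable_low J pm pn.
move/leq_trans/(_ (low_cnt _ _ _)); rewrite /pos => ->.
by case/andP: pm => m1 _; rewrite andbT; lia.
Qed.

Lemma span_pos P s u v i j : joinable R P s -> pos P u -> pos P v -> 0 < i + j ->
  pos P (i * (u + s) + j * (v + s) - s).
Proof.
move=> J pu pv; elim: i => [|i IH].
  rewrite mul0n !add0n; elim: j => // -[|j] IH _; first by rewrite mul1n addnK.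
  have -> : j.+2 * (v + s) - s = (j.+1 * (v + s) - s) + v + s by rewrite !mulSn; lia.
  exact: joinable_pos J (IH isT) pv.
case: (posnP (i + j)) => [ij|ij] _.
  have [-> ->] : i = 0 /\ j = 0 by lia.
  by rewrite mul1n mul0n addn0 addnK.
have -> : i.+1 * (u + s) + j * (v + s) - s = i * (u + s) + j * (v + s) - s + u + s.
  suff : s <= i * (u + s) + j * (v + s) by rewrite mulSn; lia.
  case: i ij {IH} => [|i] ij; last by rewrite mulSn; lia.
  by case: j ij => // j _; rewrite mulSn; lia.
exact: joinable_pos J (IH ij) pu.
Qed.

(** With i > 1 the last step is a join, and the joining gadget brings a vertex of degree at most
    5. *)
Lemma span_low P s u v i j : joinable R P s -> pos P u -> pos P v -> 1 < i ->
  0 < low R P (i * (u + s) + j * (v + s) - s).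
Proof.
case: i => [|[|i]] // J pu pv _.
have p : pos P (i.+1 * (u + s) + j * (v + s) - s) by apply: span_pos.
have -> : i.+2 * (u + s) + j * (v + s) - s = i.+1 * (u + s) + j * (v + s) - s + u + s.
  by rewrite !mulSn; lia.
exact: joinable_low J p pu.
Qed.

Definition between d D : pred nat := fun x => d <= x <= D.

(** The building blocks follow the least degree: the triangle and K_4 up to 2, K_4 with the 4-wheel
    or the prism for 3, the octahedron and [o13_edges] for 4, the icosahedron and [r26_edges] for 5.
    The excluded pairs are those forcing a regular graph of odd degree, whose order is even. *)
Lemma exists_low d D : d <= 5 -> 3 <= D -> d <= D -> exists N, forall n, N <= n ->
  (odd n -> (d, D) \notin [:: (3, 3); (5, 5)]) -> 0 < low R (between d D) n.
Proof.
move=> d5 D3 dD; set P := between d D.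
have [[ck3 _] [[ck4 cocta cico] [cw4 cprism co13 cr26 cz15]]] := checks.
have J4 h : joinable R P 4 := @joinable_list 4 _ _ _ _ 3 P ck4 isT isT h.
have J6 h : joinable R P 6 := @joinable_list 6 _ _ _ _ 4 P cocta isT isT h.
have J12 h : joinable R P 12 := @joinable_list 12 _ _ _ _ 5 P cico isT isT h.
have sub1 k : P k -> subpred (pred1 k) P by move=> Pk _ /eqP ->.
have sub2 k : P k -> P k.+1 -> subpred (fun x => k <= x <= k.+1) P.
  move=> Pk Pk' x /andP [kx xk]; have [-> //|ne] := eqVneq x k.
  by have -> : x = k.+1 by apply/eqP; rewrite eqn_leq xk ltn_neqAle eq_sym ne.
have p3 h2 : pos P 3 := list_graph_pos ck3 isT (sub1 2 h2).
have p4 h3 : pos P 4 := list_graph_pos ck4 isT (sub1 3 h3).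
have p5 h3 h4 : pos P 5 := list_graph_pos cw4 isT (sub2 3 h3 h4).
have p6 h3 : pos P 6 := list_graph_pos cprism isT (sub1 3 h3).
have p6' h4 : pos P 6 := list_graph_pos cocta isT (sub1 4 h4).
have p13 h4 : pos P 13 := list_graph_pos co13 isT (sub1 4 h4).
have p12 h5 : pos P 12 := list_graph_pos cico isT (sub1 5 h5).
have p26 h5 : pos P 26 := list_graph_pos cr26 isT (sub1 5 h5).
have p15 h5 h6 : pos P 15 := list_graph_pos cz15 isT (sub2 5 h5 h6).
clear ck3 ck4 cocta cico cw4 cprism co13 cr26 cz15.
have PE x : P x = (d <= x <= D) by [].
have inP x : d <= x -> x <= D -> P x by move=> h h'; rewrite PE h h'.
have [d2|d2] := leqP d 2.
  exists 100 => n nN _; have P2 : P 2 := inP 2 d2 (ltnW D3).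
  have P3 : P 3 := inP 3 (leqW d2) D3.
  have [i [j [i1 ->]]] := span_7_8 nN.
  exact: span_low (J4 P3) (p3 P2) (p4 P3) i1.
have [d3|d3] := leqP d 3.
  have P3 : P 3 := inP 3 d3 D3.
  have [D4|D4] := leqP 4 D.
    exists 100 => n nN _; have P4 : P 4 := inP 4 (leqW d3) D4.
    have [i [j [i1 ->]]] := span_8_9 nN.
    exact: span_low (J4 P3) (p4 P3) (p5 P3 P4) i1.
  exists 100 => n nN h.
  have ev : ~~ odd n.
    apply/negP => /h; rewrite inE.
    have -> : d = 3 by apply/eqP; rewrite eqn_leq d3.
    have -> : D = 3 by apply/eqP; rewrite eqn_leq D3 andbT.
    by rewrite eqxx.
  have [i [j [i1 ->]]] := span_8_10 nN ev.
  exact: span_low (J4 P3) (p4 P3) (p6 P3) i1.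
have [d4|d4] := leqP d 4.
  have P4 : P 4 := inP 4 d4 (leq_trans d3 dD).
  exists 400 => n nN _.
  have nN' : 400 <= n + 6 by apply: leq_trans nN (leq_addr _ _).
  have [i [j [i1 e]]] := span_12_19 nN'.
  have -> : n = i * (6 + 6) + j * (13 + 6) - 6 by rewrite -e addnK.
  exact: span_low (J6 P4) (p6' P4) (p13 P4) i1.
have P5 : P 5 := inP 5 d5 (leq_trans d4 dD).
exists 2000 => n nN h; case on : (odd n); last first.
  have [||i [j [i1 ->]]] := @span_24_38 n; [by apply: leq_trans nN|by rewrite on|].
  exact: span_low (J12 P5) (p12 P5) (p26 P5) i1.
have P6 : P 6.
  apply: (inP 6 (leqW d5)); rewrite ltn_neqAle (leq_trans d4 dD) andbT.
  apply: contraTneq (h on) => <-.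
  have -> : d = 5 by apply/eqP; rewrite eqn_leq d5.
  by rewrite !inE eqxx orbT.
(* 27 = 15 + 12: an odd order is reached by one copy of [z15_edges] joined through an
   icosahedron. *)
have n27 : 27 <= n by apply: leq_trans nN.
have [||i [j [i1 e]]] := @span_24_38 (n - 27).
- by rewrite leq_subRL //; apply: leq_trans nN.
- by rewrite oddB // on.
have -> : n = (n - 27) + 15 + 12 by rewrite -addnA subnK.
apply: joinable_low (J12 P5) _ (p15 P5 P6); rewrite e.
by apply: span_pos (J12 P5) (p12 P5) (p26 P5) _; rewrite addn_gt0 (ltnW i1).
Qed.

End Concrete.

Lemma adj_rgraph_or (V : finType) (e : rel V) x y :
  adj (rgraph e) x y = e x y || e y x.
Proof.
apply/imsetP/orP => [[[a b]]|].
  by rewrite inE /= => h /set2_eqP [[-> ->]|[-> ->]]; [left|right].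
by case=> h; [exists (x, y)|exists (y, x)]; rewrite ?inE // setUC.
Qed.

Lemma simple_rgraph (V : finType) (e : rel V) : irreflexive e -> simple_graph (rgraph e).
Proof.
move=> ie; apply/forall_inP => f /imsetP [[a b]]; rewrite inE /= => h ->.
by rewrite cards2; have [E|//] := eqVneq a b; rewrite E ie in h.
Qed.

(* No small graph has degrees at least 5 and a prescribed maximum degree D; the
   hub, a vertex joined to D copies of Z, realizes it. *)
Section Hub.
Variables (R : realType) (T : finType) (Z : {set {set T}}) (z w : T) (D : nat).
Hypotheses (sZ : simple_graph Z) (zw : z != w) (nzw : ~~ adj Z z w).
Hypothesis (plZ : planar R ([set z; w] |: Z)).
Hypothesis (cZ : conn Z [set: T]).

Let U : finType := option ('I_D * T).

Definition hub_rel : rel U := fun u v => match u, v with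
  | Some (i, a), Some (i', b) => (i == i') && adj Z a b
  | None, Some (i, a) => a == w
  | _, _ => false
  end.

Definition hub : {set {set U}} := rgraph hub_rel.

Lemma simple_hub : simple_graph hub.
Proof.
apply: simple_rgraph => -[[i a]|] //=; rewrite eqxx /=.
by apply/negP => /(simple_neq sZ); rewrite eqxx.
Qed.

Lemma adj_hub_copy i a i' b : adj hub (Some (i, a)) (Some (i', b)) = (i == i') && adj Z a b.
Proof. by rewrite adj_rgraph_or /= (eq_sym i') (adjC Z b) orbb. Qed.

Lemma adj_hub_root i a : adj hub None (Some (i, a)) = (a == w).
Proof. by rewrite adj_rgraph_or /= orbF. Qed.

Lemma adj_hub_rootN : adj hub None None = false.
Proof. by rewrite adj_rgraph_or. Qed.

Lemma degree_hub_root : degree hub None = D.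
Proof.
rewrite (degree_nbr _ simple_hub).
have inj : injective (fun i : 'I_D => Some (i, w)) by move=> i j [].
rewrite -[RHS]card_ord -(card_imset predT inj); apply: eq_card => -[[i a]|].
  rewrite inE adj_hub_root; apply/eqP/imsetP => [->|[j _ [_ ->]]] //.
  by exists i.
by rewrite inE adj_hub_rootN; apply/esym/negP => /imsetP [].
Qed.

Lemma degree_hub_copy i a : degree hub (Some (i, a)) = degree Z a + (a == w).
Proof.
rewrite (degree_nbr _ simple_hub) (degree_nbr _ sZ).
pose cp b : U := Some (i, b).
have inj : injective cp by move=> b c [].
rewrite -(card_imset (nbr Z a) inj).
pose A : {set U} := if a == w then [set None] else set0.
have -> : nbr hub (Some (i, a)) = cp @: nbr Z a :|: A.
  apply/setP => -[[j b]|]; rewrite inE in_setU.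
    rewrite adj_hub_copy; have -> : (Some (j, b) \in A) = false.
      by rewrite /A; case: ifP; rewrite ?inE.
    rewrite orbF; apply/andP/imsetP => [[/eqP <- ab]|[c]].
      by exists b; rewrite ?inE.
    by rewrite inE => ac [Ej Eb]; rewrite Ej Eb eqxx.
  rewrite adjC adj_hub_root; have -> : (None \in cp @: nbr Z a) = false.
    by apply/negP => /imsetP [].
  by rewrite /A; case: eqP; rewrite ?inE.
rewrite cardsU; have -> : cp @: nbr Z a :&: A = set0.
  apply/setP => u; rewrite in_setI inE; apply/negP => /andP [/imsetP [b _ ->]].
  by rewrite /A; case: ifP; rewrite inE.
by rewrite cards0 subn0 /A; case: eqP; rewrite ?cards1 ?cards0.
Qed.

Lemma conn_hub : conn hub [set: U].
Proof.
apply: (@conn_root _ _ _ None) => -[[i a]|] _; last exact: connect0.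
apply: connect_trans (connect1 (_ : adj hub None (Some (i, w)))) _.
  by rewrite adj_hub_root.
have := connP cZ (in_setT w) (in_setT a).
case/connectP=> p; elim: p w => [|b p IH] c /= => [_ -> //|/andP [cb pp] E].
apply: connect_trans (connect1 _) (IH _ pp E).
by rewrite adj_hub_copy eqxx.
Qed.

(* Planarity: start from a star and replace its leaves one at a time, swapping
   the edge at the leaf with the edge zw of a copy. *)
Let W : finType := option ('I_D * option T).

Let part (j : nat) : rel W := fun u v => match u, v with
  | Some (i, Some a), Some (i', Some b) => [&& i == i', i < j & adj Z a b]
  | None, Some (i, Some a) => (i < j) && (a == w)
  | None, Some (i, None) => j <= i
  | _, _ => false
  end.

Let simple_part j : simple_graph (rgraph (part j)).
Proof.
apply: simple_rgraph => -[[i [a|]]|] //=; rewrite eqxx /=.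
by apply/negP => /andP [_ /(simple_neq sZ)]; rewrite eqxx.
Qed.

Let planar_part0 : planar R (rgraph (part 0)).
Proof.
pose L : {set W} := [set u | u != None].
have nL : None \notin L by rewrite inE.
apply: planar_sub (planar_star R nL); apply/subsetP => e /imsetP [[u v]].
rewrite inE /= => h ->; rewrite -/(adj _ u v) adj_star //; apply/orP; left.
by case: u v h => [[i [a|]]|] [[i' [b|]]|] //=; rewrite ?ltn0 ?andbF // inE.
Qed.

Let planar_partS j : j < D -> planar R (rgraph (part j)) -> planar R (rgraph (part j.+1)).
Proof.
move=> jD pl; pose f (a : T) : W := Some (Ordinal jD, Some a).
have finj : injective f by move=> a b [].
pose G2 := gmap f ([set z; w] |: Z).
pose S2 : {set W} := f @: [set: T].
have s2 : supp G2 S2 by rewrite supp_gmap //; apply/forall_inP => e _; apply: subsetT.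
have gZ : simple_graph ([set z; w] |: Z).
  by apply/forall_inP => e /setU1P [->|/(forall_inP sZ) //]; rewrite cards2 zw.
have g2 : simple_graph G2 by rewrite simple_gmap.
have s1 : supp (rgraph (part j)) (~: S2).
  have nf (i : 'I_D) (b : T) : (i < j) -> (Some (i, Some b) : W) \in ~: S2.
    by move=> ij; rewrite inE; apply/imsetP => -[c _ [E _]]; rewrite E /= ltnn in ij.
  have nN : None \in ~: S2 by rewrite inE; apply/imsetP => -[].
  have nl (i : 'I_D) : (Some (i, None) : W) \in ~: S2 by rewrite inE; apply/imsetP => -[].
  apply/forall_inP => e /imsetP [[u v]]; rewrite inE /= => h ->.
  rewrite subUset !sub1set; apply/andP.
  case: u v h => [[i [a|]]|] [[i' [b|]]|] //=.
  - by case/and3P=> /eqP <- ij _; rewrite !nf.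
  - by case/andP=> ij _; rewrite nf.
have dis : [disjoint ~: S2 & S2] by rewrite disjoint_sym disjoints_subset setCK.
have a1 : adj (rgraph (part j)) None (Some (Ordinal jD, None)).
  by rewrite adj_rgraph_or /= leqnn.
have a2 : adj G2 (f w) (f z) by rewrite adj_gmap // adjC /adj setU11.
have plG2 : planar R G2 by apply: planar_gmap.
(* The swap creates an edge from the hub to [w] and one from the old leaf to [z]; the subgraph taken
   next drops the latter. *)
have := planar_swap dis s1 s2 (simple_part j) g2 a1 a2 pl plG2.
apply: planar_sub; apply/subsetP => e /imsetP [[u v]]; rewrite inE /= => h ->.
rewrite -/(adj _ u v) adj_swap adj_rgraph_or.
case: u v h => [[i [a|]]|] [[i' [b|]]|] //=.
- case/and3P=> /eqP <- ij ab; rewrite eqxx ab andbT /=.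
  have [ij'|ji] := ltnP i j.
    apply/orP; left; rewrite andbT; apply/eqP => /set2_eqP [[]|[]] //.
  have -> : i = Ordinal jD by apply/val_inj/eqP; rewrite /= eqn_leq ji -ltnS ij.
  apply/orP; right; apply/orP; left; rewrite -/(f a) -/(f b) adj_gmap //.
  rewrite [X in _ && X]/adj in_setU1 -/(adj Z a b) ab orbT andbT.
  rewrite -!imset_set2; apply: contraNneq nzw => /(imset_inj finj) E.
  by rewrite adjC /adj -E.
- case/andP=> ij /eqP ->; rewrite eqxx andbT.
  have [ij'|ji] := ltnP i' j.
    by apply/orP; left; rewrite andbT; apply/eqP => /set2_eqP [[]|[]].
  have -> : i' = Ordinal jD by apply/val_inj/eqP; rewrite /= eqn_leq ji -ltnS ij.
  by rewrite /f eqxx !orbT.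
- move=> ji; apply/orP; left; rewrite (ltnW ji) andbT.
  apply/eqP => /set2_eqP [[_ [E]]|[]] //.
  by rewrite E /= ltnn in ji.
Qed.

Let planar_part j : j <= D -> planar R (rgraph (part j)).
Proof.
by elim: j => [|j IH] jD; [apply: planar_part0|apply/planar_partS/IH/ltnW].
Qed.

Lemma planar_hub : planar R hub.
Proof.
pose f (u : U) : W := if u is Some (i, a) then Some (i, Some a) else None.
have finj : injective f by move=> [[i a]|] [[j b]|] //= [-> ->].
apply: (planar_gmap_inv finj); apply: planar_sub (planar_part (leqnn D)).
apply/subsetP => e /imsetP [e' /imsetP [[u v]]]; rewrite inE /= => h -> ->.
rewrite imset_set2 -/(adj _ (f u) (f v)) adj_rgraph_or; apply/orP; left.
by case: u v h => [[i a]|] [[j b]|] //=; rewrite ltn_ord.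
Qed.

End Hub.

(** * Gadgets containing a prescribed degree *)

Section Gadgets.
Variable R : realType.
Implicit Types P q : pred nat.

Definition has_degree P k : Prop := exists t (X : {set {set 'I_t}}) (a b r : 'I_t),
  [/\ X \in gcls R true P P 0 [set: 'I_t], adj X a b & degree X r = k].

Lemma has_degree_gadget P q k s : has_degree P k -> joinable R P s -> ~~ q k ->
  exists g, gadget R P q g.
Proof.
move=> [t [X [a [b [r [h1 h2 h3]]]]]] [H [x1 [y1 [x2 [y2 [[k1 k2 k3 k4 k5] _]]]]]] qk.
have [K [x [y [r' [j1 j2 j3 j4]]]]] := gadget_extend r h1 h2 k1 k2 k3 k4 k5.
by exists (t + s), K, x, y, r'; split=> //; rewrite j4 h3.
Qed.

Lemma list_graph_has_degree s l cs rm q P (a b r : nat) : graph_check s l cs rm q ->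
  subpred q P -> [&& a < s, b < s & r < s] -> adjl l a b ->
  has_degree P (count (adjl l r) (iota 0 s)).
Proof.
move=> gc qP /and3P [aS bS rS] ab; have [irr _ _ _] := and4P gc.
exists s, (list_graph s l), (Ordinal aS), (Ordinal bS), (Ordinal rS); split.
- exact: list_graph_gcls gc qP.
- by rewrite adj_list_graph.
by rewrite degree_list_graph.
Qed.

Lemma has_degree_on (V : finType) (G : {set {set V}}) a b r k P :
  G \in gcls R true P P 0 [set: V] -> adj G a b -> degree G r = k -> has_degree P k.
Proof.
move=> GC ab rk; pose f := @enum_rank V.
have finj : injective f by apply: enum_rank_inj.
have fT : f @: [set: V] = [set: 'I_#|V|].
  apply/setP => i; rewrite inE; apply/imsetP; exists (enum_val i); rewrite ?inE //.
  by rewrite /f enum_valK.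
exists _, (gmap f G), (f a), (f b), (f r).
by rewrite -fT gcls_gmap // adj_gmap // degree_gmap.
Qed.

(** Deleting this edge lowers the degree of vertex 0 from 6 to 5 and leaves room at vertex 8 for the
    edge to the hub. *)
Definition z15_minus := rem (0, 8) z15_edges.

Lemma z15_minus_check :
  [/\ all (fun e => e.1 != e.2) z15_minus, order_check 15 z15_minus [::],
      ~~ adjl z15_minus 0 8,
      adjl z15_edges 0 8 && all (fun e => e \in z15_edges) z15_minus &
      all (fun i => 5 <= count (adjl z15_minus i) (iota 0 15) + (i == 8) <= 6) (iota 0 15)].
Proof. by vm_compute. Qed.

Lemma hub_has_degree P D : 6 <= D -> P 5 -> P 6 -> P D -> has_degree P D.
Proof.
move=> D6 P5 P6 PD; have [irr ord n08 /andP [a08 sub] deg] := z15_minus_check.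
have [_ [_ [_ _ _ _ /and4P [irr' pl _ _]]]] := checks.
pose Z := list_graph 15 z15_minus.
pose z : 'I_15 := inord 0; pose w : 'I_15 := inord 8.
have vz : z = 0 :> nat by rewrite inordK.
have vw : w = 8 :> nat by rewrite inordK.
have adjE l : adj (list_graph 15 l) z w = adjl l 0 8.
  by rewrite adj_list_graph vz vw.
have sZ : simple_graph Z := simple_list_graph 15 irr.
have zw : z != w by rewrite -(inj_eq val_inj) [val z]vz [val w]vw.
have nzw : ~~ adj Z z w by rewrite adjE.
have plZ : planar R ([set z; w] |: Z).
  apply: planar_sub (planar_list_graph irr' R pl); apply/subsetP => e /setU1P [->|].
    by rewrite -/(adj _ z w) adjE.
  case/imsetP=> [[a b]]; rewrite inE => /= ab ->.
  rewrite -/(adj _ a b) adj_list_graph.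
  by case/orP: ab => /(allP sub) h; rewrite /adjl h ?orbT.
have cZ : conn Z [set: 'I_15].
  by apply: order_checkP ord _ => a b ab _; rewrite adj_list_graph.
have sH := simple_hub w D sZ; pose H := hub Z w D.
have degH v : P (degree H v).
  case: v => [[i a]|]; last by rewrite degree_hub_root.
  rewrite (degree_hub_copy _ sZ) (degree_list_graph irr).
  have ai : (a : nat) \in iota 0 15 by rewrite mem_iota /=.
  have -> : (a == w) = ((a : nat) == 8) by rewrite -(inj_eq val_inj) [val w]vw.
  have /andP [h5 h6] := allP deg _ ai.
  move: (_ + _) h5 h6 => m; rewrite leq_eqVlt => /predU1P [<- //|m5] m6.
  by have -> : m = 6 by apply/eqP; rewrite eqn_leq m6.
have D0 : 0 < D by apply: leq_trans D6.
apply: (@has_degree_on _ H None (Some (Ordinal D0, w)) None).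
- apply/gclsP; split.
  + exact: sH.
  + by apply/forall_inP => e _; apply: subsetT.
  + by move=> v _; apply: degH.
  + exact: planar_hub D sZ zw nzw plZ.
  split=> [_|]; first exact: conn_hub w D cZ.
  by rewrite leqn0 cards_eq0; apply/eqP/setP => v; rewrite !inE degH.
- by rewrite /H adj_hub_root.
exact: degree_hub_root.
Qed.

(** The orders of K_4, the octahedron and the icosahedron, which are regular of degree 3, 4 and
    5. *)
Definition join_size d := if d <= 3 then 4 else if d <= 4 then 6 else 12.

Lemma joinable_size P d : d <= 5 -> P (maxn d 3) -> joinable R P (join_size d).
Proof.
have [[_ _] [[ck4 cocta cico] _]] := checks.
move=> d5; rewrite /join_size; have [d3|d3] := leqP d 3.
  by move=> P3; exact: (@joinable_list R 4 _ _ _ _ 3 P ck4 isT isT).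
have [d4|d4] := leqP d 4.
  have -> : d = 4 by apply/eqP; rewrite eqn_leq d4.
  by move=> P4; exact: (@joinable_list R 6 _ _ _ _ 4 P cocta isT isT).
have -> : d = 5 by apply/eqP; rewrite eqn_leq d5.
by move=> P5; exact: (@joinable_list R 12 _ _ _ _ 5 P cico isT isT).
Qed.

(** The degrees 1 to 4 are provided by the pendant vertex of the paw, the triangle, K_4 and the
    octahedron, each extended by the joining gadget to have a non-bridge. *)
Lemma min_gadget P q d : 0 < d <= 4 -> (forall x, d <= x <= maxn d 3 -> P x) ->
  ~~ q d -> exists g, gadget R P q g.
Proof.
move=> d4 Pd qd; have J : joinable R P (join_size d).
  apply: joinable_size; first by case/andP: d4 => _ /leqW.
  by apply: Pd; rewrite leq_maxl leqnn.
suff h : has_degree P d by apply: has_degree_gadget h J qd.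
have sub : subpred (pred1 d) P by move=> _ /eqP ->; apply: Pd; rewrite leqnn leq_maxl.
have subp : d = 1 -> subpred (fun x => 1 <= x <= 3) P.
  by move=> d1 x h; apply: Pd; rewrite d1.
case: d d4 sub subp {Pd qd J} => [|[|[|[|[|]]]]] // _ sub subp;
  have [[ck3 cpaw] [[ck4 cocta _] _]] := checks.
- exact: (@list_graph_has_degree _ _ _ _ _ _ 0 1 3 cpaw (subp erefl) isT isT).
- exact: (@list_graph_has_degree _ _ _ _ _ _ 0 1 0 ck3 sub isT isT).
- exact: (@list_graph_has_degree _ _ _ _ _ _ 0 1 0 ck4 sub isT isT).
- exact: (@list_graph_has_degree _ _ _ _ _ _ 0 1 0 cocta sub isT isT).
Qed.

Lemma regular_has_degree P k : 3 <= k <= 5 -> P k -> has_degree P k.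
Proof.
move=> k35 Pk; have sub : subpred (pred1 k) P by move=> _ /eqP ->.
case: k k35 sub {Pk} => [|[|[|[|[|[|k]]]]]] // _ sub;
  have [_ [[ck4 cocta cico] _]] := checks.
- exact: (@list_graph_has_degree _ _ _ _ _ _ 0 1 0 ck4 sub isT isT).
- exact: (@list_graph_has_degree _ _ _ _ _ _ 0 1 0 cocta sub isT isT).
- exact: (@list_graph_has_degree _ _ _ _ _ _ 0 1 0 cico sub isT isT).
Qed.

(** Degrees up to 5 come from regular graphs. From 6 on the hub is used, whose copies have degrees 5
    and 6, both then allowed. *)
Lemma max_gadget d k : 2 <= k -> d <= k -> d <= 5 ->
  exists g, gadget R (between d k.+1) (between d k) g.
Proof.
move=> k2 dk d5; have J : joinable R (between d k.+1) (join_size d).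
  by apply: joinable_size; rewrite // /between leq_maxl geq_max ltnW.
suff h : has_degree (between d k.+1) k.+1.
  by apply: has_degree_gadget h J _; rewrite /between ltnn andbF.
have Pk : between d k.+1 k.+1 by rewrite /between leqnn leqW.
have [k4|k5] := leqP k 4; first by apply: regular_has_degree; rewrite // ltnS k2.
by apply: hub_has_degree => //; rewrite /between ?d5 // ltnS ltnW.
Qed.

End Gadgets.

Lemma eventually_all (B : nat) (Q : nat -> nat -> Prop) :
  (forall i, i < B -> exists N, forall n, N <= n -> Q i n) ->
  exists N, forall n, N <= n -> forall i, i < B -> Q i n.
Proof.
elim: B => [|B IH] H; first by exists 0.
have [|N HN] := IH; first by move=> i iB; apply: H; apply: leqW.
have [N' HN'] := H B (leqnn _).
exists (maxn N N') => n; rewrite geq_max => /andP [h h'] i.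
by rewrite ltnS leq_eqVlt => /predU1P [->|iB]; [apply: HN'|apply: HN].
Qed.

(** * Comparison of neighbouring degree classes *)

Section Negligible.
Variable R : realType.

Lemma between_sub d d' D D' : d' <= d -> D <= D' -> subpred (between d D) (between d' D').
Proof. by move=> h h' x /andP [xd xD]; rewrite /between (leq_trans h) // (leq_trans xD). Qed.

Lemma low_sub (p q : pred nat) n : subpred p q -> low R p n <= low R q n.
Proof.
move=> pq; apply/subset_leq_card/subsetP => G; rewrite inE => /andP [h lw].
rewrite inE lw andbT.
have [h1 h2 h3 h4 [h5 h6]] := gclsP _ _ _ _ _ _ _ h.
apply/gclsP; split=> //; first by move=> v /h3 /pq.
split=> //; rewrite leqn0 cards_eq0; apply/eqP/setP => v.
by rewrite !inE (pq _ (h3 v _)) ?inE.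
Qed.

(** One threshold serves all [D]: for [D] above 6 the class contains the one with upper bound 6,
    which is never an exceptional pair, so finitely many pairs remain. *)
Lemma low_nonempty : exists N, forall n, N <= n -> forall d D, d <= 5 -> 3 <= D ->
  d <= D -> (odd n -> (d, D) \notin [:: (3, 3); (5, 5)]) -> 0 < low R (between d D) n.
Proof.
have [N HN] : exists N, forall n, N <= n -> forall d, d < 6 -> forall D, D < 7 ->
    3 <= D -> d <= D -> (odd n -> (d, D) \notin [:: (3, 3); (5, 5)]) ->
    0 < low R (between d D) n.
  apply: eventually_all => d d5; apply: eventually_all => D D6.
  have [/andP [D3 dD]|bad] := boolP ((3 <= D) && (d <= D)).
    by have [N HN] := exists_low R d5 D3 dD; exists N => n nN _ _; apply: HN.
  by exists 0 => n _ h h'; rewrite h h' in bad.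
exists N => n nN d D d5 D3 dD par; have [D6|D6] := leqP D 6; first exact: HN.
apply: leq_trans (low_sub n (between_sub (leqnn d) (ltnW D6))).
apply: HN => //; first by apply: leqW.
by move=> _; rewrite !inE !xpair_eqE !andbF.
Qed.

Lemma cnt_between_pos d D : d <= 5 -> 3 <= D -> d <= D ->
  exists N, forall n, N <= n -> (d, D) \notin [:: (3, 3); (5, 5)] ->
  0 < cnt R true (between d D) (between d D) 0 n.
Proof.
move=> d5 D3 dD; have [N HN] := low_nonempty; exists N => n nN ok.
by apply: leq_trans (low_cnt _ _ _); apply: HN.
Qed.

Lemma joinable_between d D : d <= 5 -> 3 <= D -> d <= D ->
  joinable R (between d D) (join_size d).
Proof.
by move=> d5 D3 dD; apply: joinable_size => //; rewrite /between leq_maxl geq_max dD.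
Qed.

Lemma proper_between d D : d < D -> (d, D) \notin [:: (3, 3); (5, 5)].
Proof.
move=> dD; rewrite !inE !xpair_eqE.
by apply/norP; split; apply: contraTN dD => /andP [/eqP -> /eqP ->].
Qed.

(** As [k] is at most [B] there are finitely many pairs to treat. In each, degree k.+1 is the one
    that does not occur, and [density] is used with [p'] equal to [p]. *)
Lemma max_negligible B M : exists N, forall n, N <= n -> forall d k, d <= 5 -> d <= k ->
  2 <= k -> k <= B -> M * cnt R false (between d k) (between d k) 0 n <=
  low R (between d k.+1) n.
Proof.
have [N HN] : exists N, forall n, N <= n -> forall d, d < 6 -> forall k, k < B.+1 ->
    d <= k -> 2 <= k -> M * cnt R false (between d k) (between d k) 0 n <=
    low R (between d k.+1) n.
  apply: eventually_all => d d5; apply: eventually_all => k kB.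
  have [/andP [dk k2]|bad] := boolP ((d <= k) && (2 <= k)); last first.
    by exists 0 => n _ h h'; rewrite h h' in bad.
  have [g G] := max_gadget R k2 dk d5.
  have [N HN] := cnt_between_pos d5 (k2 : 3 <= k.+1) (leqW dk).
  have ok := proper_between (dk : d < k.+1).
  have [||m m1 H] := density (join_size d) _ G.
  - exact: between_sub.
  - by exists (maxn N 2); rewrite ?leq_maxr // HN ?leq_maxl.
  have J := joinable_between d5 (k2 : 3 <= k.+1) (leqW dk).
  have [|N' HN'] := H _ J _ (leqnn _) M; first by exists N => n nN; apply: HN.
  by exists N' => n nN _ _; apply: HN'.
by exists N => n nN d k d5 dk k2 kB; apply: HN.
Qed.

(** [D] is unbounded, so [density] is first applied to classes without an upper bound. Large [D] are
    then settled by one comparison class and monotonicity, and the remaining [D] are finitely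
    many. *)
Lemma min_negligible d M : 0 < d <= 4 -> exists N, forall n, N <= n ->
  forall D, 3 <= D -> d < D ->
  M * cnt R false (between d.+1 D) (between d.+1 D) 0 n <= low R (between d D) n.
Proof.
move=> d4; have d5 : d <= 5 by case/andP: d4 => _ /leqW.
have [g G] : exists g, gadget R (leq d) (leq d.+1) g.
  by apply: min_gadget d4 _ _; rewrite ?ltnn // => x /andP [].
have posD D : 3 <= D -> d < D -> exists N, forall n, N <= n ->
    0 < cnt R true (between d D) (between d D) 0 n.
  move=> D3 dD; have [N HN] := cnt_between_pos d5 D3 (ltnW dD).
  by exists N => n nN; apply: HN => //; apply: proper_between.
have subl D : subpred (between d D) (leq d) by move=> x /andP [].
have [||m m1 H] := density (join_size d) _ G.
- by move=> x; apply: ltnW.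
- have [||N HN] := posD (d + 3); rewrite ?leq_addl // -?[d.+1]addn1 ?leq_add2l //.
  exists (maxn N 2); first exact: leq_maxr.
  exact: leq_trans (HN _ (leq_maxl _ _)) (leq_cnt R true _ (subl _) (subl _) (leqnn 0)).
(* A graph of order [m] has degrees at most [m], so the upper bound [D0] excludes no graph of that
   order; d + 3 secures [3 <= D0] and [d < D0]. *)
pose D0 := maxn m (d + 3).
have D03 : 3 <= D0 by rewrite leq_max leq_addl orbT.
have dD0 : d < D0 by rewrite leq_max -[d.+1]addn1 leq_add2l orbT.
have [|N1 HN1] := H (between d D0) (joinable_between d5 D03 (ltnW dD0)) (posD _ D03 dD0) _ M.
  apply/subset_leq_card/subsetP => X /gclsP [h1 h2 h3 h4 [h5 _]].
  have dX v : between d D0 (degree X v).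
    rewrite /between h3 ?inE //= leq_max degree_nbr //.
    by apply/orP; left; apply: leq_trans (max_card _) _; rewrite card_ord.
  apply/gclsP; split=> //; split=> //.
  by rewrite leqn0 cards_eq0; apply/eqP/setP => v; rewrite !inE dX.
have [N2 HN2] : exists N, forall n, N <= n -> forall D, D < D0 -> 3 <= D -> d < D ->
    M * cnt R false (between d.+1 D) (between d.+1 D) 0 n <= low R (between d D) n.
  apply: eventually_all => D _.
  have [/andP [D3 dD]|bad] := boolP ((3 <= D) && (d < D)); last first.
    by exists 0 => n _ h h'; rewrite h h' in bad.
  have [g' G'] : exists g, gadget R (between d D) (between d.+1 D) g.
    apply: min_gadget d4 _ _; last by rewrite /between ltnn.
    move=> x /andP [dx xm]; rewrite /between dx; apply: leq_trans xm _.
    by rewrite geq_max ltnW.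
  have [||m' m'1 H'] := density (join_size d) _ G'.
  - by apply: between_sub.
  - by have [N HN] := posD D D3 dD; exists (maxn N 2); rewrite ?leq_maxr // HN ?leq_maxl.
  have [N HN] := H' _ (joinable_between d5 D3 (ltnW dD)) (posD D D3 dD) (leqnn _) M.
  by exists N => n nN _ _; apply: HN.
exists (maxn N1 N2) => n; rewrite geq_max => /andP [n1 n2] D D3 dD.
have [DD|DD] := ltnP D D0; first exact: HN2.
apply: leq_trans (low_sub n (between_sub (leqnn d) DD)).
apply: leq_trans (HN1 n n1); rewrite leq_mul2l; apply/orP; right.
by apply: leq_cnt => // x /andP [].
Qed.

End Negligible.

Section DegreeBounds.
Variables (n : nat) (G : {set {set 'I_n}}).

Lemma min_degree_leq v : min_degree G <= degree G v.
Proof.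
rewrite /min_degree; have := mem_index_enum v; elim: (index_enum _) => // u s IH.
rewrite inE big_cons geq_min => /predU1P [->|/IH ->]; first by rewrite leqnn.
by rewrite orbT.
Qed.

(** [d <= n] takes care of [n] as the default value of the minimum. *)
Lemma leq_min_degree d : d <= n -> (forall v, d <= degree G v) -> d <= min_degree G.
Proof.
move=> dn H; rewrite /min_degree; elim/big_ind: _ => // x y dx dy.
by rewrite leq_min dx.
Qed.

Lemma max_degree_leq D : (max_degree G <= D) = [forall v, degree G v <= D].
Proof.
apply/bigmax_leqP/forallP => H v; first exact: H.
by move=> _; apply: H.
Qed.

End DegreeBounds.

(** * Exceptional graphs within the ambient class *)

Section Main.
Variable R : realType.

Definition degree_class n d D : {set {set {set 'I_n}}} :=
  [set G : {set {set 'I_n}} | [&& simple_graph G, `[< planar R G >],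
    d <= min_degree G <= 5 & max_degree G <= D]].

Lemma low_degree_class n d D d' D' : d <= d' -> D' <= D ->
  low R (between d' D') n <= #|degree_class n d D|.
Proof.
move=> dd DD; apply/subset_leq_card/subsetP => G; rewrite inE.
case/andP=> GC /exists_inP [v _ v5].
have [h1 h2 h3 h4 _] := gclsP _ _ _ _ _ _ _ GC.
have bnd u : between d' D' (degree G u) by apply: h3; rewrite inE.
rewrite inE h1 (asboolT h4) /= (leq_trans (min_degree_leq _ v) v5) andbT; apply/andP; split.
  apply: leq_min_degree => [|u]; last by have /andP [h _] := bnd u; apply: leq_trans h.
  have /andP [h _] := bnd v; apply: leq_trans dd (leq_trans h _).
  by rewrite degree_nbr // -[X in _ <= X]card_ord max_card.
by rewrite max_degree_leq; apply/forallP => u; have /andP [_ h] := bnd u; apply: leq_trans DD.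
Qed.

Lemma card_between n d D (X : {set {set {set 'I_n}}}) :
  (forall G, G \in X -> [/\ simple_graph G, planar R G & forall v, d <= degree G v <= D]) ->
  #|X| <= cnt R false (between d D) (between d D) 0 n.
Proof.
move=> H; apply/subset_leq_card/subsetP => G /H [h1 h2 h3]; apply/gclsP; split=> //.
- by apply/forall_inP => e _; apply: subsetT.
- by move=> v _; apply: h3.
split=> //; rewrite leqn0 cards_eq0; apply/eqP/setP => v; rewrite !inE.
by rewrite /between h3.
Qed.

(** A graph outside the event has all degrees above [d2], and is compared with graphs where [d2] is
    allowed, or all degrees below [D1], and is compared with graphs where one larger degree is
    allowed. Both comparison classes lie in the ambient one, whence the factor 2. *)
Lemma exceptions_negligible B M : exists N, forall n, N <= n -> forall d d2 D1 D,
  d <= 5 -> 0 < d2 -> d <= d2 -> d <= D -> 3 <= D -> D1 <= D -> D1 <= B ->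
  (odd n -> (d, D) \notin [:: (3, 3); (5, 5)]) ->
  0 < #|degree_class n d D| /\
  M * #|[set G in degree_class n d D | ~~ ((min_degree G <= d2) && (D1 <= max_degree G))]| <=
  2 * #|degree_class n d D|.
Proof.
have [N0 HN0] := low_nonempty R.
have [N1 HN1] := max_negligible R (maxn B 2) M.
have [N2 HN2] : exists N, forall n, N <= n -> forall d, d < 5 -> 0 < d -> forall D, 3 <= D -> d < D ->
    M * cnt R false (between d.+1 D) (between d.+1 D) 0 n <= low R (between d D) n.
  apply: eventually_all => d d4; case: (posnP d) => [->|d0]; first by exists 0.
  have [|N HN] := @min_negligible R d M; first by rewrite d0.
  by exists N => n nN _; apply: HN.
exists (maxn (maxn N0 N1) (maxn N2 1)) => n.
rewrite !geq_max -!andbA => /and4P [n0 n1 n2 npos] d d2 D1 D d5 d20 dd2 dD D3 D1D D1B par.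
pose v0 := Ordinal npos.
set A := degree_class n d D; split.
  by apply: leq_trans (HN0 n n0 d D d5 D3 dD par) (low_degree_class _ _ _).
pose Bmin := [set G in A | d2 < min_degree G].
pose Bmax := [set G in A | max_degree G < D1].
have AP G : G \in A -> [/\ simple_graph G, planar R G, d <= min_degree G <= 5
    & forall v, d <= degree G v <= D].
  rewrite inE => /and4P [h1 /asboolP h2 h3 h4]; split=> // v.
  case/andP: h3 => h3 _; rewrite (leq_trans h3 (min_degree_leq _ _)).
  by move: h4; rewrite max_degree_leq => /forallP ->.
have sub : [set G in A | ~~ ((min_degree G <= d2) && (D1 <= max_degree G))] \subset Bmin :|: Bmax.
  by apply/subsetP => G; rewrite !in_set negb_and -!ltnNge => /andP [-> ->].
apply: leq_trans (_ : M * #|Bmin| + M * #|Bmax| <= _).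
  rewrite -mulnDr leq_mul2l; apply/orP; right; apply: leq_trans (subset_leq_card sub) _.
  exact: leq_card_setU.
rewrite mul2n -addnn; apply: leq_add.
  have BP G : G \in Bmin -> [/\ simple_graph G, planar R G, d2 < 5 & forall v, d2 < degree G v <= D].
    rewrite in_set => /andP [/AP [h1 h2 /andP [_ h3] h4] h5]; split=> //.
      exact: leq_trans h5 h3.
    by move=> v; rewrite (leq_trans h5 (min_degree_leq _ _)); have /andP [] := h4 v.
  (* A member of [Bmin] shows that d2 < 5, its minimum degree being at most 5, and that d2 < D. *)
  have [E|[G0 /BP [_ _ d25 /(_ v0) h]]] := set_0Vmem Bmin; first by rewrite E cards0 muln0.
  have dD2 : d2 < D by case/andP: h; apply: leq_trans.
  apply: leq_trans (_ : low R (between d2 D) n <= _); last exact: low_degree_class.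
  apply: leq_trans (HN2 n n2 d2 d25 d20 D D3 dD2); rewrite leq_mul2l.
  by apply/orP; right; apply: card_between => G /BP [].
(* Raising D1 - 1 to at least 2 makes k.+1 at least 3, as the comparison of maximum degrees
   requires; k < D still holds because 3 <= D. *)
pose k := maxn D1.-1 2.
have BP G : G \in Bmax -> [/\ simple_graph G, planar R G, 0 < D1 & forall v, d <= degree G v <= k].
  rewrite in_set => /andP [/AP [h1 h2 _ h4] h5]; have D10 : 0 < D1 by apply: leq_trans h5.
  split=> // v; have /andP [-> _] := h4 v; rewrite leq_max; apply/orP; left.
  have : max_degree G <= D1.-1 by rewrite -ltnS prednK.
  by rewrite max_degree_leq => /forallP ->.
have [E|[G0 /BP [_ _ D10 /(_ v0) h]]] := set_0Vmem Bmax; first by rewrite E cards0 muln0.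
have dk : d <= k by case/andP: h; apply: leq_trans.
have kB : k <= maxn B 2.
  by rewrite geq_max leq_maxr andbT leq_max (leq_trans (leq_pred _) D1B).
have kD : k < D by rewrite /k; case: ltngtP D1D D3 => //; lia.
apply: leq_trans (_ : low R (between d k.+1) n <= _); last exact: low_degree_class.
apply: leq_trans (HN1 n n1 d k d5 dk (leq_maxr _ _) kB); rewrite leq_mul2l.
by apply/orP; right; apply: card_between => G /BP [].
Qed.

End Main.

End Classes.
Import Classes.

(** * The limit *)

Import all_classical all_reals all_analysis zify ring lra.

Import Order.TTheory GRing.Theory Num.Theory.
Import numFieldNormedType.Exports.

Local Open Scope classical_set_scope.
Local Open Scope ring_scope.

Lemma planar_graphs_class (R : realType) n (d1 D2 : int) (d D : nat) :
  d1 <= d%:Z -> (forall m : nat, d1 <= m%:Z -> (d <= m)%N) -> D2 = D%:Z ->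
  planar_graphs R n d1 5 0 D2 = degree_class R n d D.
Proof.
move=> h1 h2 ->; apply/setP => G; rewrite !inE; congr [&& _, _, _ & _].
  apply/andP/andP => [[/h2 -> ?]|[h ?]]; split=> //.
  by apply: le_trans h1 _; rewrite lez_nat.
Qed.

Theorem theorem19p1 (R : realType) (K : R) (d1 d2 D1 D2 : nat -> int)
    (hyps : \forall n \near \oo,
      [/\ (* (a) *) d1 n <= Num.min 5 (Num.min (d2 n) (D2 n)) /\ D1 n <= D2 n,
          (* (b) *) odd n -> (d1 n, D2 n) \notin [:: (3, 3); (5, 5)],
          (* (c) *) 3 <= D2 n
        & (* (d) *) 0 < d2 n /\ (D1 n)%:~R <= K]) :
  (fun n : nat =>
     uniform_probability R
       (planar_graphs R n (d1 n) 5 0 (D2 n))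
       (planar_graphs R n (d1 n) (d2 n) (D1 n) (D2 n)))
    @ \oo --> (1 : R).
Proof.
have [B KB] := archi K.
apply/cvgrPdist_le => eps eps0.
(* The exceptions will be at most a fraction 2 / M of the class, hence at most [eps]. *)
have [M HM] := archi (2 / eps).
have [N HN] := exceptions_negligible R B M.
have [N' _ HN'] := hyps.
exists (maxn N N') => //= n /=; rewrite geq_max => /andP [nN nN'].
have [[ha1 ha2] hb hc [hd1 hd2]] := HN' n nN'.
have D1B : (`|Num.max (D1 n) 0| <= B)%N.
  have : D1 n <= B%:Z.
    by rewrite -(ler_int R); apply: le_trans hd2 (le_trans KB _).
  by lia.
(* Degrees are natural numbers, so negative lower bounds may be raised to 0 without changing the
   classes. *)
pose d := `|Num.max (d1 n) 0|%N; pose D := `|D2 n|%N.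
have [] := HN n nN d `|d2 n|%N `|Num.max (D1 n) 0|%N D; rewrite /d /D; try lia.
  move=> /hb; rewrite !inE !xpair_eqE; lia.
rewrite -/d -/D.
have -> : planar_graphs R n (d1 n) 5 0 (D2 n) = degree_class R n d D.
  by apply: planar_graphs_class; rewrite /d /D; [lia|move=> m|]; lia.
set A := degree_class R n d D => A0 HA.
set E := planar_graphs _ _ _ _ _ _.
set X := [set G in A | _]%SET in HA.
have XA : X \subset A by apply/fintype.subsetP => G; rewrite inE => /andP [].
have AE : A :&: E = A :\: X.
  apply/setP => G; rewrite finset.in_setI finset.in_setD.
  have [GA|nGA] := boolP (G \in A); last by rewrite andbF.
  have -> : (G \in X) = ~~ ((min_degree G <= `|d2 n|) && (`|Num.max (D1 n) 0| <= max_degree G))%N.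
    by rewrite inE GA.
  rewrite negbK andbT /=.
  have := GA; rewrite inE => /and4P [h1 h2 /andP [h3 _] h4].
  by rewrite inE h1 h2 /=; move: h3 h4; rewrite /d /D; lia.
have XAle : (#|X| <= #|A|)%N by apply: subset_leq_card.
have cE : #|A :&: E|%:R = #|A|%:R - #|X|%:R :> R.
  by rewrite AE cardsD (finset.setIidPr XA) natrB.
have a0 : 0 < #|A|%:R :> R by rewrite ltr0n.
have := HA; rewrite -(ler_nat R) !natrM => HA'.
rewrite /uniform_probability cE.
have x0 : 0 <= #|X|%:R :> R by [].
move: (#|A|%:R) (#|X|%:R) a0 x0 HA' => a x a0 x0 HA'.
have -> : 1 - (a - x) / a = x / a by field; rewrite gt_eqF.
rewrite ger0_norm ?divr_ge0 ?(ltW a0) // ler_pdivrMr // mulrC.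
have : 2 / eps * x <= 2 * a by apply: le_trans HA'; rewrite ler_wpM2r.
by rewrite mulrAC ler_pdivrMr // -mulrA ler_pM2l.
Qed.
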